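(* Let $T>0$, $M>0$, $0<\delta\le\tfrac12$. Let $\lambda\colon[0,T]\to\mathbb{R}$ satisfy $\|\lambda\|_{\mathrm{Lip}(1/2)}\le1$, $\lambda\in C^{1,\delta}([0,T])$ and $\|\lambda\|_{C^{1,\delta}([0,T])}\le M$. Let $\gamma=\gamma^\lambda$ be the slit generated by $\lambda$ and $\Gamma(t):=\gamma(t^2)$ for $t\in[0,\sqrt T]$. (1) If $0<\delta<\frac12$, then $\Gamma$ is $C^{1,\frac12+\delta}$ regular on $[0,\sqrt T]$; in fact $$\|\Gamma\|_{C^{1,\frac12+\delta}([0,\sqrt T])}\le N\qquad\text{and}\qquad \inf_{t\in[0,\sqrt T]}|\Gamma'(t)|\ge\frac1N,$$ where $N=N(M,T,\delta)>0$ depends only on $M,T,\delta$. (2) If $\delta=\frac12$, then $\Gamma'$ is weakly Lipschitz in the sense that $$|\Gamma'(t_1)-\Gamma'(t_2)|\le N|t_1-t_2|\max\left\{1,\log\frac1{|t_1-t_2|}\right\}\qquad(0\le t_1<t_2\le\sqrt T),$$ where $N=N(M,T)>0$ depends only on $M,T$.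
   Context: Let $\mathbb{H}=\{z\in\mathbb{C}:\operatorname{Im} z>0\}$. For a continuous $\lambda\colon[0,T]\to\mathbb{R}$ (a driving function), let $g_t(z)$ be the solution of the chordal Loewner equation $\partial_t g_t(z)=\frac{2}{g_t(z)-\lambda(t)}$, $g_0(z)=z$, and let $H_t$ be the set of $z\in\mathbb{H}$ for which the solution is well defined up to time $t$ (i.e. $g_s(z)\ne\lambda(s)$ for $s\in[0,t]$). Then $g_t\colon H_t\to\mathbb{H}$ is conformal. Put $\|\lambda\|_{\mathrm{Lip}(1/2)}=\sup_{t_1\ne t_2\in[0,T]}|\lambda(t_1)-\lambda(t_2)|/|t_1-t_2|^{1/2}$. It is known (Marshall–Rohde, Lind) that if $\|\lambda\|_{\mathrm{Lip}(1/2)}<4$, then $\lambda$ generates a slit $\gamma=\gamma^{\lambda}\colon[0,T]\to\overline{\mathbb{H}}$: a simple curve with $\gamma(0)=\lambda(0)\in\mathbb{R}$, $\gamma(t)\in\mathbb{H}$ for $0<t\le T$, and $H_t=\mathbb{H}\setminus\gamma([0,t])$ for all $t$; moreover $\gamma(t)=\lim_{y\downarrow0}g_t^{-1}(\lambda(t)+iy)$. For a function $\phi$ on a closed interval $I$, $n\in\mathbb{N}$, $0<\alpha\le1$: $\|\phi\|_{C^{n,\alpha}(I)}=\sum_{k=0}^n\sup_I|\phi^{(k)}|+\sup_{t_1\ne t_2\in I}\frac{|\phi^{(n)}(t_1)-\phi^{(n)}(t_2)|}{|t_1-t_2|^\alpha}$, with one-sided derivatives at endpoints. A curve is ''$C^{n,\alpha}$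 regular'' on $I$ if its $C^{n,\alpha}(I)$ norm is finite and its derivative is nonzero everywhere on $I$. *)

(* Defs.v *)
From Stdlib Require Import Reals Lra Psatz ClassicalEpsilon.
From Coquelicot Require Import Coquelicot.
Open Scope R_scope.

Definition Icc (a b : R) (t : R) : Prop := a <= t <= b.

(* This is [is_derive] with [locally t] restricted to [a, b]: two-sided inside
   the interval and one-sided at the endpoints.  Every [l] qualifies when
   [a = b]. *)
Definition is_derive_within {V : NormedModule R_AbsRing} (a b : R)
    (f : R -> V) (t : R) (l : V) : Prop :=
  filterdiff f (within (Icc a b) (locally t)) (fun h : R => scal h l).

Definition ex_derive_within {V : NormedModule R_AbsRing} (a b : R)
    (f : R -> V) (t : R) : Prop :=
  exists l : V, is_derive_within a b f t l.

(* Unspecified where the derivative does not exist. *)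
Definition Derive_within {V : NormedModule R_AbsRing} (a b : R)
    (f : R -> V) (t : R) : V :=
  epsilon (inhabits zero) (is_derive_within a b f t).

Fixpoint Derive_n_within {V : NormedModule R_AbsRing} (a b : R)
    (f : R -> V) (n : nat) : R -> V :=
  match n with
  | O => f
  | S k => Derive_within a b (Derive_n_within a b f k)
  end.

Definition sup_norm {V : NormedModule R_AbsRing} (a b : R) (f : R -> V) : Rbar :=
  Lub_Rbar (fun r => exists t, Icc a b t /\ r = norm (f t)).

(* [Rpower x alpha] is the usual real power only for [0 < x], which holds here
   since [t1 <> t2].  For [alpha = 1/2] this is the Lip(1/2) seminorm. *)
Definition Holder_seminorm {V : NormedModule R_AbsRing} (alpha a b : R)
    (f : R -> V) : Rbar :=
  Lub_Rbar (fun r => exists t1 t2, Icc a b t1 /\ Icc a b t2 /\ t1 <> t2 /\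
    r = norm (minus (f t1) (f t2)) / Rpower (Rabs (t1 - t2)) alpha).

Fixpoint sup_norms {V : NormedModule R_AbsRing} (n : nat) (a b : R)
    (f : R -> V) : Rbar :=
  match n with
  | O => sup_norm a b f
  | S k => Rbar_plus (sup_norms k a b f) (sup_norm a b (Derive_n_within a b f n))
  end.

(* Meaningful when [f] is [n] times differentiable on [a, b]. *)
Definition Holder_norm {V : NormedModule R_AbsRing} (n : nat) (alpha a b : R)
    (f : R -> V) : Rbar :=
  Rbar_plus (sup_norms n a b f)
            (Holder_seminorm alpha a b (Derive_n_within a b f n)).

Definition differentiable_n {V : NormedModule R_AbsRing} (n : nat) (a b : R)
    (f : R -> V) : Prop :=
  forall k t, (k < n)%nat -> Icc a b t ->
    ex_derive_within a b (Derive_n_within a b f k) t.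

Definition in_Holder {V : NormedModule R_AbsRing} (n : nat) (alpha a b : R)
    (f : R -> V) : Prop :=
  differentiable_n n a b f /\ is_finite (Holder_norm n alpha a b f).

(* So the generic norms above, taken in [C_R_NormedModule], use the modulus. *)
Lemma norm_C_R_Cmod (z : C) : @norm R_AbsRing C_R_NormedModule z = Cmod z.
Proof.
  unfold Cmod, norm; simpl; unfold prod_norm, norm; simpl; unfold abs; simpl.
  f_equal; rewrite !Rmult_1_r, <- !Rabs_mult, !Rabs_right; nra.
Qed.

Definition Holder_regular (n : nat) (alpha a b : R) (c : R -> C) : Prop :=
  in_Holder (V := C_R_NormedModule) n alpha a b c /\
  forall t, Icc a b t ->
    ex_derive_within (V := C_R_NormedModule) a b c t /\
    Derive_within (V := C_R_NormedModule) a b c t <> RtoC 0.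

Definition upper_half_plane (z : C) : Prop := 0 < Im z.

(* For [t = 0] the differential equation is void, and only [z <> lam 0] is
   required. *)
Definition Loewner_solution (lam : R -> R) (t : R) (z : C) (g : R -> C) : Prop :=
  g 0 = z /\
  forall s, Icc 0 t s ->
    g s <> RtoC (lam s) /\
    is_derive_within (V := C_R_NormedModule) 0 t g s
      (RtoC 2 / (g s - RtoC (lam s)))%C.

Definition Loewner_domain (lam : R -> R) (t : R) (z : C) : Prop :=
  upper_half_plane z /\ exists g : R -> C, Loewner_solution lam t z g.

Definition generates_slit (lam : R -> R) (T : R) (gam : R -> C) : Prop :=
  continuous_on (Icc 0 T) gam /\
  (forall s t, Icc 0 T s -> Icc 0 T t -> gam s = gam t -> s = t) /\
  gam 0 = RtoC (lam 0) /\
  (forall t, 0 < t <= T -> upper_half_plane (gam t)) /\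
  (forall t, Icc 0 T t -> forall z : C,
     Loewner_domain lam t z <->
     upper_half_plane z /\ ~ (exists s, Icc 0 t s /\ gam s = z)).

Definition slit_sq (gam : R -> C) (t : R) : C := gam (t ^ 2).

(* Main.v *)
Require Import Defs.
From Stdlib Require Import ssreflect Reals Lra Psatz ClassicalEpsilon.
From Coquelicot Require Import Coquelicot.
Open Scope R_scope.

(** Let [l] be the derivative of [lam].  For a slit point [gam t], the centred
    flow [Z_t r = g_r (gam t) - lam r] satisfies [Z_t 0 = gam t - gam 0] and
    [Z_t' = 2 / Z_t - l] before time [t].  It reaches [0] at time [t]: [Z_t ^ 2]
    has a bounded derivative, hence a limit at [t], and if this limit were not
    [0] the solution would continue up to time [t], which is impossible for a
    point of the slit ([hitting_flow_of_escape]).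

    The half-Hoelder constant [1] confines the flow to the cone
    [|Re (Z_t r)| <= sqrt (t - r) <= Im (Z_t r)] ([flow_Re_bound],
    [flow_Im_lower]).  So [Z_t r] is of size [sqrt (t - r)], and the sum of the
    flows of two slit points is at least as large as each of these sizes.

    For [a < b] the difference [B = Z_b ^ 2 - Z_a ^ 2] solves the linear equation
    [B' = - 2 l / (Z_b + Z_a) * B], with [B a = Z_b(a) ^ 2], about
    [- 4 (b - a)].  Solving it backwards from [a] to [0] and replacing
    [(Z_b + Z_a) / 2] by [Z_a] in the exponent, one finds that the increment
    [(gam b - gam 0) ^ 2 - (gam a - gam 0) ^ 2] is about [- 4 (b - a)] times the
    exponential of the integral of [l / Z_a] over [0, a]
    ([flow_sq_increment]).  In the time [u = sqrt t], put
    [z u = gam (u ^ 2) - gam 0] and let [J u] be the integral of [l / Z_t] over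
    [0, t] with [t = u ^ 2].  Then [(z ^ 2)' = - 8 u exp (J u)], so the
    derivative of the slit is [- 4 exp (J u) / Q u] with [Q u = z u / u].

    The gain of half a derivative is a gain for [J] ([flow_log_increment]).
    Since [1 / Z_b - 1 / Z_a] is half the derivative of [Z_b - Z_a], the
    function [l] can be replaced by [l - l a] in [J b - J a], at the cost of
    boundary terms of size [sqrt b - sqrt a].  With [h = b - a], what is left is
    bounded by the integral of [(a - r) ^ d * h / ((b - r) * sqrt (a - r))] over
    [0, a], and by a similar integral over [a, b].  They are at most
    of order [h ^ (1/2 + d)] for [d < 1/2], and [h log (1 / h)] for [d = 1/2].

    Finally [Q u ^ 2] is the average over [x] in [0, 1] of [- 8 x exp (J (u x))],
    so [Q] has the same modulus of continuity as [J], and so has the derivative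
    [- 4 exp (J u) / Q u] ([root_derivative_increment]).  It is bounded above
    and below because [1 <= |Q u| <= 3] and [J] is bounded. *)

(** * Calculus of complex-valued functions of a real variable *)

(** Continuity and derivatives are taken on real and imaginary parts, so that
    the differentiation rules reduce to the real ones. *)
Definition Ccont (f : R -> C) (x : R) : Prop :=
  continuous (fun r => Re (f r)) x /\ continuous (fun r => Im (f r)) x.

Definition Cderiv (f : R -> C) (x : R) (l : C) : Prop :=
  is_derive (fun r => Re (f r)) x (Re l) /\
  is_derive (fun r => Im (f r)) x (Im l).

Lemma is_derive_eq (f : R -> R) (x l l' : R) : is_derive f x l -> l = l' -> is_derive f x l'.
Proof. intros H <-; exact H. Qed.

Lemma Cderiv_eq f x (l l' : C) : Cderiv f x l -> l = l' -> Cderiv f x l'.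
Proof. intros H <-; exact H. Qed.

Lemma Cderiv_cont f x l : Cderiv f x l -> Ccont f x.
Proof.
  intros [H1 H2]; split; apply: ex_derive_continuous; eexists; eassumption.
Qed.

Lemma Ccont_const c x : Ccont (fun _ => c) x.
Proof. split; apply continuous_const. Qed.

Lemma Ccont_RtoC f x : continuous f x -> Ccont (fun r => RtoC (f r)) x.
Proof. intros H; split; simpl; [exact H | apply continuous_const]. Qed.

Lemma Ccont_plus f g x : Ccont f x -> Ccont g x -> Ccont (fun r => (f r + g r)%C) x.
Proof. intros [? ?] [? ?]; split; simpl; now apply: continuous_plus. Qed.

Lemma Ccont_minus f g x : Ccont f x -> Ccont g x -> Ccont (fun r => (f r - g r)%C) x.
Proof. intros [? ?] [? ?]; split; simpl; now apply: continuous_minus. Qed.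

Lemma Ccont_mult f g x : Ccont f x -> Ccont g x -> Ccont (fun r => (f r * g r)%C) x.
Proof.
  intros [? ?] [? ?]; split; simpl.
  - apply: continuous_minus; now apply: continuous_mult.
  - apply: continuous_plus; now apply: continuous_mult.
Qed.

Lemma Cderiv_const c x : Cderiv (fun _ => c) x 0.
Proof. split; simpl; apply: is_derive_const. Qed.

Lemma Cderiv_RtoC f x l : is_derive f x l -> Cderiv (fun r => RtoC (f r)) x (RtoC l).
Proof. intros H; split; simpl; [exact H | apply: is_derive_const]. Qed.

Lemma Cderiv_plus f g x l m :
  Cderiv f x l -> Cderiv g x m -> Cderiv (fun r => (f r + g r)%C) x (l + m).
Proof. intros [? ?] [? ?]; split; simpl; now apply: is_derive_plus. Qed.

Lemma Cderiv_minus f g x l m :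
  Cderiv f x l -> Cderiv g x m -> Cderiv (fun r => (f r - g r)%C) x (l - m).
Proof. intros [? ?] [? ?]; split; simpl; now apply: is_derive_minus. Qed.

Lemma is_derive_mulR (f g : R -> R) x l m :
  is_derive f x l -> is_derive g x m ->
  is_derive (fun r => f r * g r) x (l * g x + f x * m).
Proof.
  intros H1 H2; apply: (is_derive_mult f g x l m H1 H2).
  intros; apply Rmult_comm.
Qed.

Lemma Cderiv_mult f g x l m :
  Cderiv f x l -> Cderiv g x m ->
  Cderiv (fun r => (f r * g r)%C) x (l * g x + f x * m).
Proof.
  intros [H1 H2] [H3 H4]; split; simpl.
  - eapply is_derive_eq.
    + apply: is_derive_minus; apply: is_derive_mulR; eassumption.
    + unfold minus, plus, opp; simpl; unfold Re, Im; ring.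
  - eapply is_derive_eq.
    + apply: is_derive_plus; apply: is_derive_mulR; eassumption.
    + unfold minus, plus, opp; simpl; unfold Re, Im; ring.
Qed.

Lemma Cderiv_scale f c x l :
  Cderiv f (c * x) l -> Cderiv (fun v => f (c * v)) x (c * l).
Proof.
  intros [H1 H2].
  assert (H : is_derive (fun v => c * v) x c)
    by (auto_derive; [exact I | ring]).
  split; simpl.
  - eapply is_derive_eq; [apply: (is_derive_comp (fun r => Re (f r))); eassumption |].
    unfold scal; simpl; unfold mult; simpl; unfold Re, Im; ring.
  - eapply is_derive_eq; [apply: (is_derive_comp (fun r => Im (f r))); eassumption |].
    unfold scal; simpl; unfold mult; simpl; unfold Re, Im; ring.
Qed.

Lemma Cderiv_ext_loc f g x l :
  locally x (fun r => f r = g r) -> Cderiv f x l -> Cderiv g x l.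
Proof.
  intros E [H1 H2]; split; [eapply is_derive_ext_loc, H1 | eapply is_derive_ext_loc, H2];
    revert E; apply filter_imp; intros r ->; reflexivity.
Qed.

(** ** Monotonicity and mean value inequalities *)

Lemma nonincreasing_of_derive (f f' : R -> R) a b :
  a <= b ->
  (forall x, a <= x <= b -> continuous f x) ->
  (forall x, a < x < b -> is_derive f x (f' x)) ->
  (forall x, a < x < b -> f' x <= 0) ->
  f b <= f a.
Proof.
  intros Hab Hc Hd Hn.
  destruct (Req_dec a b) as [->|Hne]; [lra|].
  destruct (MVT_gen f a b (fun x => Rmin 0 (f' x))) as [c [_ Hc2]].
  - rewrite Rmin_left ?Rmax_right; try lra; intros x Hx.
    rewrite Rmin_right; [now apply Hd | now apply Hn].
  - rewrite Rmin_left ?Rmax_right; try lra; intros x Hx.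
    apply continuity_pt_filterlim, Hc; lra.
  - pose proof (Rmin_l 0 (f' c)); nra.
Qed.

(** Pairing with the direction of [f b - f a] reduces the complex mean value
    inequality to monotonicity of a real function. *)
Lemma Cmod_increment_le (f f' : R -> C) (m m' : R -> R) a b :
  a <= b ->
  (forall x, a <= x <= b -> Ccont f x) ->
  (forall x, a <= x <= b -> continuous m x) ->
  (forall x, a < x < b -> Cderiv f x (f' x)) ->
  (forall x, a < x < b -> is_derive m x (m' x)) ->
  (forall x, a < x < b -> Cmod (f' x) <= m' x) ->
  Cmod (f b - f a) <= m b - m a.
Proof.
  intros Hab Hcf Hcm Hdf Hdm Hle.
  set (d := (f b - f a)%C).
  pose (phi := fun x => (Re d * Re (f x) + Im d * Im (f x)) - Cmod d * m x).
  pose (phi' := fun x => (Re d * Re (f' x) + Im d * Im (f' x)) - Cmod d * m' x).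
  assert (CS : forall z, Re d * Re z + Im d * Im z <= Cmod d * Cmod z).
  { intros z. rewrite -Cmod_conj -Cmod_mult.
    eapply Rle_trans; [|apply (re_le_Cmod (Cconj d * z))].
    eapply Rle_trans; [|apply Rle_abs].
    simpl; unfold Re, Im; lra. }
  assert (H : phi b <= phi a).
  { apply (nonincreasing_of_derive phi phi'); auto.
    - intros x Hx; destruct (Hcf x Hx).
      unfold phi; apply: continuous_minus.
      + apply: continuous_plus; apply: continuous_mult; auto using continuous_const.
      + apply: continuous_mult; auto using continuous_const.
    - intros x Hx; destruct (Hdf x Hx).
      unfold phi, phi'; apply: is_derive_minus.
      + apply: is_derive_plus; now apply: is_derive_scal.
      + apply: is_derive_scal; auto.
    - intros x Hx; unfold phi'.
      pose proof (CS (f' x)); pose proof (Hle x Hx); pose proof (Cmod_ge_0 d); nra. }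
  unfold phi in H.
  assert (E : Cmod d ^ 2 = Re d * (Re (f b) - Re (f a)) + Im d * (Im (f b) - Im (f a))).
  { rewrite Cmod2_alt; unfold d; simpl; unfold Re, Im; ring. }
  destruct (Req_dec (Cmod d) 0) as [Z|NZ].
  - rewrite Z.
    assert (m a <= m b); [|lra].
    enough (- m b <= - m a) by lra.
    apply (nonincreasing_of_derive (fun x => - m x) (fun x => - m' x)); auto.
    + intros x Hx; apply: continuous_opp; auto.
    + intros x Hx; apply: is_derive_opp; auto.
    + intros x Hx; pose proof (Hle x Hx); pose proof (Cmod_ge_0 (f' x)); lra.
  - assert (0 < Cmod d) by (pose proof (Cmod_ge_0 d); lra). nra.
Qed.

(** Gronwall in both directions: the weights [exp (-2 k)] and [exp (2 k)] make
    the squared modulus monotone. *)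
Lemma Cmod_gronwall (f f' : R -> C) (k k' : R -> R) a b :
  a <= b ->
  (forall x, a <= x <= b -> Ccont f x) ->
  (forall x, a <= x <= b -> continuous k x) ->
  (forall x, a < x < b -> Cderiv f x (f' x)) ->
  (forall x, a < x < b -> is_derive k x (k' x)) ->
  (forall x, a < x < b -> Cmod (f' x) <= k' x * Cmod (f x)) ->
  Cmod (f b) <= Cmod (f a) * exp (k b - k a) /\
  Cmod (f a) <= Cmod (f b) * exp (k b - k a).
Proof.
  intros Hab Hcf Hck Hdf Hdk Hle.
  pose (n := fun x => Re (f x) * Re (f x) + Im (f x) * Im (f x)).
  pose (n' := fun x => 2 * (Re (f x) * Re (f' x) + Im (f x) * Im (f' x))).
  assert (En : forall x, n x = Cmod (f x) ^ 2)
    by (intros x; rewrite Cmod2_alt; unfold n; ring).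
  assert (Hn' : forall x, a < x < b -> Rabs (n' x) <= 2 * k' x * n x).
  { intros x Hx.
    replace (n' x) with (2 * Re (Cconj (f x) * f' x)%C)
      by (unfold n'; simpl; unfold Re, Im; ring).
    rewrite Rabs_mult (Rabs_right 2); [|lra].
    pose proof (re_le_Cmod (Cconj (f x) * f' x)) as H.
    rewrite Cmod_mult Cmod_conj in H.
    rewrite En. pose proof (Hle x Hx). pose proof (Cmod_ge_0 (f x)). nra. }
  assert (Hcn : forall x, a <= x <= b -> continuous n x).
  { intros x Hx; destruct (Hcf x Hx).
    apply: continuous_plus; now apply: continuous_mult. }
  assert (Hdn : forall x, a < x < b -> is_derive n x (n' x)).
  { intros x Hx; destruct (Hdf x Hx); eapply is_derive_eq.
    - apply: is_derive_plus; apply: is_derive_mulR; eassumption.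
    - unfold n', plus; simpl; ring. }
  assert (Hexp : forall c x, a <= x <= b -> continuous (fun r => exp (c * k r)) x).
  { intros c x Hx. apply (continuous_comp (fun r => c * k r) exp).
    - apply: continuous_mult; auto using continuous_const.
    - apply: ex_derive_continuous; eexists; apply is_derive_exp. }
  assert (Dexp : forall c x, a < x < b ->
     is_derive (fun r => exp (c * k r)) x (c * k' x * exp (c * k x))).
  { intros c x Hx. eapply is_derive_eq.
    - apply: (is_derive_comp exp); [apply is_derive_exp|].
      apply: is_derive_scal; auto.
    - unfold scal; simpl; unfold mult; simpl; ring. }
  assert (Hm : n b * exp (-2 * k b) <= n a * exp (-2 * k a)).
  { apply (nonincreasing_of_derive (fun x => n x * exp (-2 * k x))
       (fun x => n' x * exp (-2 * k x) + n x * (-2 * k' x * exp (-2 * k x)))); auto.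
    - intros x Hx; apply: continuous_mult; auto.
    - intros x Hx; apply: is_derive_mulR; auto.
    - intros x Hx. pose proof (Hn' x Hx) as H. pose proof (Rle_abs (n' x)).
      pose proof (exp_pos (-2 * k x)). nra. }
  assert (Hp : - (n b * exp (2 * k b)) <= - (n a * exp (2 * k a))).
  { apply (nonincreasing_of_derive (fun x => - (n x * exp (2 * k x)))
       (fun x => - (n' x * exp (2 * k x) + n x * (2 * k' x * exp (2 * k x))))); auto.
    - intros x Hx; apply: continuous_opp; apply: continuous_mult; auto.
    - intros x Hx; apply: is_derive_opp; apply: is_derive_mulR; auto.
    - intros x Hx. pose proof (Hn' x Hx) as H. pose proof (Rle_abs (- n' x)) as H2.
      rewrite Rabs_Ropp in H2. pose proof (exp_pos (2 * k x)). nra. }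
  assert (E2 : forall x y, exp (2 * x) = exp (x - y) ^ 2 * exp (2 * y)).
  { intros x y; replace (exp (x - y) ^ 2) with (exp (x - y) * exp (x - y)) by ring.
    rewrite -!exp_plus; f_equal; ring. }
  assert (Sq : forall x y c, 0 <= y -> 0 < c -> x ^ 2 <= y ^ 2 * c ^ 2 -> x <= y * c)
    by (intros x y c Hy Hc H; assert (0 <= y * c) by nra; nra).
  split; apply Sq; auto using Cmod_ge_0, exp_pos; rewrite -!En.
  - assert (E : exp (-2 * k a) = exp (k b - k a) ^ 2 * exp (-2 * k b)).
    { replace (-2 * k a) with (2 * - k a) by ring.
      replace (-2 * k b) with (2 * - k b) by ring.
      rewrite (E2 (- k a) (- k b)); do 3 f_equal; ring. }
    rewrite E in Hm. pose proof (exp_pos (-2 * k b)). nra.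
  - rewrite (E2 (k b) (k a)) in Hp. pose proof (exp_pos (2 * k a)). nra.
Qed.

Lemma is_derive_pos_part_sq x :
  is_derive (fun u => Rmax 0 u * Rmax 0 u) x (2 * Rmax 0 x).
Proof.
  destruct (total_order_T x 0) as [[L|E]|L].
  - rewrite Rmax_left; [|lra].
    apply (is_derive_ext_loc (fun _ => 0)).
    + exists (mkposreal (- x) ltac:(lra)); intros y Hy.
      unfold ball in Hy; simpl in Hy; unfold AbsRing_ball, abs, minus, plus, opp in Hy;
        simpl in Hy.
      apply Rabs_def2 in Hy; rewrite Rmax_left; lra.
    + rewrite Rmult_0_r; apply: is_derive_const.
  - subst x; rewrite Rmax_left; [|lra]; rewrite Rmult_0_r.
    apply is_derive_Reals; intros eps Heps.
    exists (mkposreal eps Heps); intros h Hh Hlt; simpl in Hlt.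
    rewrite Rplus_0_l (Rmax_left 0 0); [|lra].
    replace ((Rmax 0 h * Rmax 0 h - 0 * 0) / h - 0) with (Rmax 0 h * Rmax 0 h / h)
      by (field; auto).
    unfold Rdiv; rewrite Rabs_mult Rabs_inv.
    assert (0 < Rabs h) by now apply Rabs_pos_lt.
    assert (0 <= Rmax 0 h <= Rabs h).
    { split; [apply Rmax_l | apply Rmax_lub; [lra | apply Rle_abs]]. }
    rewrite Rabs_right; [|nra].
    apply (Rmult_lt_reg_r (Rabs h)); auto.
    rewrite Rmult_assoc Rinv_l; nra.
  - rewrite Rmax_right; [|lra].
    apply (is_derive_ext_loc (fun u => u * u)).
    + exists (mkposreal x L); intros y Hy.
      unfold ball in Hy; simpl in Hy; unfold AbsRing_ball, abs, minus, plus, opp in Hy;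
        simpl in Hy.
      apply Rabs_def2 in Hy; rewrite Rmax_right; lra.
    + auto_derive; [exact I | ring].
Qed.

(** Composing [f] with the square of the positive part of [c - x] makes the sign
    condition unconditional, so no first exit time is needed. *)
Lemma barrier (f f' : R -> R) a b c :
  a <= b ->
  (forall x, a <= x <= b -> continuous f x) ->
  (forall x, a < x < b -> is_derive f x (f' x)) ->
  f a < c ->
  (forall x, a < x < b -> f x < c -> f' x <= 0) ->
  f b <= f a.
Proof.
  intros Hab Hc Hd Ha Hn.
  pose (q := fun u => Rmax 0 u * Rmax 0 u).
  assert (H : - q (c - f b) <= - q (c - f a)).
  { apply (nonincreasing_of_derive (fun x => - q (c - f x))
      (fun x => - ((- f' x) * (2 * Rmax 0 (c - f x))))); auto.
    - intros x Hx; apply: continuous_opp; apply (continuous_comp (fun r => c - f r) q).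
      + apply: continuous_minus; auto using continuous_const.
      + apply: ex_derive_continuous; eexists; apply is_derive_pos_part_sq.
    - intros x Hx; apply: is_derive_opp; apply: (is_derive_comp q).
      + apply is_derive_pos_part_sq.
      + eapply is_derive_eq; [apply: is_derive_minus; [apply: is_derive_const | auto]|].
        unfold minus, plus, opp, zero; simpl; ring.
    - intros x Hx. destruct (Rlt_dec (f x) c) as [L|L].
      + pose proof (Hn x Hx L). pose proof (Rmax_l 0 (c - f x)). nra.
      + rewrite Rmax_left; lra. }
  unfold q in H; rewrite (Rmax_right 0 (c - f a)) in H; [|lra].
  destruct (Rle_dec 0 (c - f b)).
  - rewrite Rmax_right in H; [nra | lra].
  - rewrite Rmax_left in H; [nra | lra].
Qed.

(** The limit is the supremum of [f + m - m b], which is nondecreasing, while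
    [f - m + m b] is nonincreasing and lies above it. *)
Lemma limit_at_end (f m : R -> R) a b :
  a < b ->
  (forall x y, a <= x <= y -> y < b -> Rabs (f y - f x) <= m y - m x) ->
  (forall x, a <= x < b -> m x <= m b) ->
  exists L, forall x, a <= x < b -> Rabs (f x - L) <= m b - m x.
Proof.
  intros Hab Hf Hm.
  pose (S := fun r => exists y, a <= y < b /\ r = f y - (m b - m y)).
  assert (K : forall x y, a <= x < b -> a <= y < b ->
     f y - (m b - m y) <= f x + (m b - m x)).
  { intros x y Hx Hy; pose proof (Hm x Hx); pose proof (Hm y Hy).
    destruct (Rle_dec x y) as [L|L].
    - pose proof (Hf x y ltac:(lra) ltac:(lra)) as H1; apply Rabs_le_between in H1; lra.
    - pose proof (Hf y x ltac:(lra) ltac:(lra)) as H1; apply Rabs_le_between in H1; lra. }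
  destruct (completeness S) as [L [HL1 HL2]].
  - exists (f a + (m b - m a)); intros r [y [Hy ->]]; apply K; lra.
  - exists (f a - (m b - m a)); exists a; split; [lra | reflexivity].
  - exists L; intros x Hx; apply Rabs_le_between; split.
    + enough (L <= f x + (m b - m x)) by lra.
      apply HL2; intros r [y [Hy ->]]; now apply K.
    + enough (f x - (m b - m x) <= L) by lra.
      apply HL1; exists x; split; [lra | reflexivity].
Qed.

Lemma locally_of_dist (P : R -> Prop) x e :
  0 < e -> (forall y, Rabs (y - x) < e -> P y) -> locally x P.
Proof. intros He H; exists (mkposreal e He); intros y Hy; apply H, Hy. Qed.

Lemma continuous_of_bound (f g : R -> R) x e : 0 < e ->
  continuous g x -> g x = 0 ->
  (forall y, Rabs (y - x) < e -> Rabs (f y - f x) <= g y) ->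
  continuous f x.
Proof.
  intros Hpos Hg E H; apply continuity_pt_filterlim.
  apply continuity_pt_filterlim in Hg.
  intros eps He; destruct (Hg eps He) as [d [Hd1 Hd2]].
  exists (Rmin d e); split; [apply Rmin_pos; lra|]; intros y [Hy1 Hy2].
  pose proof (Rmin_l d e); pose proof (Rmin_r d e).
  specialize (Hd2 y); unfold dist in *; simpl in *; unfold R_dist in *.
  rewrite E Rminus_0_r in Hd2. specialize (Hd2 ltac:(split; [auto | lra])).
  pose proof (Rle_abs (g y)). pose proof (H y ltac:(lra)). lra.
Qed.

Lemma Im_abs_le_Cmod z : Rabs (Im z) <= Cmod z.
Proof. eapply Rle_trans; [apply Rmax_r | apply Rmax_Cmod]. Qed.

Lemma Cmod_le_sum z : Cmod z <= Rabs (Re z) + Rabs (Im z).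
Proof.
  pose proof (Cmod2_alt z) as E; rewrite -(pow2_abs (Re z)) -(pow2_abs (Im z)) in E.
  pose proof (Rabs_pos (Re z)); pose proof (Rabs_pos (Im z)); pose proof (Cmod_ge_0 z).
  nra.
Qed.

Lemma Ccont_of_bound (f : R -> C) (g : R -> R) x e : 0 < e ->
  continuous g x -> g x = 0 ->
  (forall y, Rabs (y - x) < e -> Cmod (f y - f x) <= g y) ->
  Ccont f x.
Proof.
  intros He Hg E H; split; apply (continuous_of_bound _ g x e He Hg E);
    intros y Hy; (eapply Rle_trans; [|apply (H y Hy)]).
  - apply (re_le_Cmod (f y - f x)).
  - apply (Im_abs_le_Cmod (f y - f x)).
Qed.

Lemma C_limit_at_end (f : R -> C) (m : R -> R) a b :
  a < b ->
  (forall x y, a <= x <= y -> y < b -> Cmod (f y - f x) <= m y - m x) ->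
  (forall x, a <= x < b -> m x <= m b) ->
  exists L : C, forall x, a <= x < b -> Cmod (f x - L) <= 2 * (m b - m x).
Proof.
  intros Hab Hf Hm.
  destruct (limit_at_end (fun r => Re (f r)) m a b) as [L1 HL1]; auto.
  { intros x y Hxy Hy; eapply Rle_trans; [|apply (Hf x y Hxy Hy)].
    apply (re_le_Cmod (f y - f x)). }
  destruct (limit_at_end (fun r => Im (f r)) m a b) as [L2 HL2]; auto.
  { intros x y Hxy Hy; eapply Rle_trans; [|apply (Hf x y Hxy Hy)].
    apply (Im_abs_le_Cmod (f y - f x)). }
  exists (L1, L2); intros x Hx; eapply Rle_trans; [apply Cmod_le_sum|].
  pose proof (HL1 x Hx); pose proof (HL2 x Hx); simpl; unfold Re, Im in *; simpl.
  unfold Rminus in *; lra.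
Qed.

Definition extend_by (t : R) (f : R -> C) (L : C) (r : R) : C :=
  match Rlt_dec r t with left _ => f r | right _ => L end.

Lemma extend_by_left t f L r : r < t -> extend_by t f L r = f r.
Proof. intros; unfold extend_by; destruct (Rlt_dec r t); [auto | lra]. Qed.

Lemma extend_by_right t f L r : t <= r -> extend_by t f L r = L.
Proof. intros; unfold extend_by; destruct (Rlt_dec r t); [lra | auto]. Qed.

Lemma extend_by_locally t f L r : r < t -> locally r (fun y => f y = extend_by t f L y).
Proof.
  intros Hr; apply (locally_of_dist _ r (t - r)); [lra|]; intros y Hy.
  apply Rabs_def2 in Hy; rewrite extend_by_left; auto; lra.
Qed.

Lemma Cderiv_extend_by t f L r l : r < t -> Cderiv f r l -> Cderiv (extend_by t f L) r l.
Proof. intros Hr; apply Cderiv_ext_loc, extend_by_locally, Hr. Qed.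

Lemma Ccont_extend_by t f L (g : R -> R) a : a < t ->
  (forall r, r < t -> Ccont f r) ->
  (forall r, a <= r < t -> Cmod (f r - L) <= g r) ->
  (forall r, 0 <= g r) -> continuous g t -> g t = 0 ->
  forall r, Ccont (extend_by t f L) r.
Proof.
  intros Ha Hf Hg Hg0 Hgc Hgt r.
  destruct (total_order_T r t) as [[Lt| ->]|Lt].
  - destruct (Hf r Lt) as [H1 H2]; pose proof (extend_by_locally t f L r Lt) as E.
    split; [eapply continuous_ext_loc, H1 | eapply continuous_ext_loc, H2];
      revert E; apply filter_imp; intros y <-; auto.
  - apply (Ccont_of_bound _ g t (t - a)); auto; [lra|]; intros y Hy.
    apply Rabs_def2 in Hy; rewrite (extend_by_right t f L t); [|lra].
    destruct (Rlt_dec y t).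
    + rewrite extend_by_left; auto; apply Hg; lra.
    + rewrite extend_by_right; [|lra].
      replace (L - L)%C with (RtoC 0) by ring; rewrite Cmod_0; auto.
  - apply (Ccont_of_bound _ (fun _ => 0) r (r - t)); auto using continuous_const; [lra|].
    intros y Hy; apply Rabs_def2 in Hy; rewrite !extend_by_right; try lra.
    replace (L - L)%C with (RtoC 0) by ring; rewrite Cmod_0; lra.
Qed.

(** ** The complex exponential *)

Definition Cexp (z : C) : C := (exp (Re z) * cos (Im z), exp (Re z) * sin (Im z)).

Lemma Cexp_0 : Cexp 0 = 1.
Proof. unfold Cexp; simpl; rewrite exp_0 cos_0 sin_0; unfold RtoC; f_equal; ring. Qed.

Lemma Cmod_Cexp z : Cmod (Cexp z) = exp (Re z).
Proof.
  pose proof (exp_pos (Re z)) as He.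
  unfold Cmod, Cexp; simpl fst; simpl snd.
  replace ((exp (Re z) * cos (Im z)) ^ 2 + (exp (Re z) * sin (Im z)) ^ 2)
    with (exp (Re z) ^ 2 * (Rsqr (sin (Im z)) + Rsqr (cos (Im z))))
    by (unfold Rsqr; ring).
  rewrite sin2_cos2 Rmult_1_r; apply sqrt_pow2; lra.
Qed.

Lemma Ccont_Cexp f x : Ccont f x -> Ccont (fun r => Cexp (f r)) x.
Proof.
  intros [H1 H2].
  assert (He : continuous (fun r => exp (Re (f r))) x).
  { apply (continuous_comp (fun r => Re (f r)) exp); auto.
    apply: ex_derive_continuous; eexists; apply is_derive_exp. }
  split; simpl; apply: continuous_mult; auto.
  - apply (continuous_comp (fun r => Im (f r)) cos); auto.
    apply: ex_derive_continuous; eexists; apply is_derive_cos.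
  - apply (continuous_comp (fun r => Im (f r)) sin); auto.
    apply: ex_derive_continuous; eexists; apply is_derive_sin.
Qed.

Lemma Cderiv_Cexp f x l :
  Cderiv f x l -> Cderiv (fun r => Cexp (f r)) x (l * Cexp (f x)).
Proof.
  intros [H1 H2].
  assert (He : is_derive (fun r => exp (Re (f r))) x (Re l * exp (Re (f x))))
    by (apply: (is_derive_comp exp); [apply is_derive_exp | exact H1]).
  split; simpl; (eapply is_derive_eq; [apply: is_derive_mulR; [exact He|]|]).
  - apply: (is_derive_comp cos); [apply is_derive_cos | exact H2].
  - unfold scal; simpl; unfold mult; simpl; unfold Re, Im; ring.
  - apply: (is_derive_comp sin); [apply is_derive_sin | exact H2].
  - unfold scal; simpl; unfold mult; simpl; unfold Re, Im; ring.
Qed.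

Lemma exp_nondecreasing x y : x <= y -> exp x <= exp y.
Proof. intros [H| ->]; [left; now apply exp_increasing | lra]. Qed.

Lemma Cexp_lipschitz z w K :
  Re z <= K -> Re w <= K -> Cmod (Cexp z - Cexp w) <= exp K * Cmod (z - w).
Proof.
  intros Hz Hw.
  pose (f := fun v : R => (w + RtoC v * (z - w))%C).
  assert (Hd : forall v, Cderiv f v (z - w)).
  { intros v; eapply Cderiv_eq.
    - apply Cderiv_plus; [apply Cderiv_const|].
      apply Cderiv_mult; [apply (Cderiv_RtoC (fun v => v)), is_derive_id | apply Cderiv_const].
    - cbv beta; change (RtoC one) with (RtoC 1); ring. }
  replace (Cexp z) with (Cexp (f 1)) by (unfold f; f_equal; ring).
  replace (Cexp w) with (Cexp (f 0)) by (unfold f; f_equal; ring).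
  eapply Rle_trans.
  - apply (Cmod_increment_le (fun v => Cexp (f v)) (fun v => ((z - w) * Cexp (f v))%C)
      (fun v => exp K * Cmod (z - w) * v) (fun v => exp K * Cmod (z - w))); try lra.
    + intros v _; apply Ccont_Cexp; eapply Cderiv_cont, Hd.
    + intros v _; apply: ex_derive_continuous; auto_derive; exact I.
    + intros v _; apply Cderiv_Cexp, Hd.
    + intros v _; auto_derive; [exact I | ring].
    + intros v Hv; rewrite Cmod_mult Cmod_Cexp Rmult_comm.
      apply Rmult_le_compat_r; [apply Cmod_ge_0|].
      apply exp_nondecreasing.
      unfold f; simpl; unfold Re in *; simpl. nra.
  - lra.
Qed.

(** * The centred flow of a point of the slit *)

(** The driving function [lam], with derivative [l], on the time interval from
    [0] to [T].  Both are defined and continuous on the whole line, so that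
    no one-sided limits occur. *)
Record driver (T M : R) (lam l : R -> R) : Prop := {
  driver_cont : forall r, continuous lam r;
  driver_cont' : forall r, continuous l r;
  driver_derive : forall r, 0 < r < T -> is_derive lam r (l r);
  driver_bound : forall r, Rabs (l r) <= M;
  driver_half : forall r s, 0 <= r <= T -> 0 <= s <= T ->
    Rabs (lam r - lam s) <= sqrt (Rabs (r - s)) }.

(** For a slit point [gam t] this is [Z r = g_r (gam t) - lam r], which reaches
    the singularity [0] exactly at time [t].  Values outside of [0, t] only
    make [Z] continuous on the whole line. *)
Record hitting_flow (l : R -> R) (t : R) (Z : R -> C) : Prop := {
  flow_cont : forall r, Ccont Z r;
  flow_end : Z t = 0;
  flow_pos : forall r, r < t -> 0 < Im (Z r);
  flow_ode : forall r, 0 < r < t -> Cderiv Z r (2 / Z r - RtoC (l r)) }.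

Lemma Im_pos_neq_0 z : 0 < Im z -> z <> 0.
Proof. intros H E; rewrite E in H; simpl in H; lra. Qed.

Lemma Cmod_sq z : Cmod z ^ 2 = Re z ^ 2 + Im z ^ 2.
Proof. apply Cmod2_alt. Qed.

Lemma Im_le_Cmod z : Im z <= Cmod z.
Proof.
  pose proof (Cmod_sq z); pose proof (Cmod_ge_0 z); nra.
Qed.

Lemma Re_2div z : Re (2 / z) = 2 * Re z / (Re z ^ 2 + Im z ^ 2).
Proof. unfold Cdiv, Cinv, Cmult, Rdiv, Re, Im; simpl. ring. Qed.

Lemma Im_2div z : Im (2 / z) = - 2 * Im z / (Re z ^ 2 + Im z ^ 2).
Proof. unfold Cdiv, Cinv, Cmult, Rdiv, Re, Im; simpl. ring. Qed.

Lemma Cdiv_Cmod_le (z w : C) a b :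
  0 < b -> Cmod z <= a -> b <= Cmod w -> Cmod (z / w) <= a / b.
Proof.
  intros Hb Ha Hw.
  rewrite Cmod_div; [|apply Cmod_gt_0; lra].
  pose proof (Cmod_ge_0 z).
  apply Rmult_le_compat; auto.
  - left; apply Rinv_0_lt_compat; lra.
  - now apply Rinv_le_contravar.
Qed.

Lemma continuous_sqrt_sub t r : continuous (fun x => sqrt (t - x)) r.
Proof.
  apply continuous_sqrt_comp; apply: continuous_minus;
    [apply continuous_const | apply continuous_id].
Qed.

Section Flow.

Context (T M : R) (lam l : R -> R) (HD : driver T M lam l).
Context (t : R) (Z : R -> C) (Ht : 0 < t <= T) (HZ : hitting_flow l t Z).

Lemma driver_bound_ge_0 : 0 <= M.
Proof. pose proof (driver_bound _ _ _ _ HD 0); pose proof (Rabs_pos (l 0)); lra. Qed.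

Lemma flow_neq_0 r : r < t -> Z r <> 0.
Proof. intros H; apply Im_pos_neq_0, (flow_pos _ _ _ HZ); lra. Qed.

Lemma flow_derive_Re_lam r : 0 < r < t ->
  is_derive (fun x => Re (Z x) + lam x) r
    (2 * Re (Z r) / (Re (Z r) ^ 2 + Im (Z r) ^ 2)).
Proof.
  intros Hr; destruct (flow_ode _ _ _ HZ r Hr) as [H _].
  eapply is_derive_eq.
  - apply: is_derive_plus; [exact H | apply (driver_derive _ _ _ _ HD); lra].
  - rewrite -Re_2div; unfold plus; simpl; unfold Re, Im; ring.
Qed.

Lemma flow_derive_Im r : 0 < r < t ->
  is_derive (fun x => Im (Z x)) r (- 2 * Im (Z r) / (Re (Z r) ^ 2 + Im (Z r) ^ 2)).
Proof.
  intros Hr; destruct (flow_ode _ _ _ HZ r Hr) as [_ H].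
  eapply is_derive_eq; [exact H|].
  rewrite -Im_2div; simpl; unfold Re, Im; ring.
Qed.

Lemma flow_mod_pos r : r < t -> 0 < Re (Z r) ^ 2 + Im (Z r) ^ 2.
Proof. intros H; pose proof (flow_pos _ _ _ HZ r H); nra. Qed.

(** The point [Re (Z r) + lam r] moves away from [lam r].  If it started
    further than [sqrt (t - r)] from it, the half-Hoelder driver could never
    catch it, whereas they meet at time [t]. *)
Lemma flow_Re_bound r : 0 <= r <= t -> Rabs (Re (Z r)) <= sqrt (t - r).
Proof.
  intros Hr.
  assert (Hc : forall x, continuous (fun x => Re (Z x) + lam x) x).
  { intros x; apply: continuous_plus;
      [apply (flow_cont _ _ _ HZ) | apply (driver_cont _ _ _ _ HD)]. }
  assert (Hl : forall x, r <= x <= t -> Rabs (lam x - lam r) <= sqrt (t - r)).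
  { intros x Hx; eapply Rle_trans; [apply (driver_half _ _ _ _ HD); lra|].
    apply sqrt_le_1_alt; rewrite Rabs_right; lra. }
  assert (Et : Re (Z t) = 0) by (rewrite (flow_end _ _ _ HZ); reflexivity).
  apply Rabs_le_between; split; apply Rnot_lt_le; intros L.
  - assert (B : Re (Z t) + lam t <= Re (Z r) + lam r).
    { apply (barrier (fun x => Re (Z x) + lam x)
        (fun x => 2 * Re (Z x) / (Re (Z x) ^ 2 + Im (Z x) ^ 2)) r t (lam r - sqrt (t - r)));
        try lra; auto.
      - intros x Hx; apply flow_derive_Re_lam; lra.
      - intros x Hx Hlt. pose proof (Hl x ltac:(lra)) as K; apply Rabs_le_between in K.
        pose proof (flow_mod_pos x ltac:(lra)) as P. apply Rinv_0_lt_compat in P.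
        unfold Rdiv; nra. }
    pose proof (Hl t ltac:(lra)) as K; apply Rabs_le_between in K; lra.
  - assert (B : - (Re (Z t) + lam t) <= - (Re (Z r) + lam r)).
    { apply (barrier (fun x => - (Re (Z x) + lam x))
        (fun x => - (2 * Re (Z x) / (Re (Z x) ^ 2 + Im (Z x) ^ 2)))
        r t (- (lam r + sqrt (t - r)))); try lra; auto.
      - intros x Hx; apply: continuous_opp; auto.
      - intros x Hx; apply: is_derive_opp; apply flow_derive_Re_lam; lra.
      - intros x Hx Hlt. pose proof (Hl x ltac:(lra)) as K; apply Rabs_le_between in K.
        pose proof (flow_mod_pos x ltac:(lra)) as P. apply Rinv_0_lt_compat in P.
        unfold Rdiv; nra. }
    pose proof (Hl t ltac:(lra)) as K; apply Rabs_le_between in K; lra.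
Qed.

(** [(Im Z ^ 2)' = - 4 Im Z ^ 2 / |Z| ^ 2] is at least [- 4]. *)
Lemma flow_Im_upper r : 0 <= r <= t -> Im (Z r) ^ 2 <= 4 * (t - r).
Proof.
  intros Hr.
  assert (H : - (Im (Z t) * Im (Z t) + 4 * t) <= - (Im (Z r) * Im (Z r) + 4 * r)).
  { apply (nonincreasing_of_derive (fun x => - (Im (Z x) * Im (Z x) + 4 * x))
     (fun x => - (4 - 4 * (Im (Z x) ^ 2 * / (Re (Z x) ^ 2 + Im (Z x) ^ 2))))); try lra.
    - intros x Hx; destruct (flow_cont _ _ _ HZ x); apply: continuous_opp.
      apply: continuous_plus; apply: continuous_mult; auto using continuous_const, continuous_id.
    - intros x Hx; apply: is_derive_opp; eapply is_derive_eq.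
      + apply: is_derive_plus.
        * apply: is_derive_mulR; apply flow_derive_Im; lra.
        * apply: is_derive_scal; apply: is_derive_id.
      + unfold plus, one, Rdiv; simpl; ring.
    - intros x Hx; pose proof (flow_mod_pos x ltac:(lra)) as P.
      enough (Im (Z x) ^ 2 * / (Re (Z x) ^ 2 + Im (Z x) ^ 2) <= 1) by lra.
      apply (Rmult_le_reg_r (Re (Z x) ^ 2 + Im (Z x) ^ 2)); auto.
      rewrite Rmult_assoc Rinv_l; nra. }
  rewrite (flow_end _ _ _ HZ) in H; simpl in H; nra.
Qed.

Lemma flow_Cmod_upper r : 0 <= r <= t -> Cmod (Z r) <= 3 * sqrt (t - r).
Proof.
  intros Hr.
  pose proof (flow_Re_bound r Hr) as H1; pose proof (flow_Im_upper r Hr) as H2.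
  pose proof (sqrt_pos (t - r)). pose proof (sqrt_sqrt (t - r) ltac:(lra)).
  pose proof (Cmod_sq (Z r)). pose proof (Cmod_ge_0 (Z r)).
  apply Rabs_le_between in H1. nra.
Qed.

Lemma flow_sq_ode r : 0 < r < t ->
  Cderiv (fun x => (Z x * Z x)%C) r (4 - 2 * RtoC (l r) * Z r).
Proof.
  intros Hr; pose proof (flow_ode _ _ _ HZ r Hr) as H.
  eapply Cderiv_eq; [apply Cderiv_mult; exact H|].
  field; apply flow_neq_0; lra.
Qed.

Lemma is_derive_pow32 r : r < t ->
  is_derive (fun x => (t - x) * sqrt (t - x)) r (- (3 / 2) * sqrt (t - r)).
Proof.
  intros Hr; auto_derive; [lra|].
  assert (0 < sqrt (t - r)) by (apply sqrt_lt_R0; lra).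
  replace (t + - r) with (t - r) by ring.
  pose proof (sqrt_sqrt (t - r) ltac:(lra)) as E.
  apply (Rmult_eq_reg_r (2 * sqrt (t - r))); [|lra].
  field_simplify; [|lra]. replace (sqrt (t - r) ^ 2) with (t - r) by nra. ring.
Qed.

Lemma is_derive_sqrt_sub r : r < t ->
  is_derive (fun x => sqrt (t - x)) r (- / (2 * sqrt (t - r))).
Proof.
  intros Hr; auto_derive; [lra|].
  assert (0 < sqrt (t - r)) by (apply sqrt_lt_R0; lra).
  replace (t + - r) with (t - r) by ring. field; lra.
Qed.

(** [(Z ^ 2)' = 4 - 2 l Z] with [Z] of size [sqrt (t - r)]: near time [t] the
    flow looks like [2 i sqrt (t - r)], the flow of a constant driver. *)
Lemma flow_sq_expansion r : 0 <= r <= t ->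
  Cmod (Z r * Z r + RtoC (4 * (t - r))) <= 4 * M * ((t - r) * sqrt (t - r)).
Proof.
  intros Hr.
  pose (f := fun x => (Z x * Z x + RtoC (4 * (t - x)))%C).
  assert (E : f t = 0).
  { unfold f; rewrite (flow_end _ _ _ HZ) Rminus_diag Rmult_0_r; ring. }
  change (Cmod (f r) <= 4 * M * ((t - r) * sqrt (t - r))).
  replace (Cmod (f r)) with (Cmod (f t - f r)).
  2:{ rewrite E; replace (0 - f r)%C with (- f r)%C by ring; apply Cmod_opp. }
  replace (4 * M * ((t - r) * sqrt (t - r))) with
    (- (4 * M) * ((t - t) * sqrt (t - t)) - - (4 * M) * ((t - r) * sqrt (t - r))) by ring.
  apply (Cmod_increment_le f (fun x => (- (2) * RtoC (l x) * Z x)%C)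
     (fun x => - (4 * M) * ((t - x) * sqrt (t - x)))
     (fun x => - (4 * M) * (- (3 / 2) * sqrt (t - x)))); try lra.
  - intros x Hx; apply Ccont_plus.
    + apply Ccont_mult; apply (flow_cont _ _ _ HZ).
    + apply Ccont_RtoC; apply: ex_derive_continuous; auto_derive; exact I.
  - intros x Hx; apply: continuous_mult; [apply continuous_const|].
    apply: continuous_mult; [|apply continuous_sqrt_sub].
    apply: ex_derive_continuous; auto_derive; exact I.
  - intros x Hx; eapply Cderiv_eq.
    + apply Cderiv_plus; [apply flow_sq_ode; lra|].
      apply (Cderiv_RtoC _ _ (-(4))); auto_derive; [exact I | ring].
    + rewrite RtoC_opp; ring.
  - intros x Hx; apply: is_derive_scal; apply is_derive_pow32; lra.
  - intros x Hx; rewrite !Cmod_mult Cmod_opp !Cmod_R (Rabs_right 2); [|lra].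
    pose proof (driver_bound _ _ _ _ HD x). pose proof (flow_Cmod_upper x ltac:(lra)).
    pose proof (Cmod_ge_0 (Z x)). pose proof (Rabs_pos (l x)).
    pose proof (sqrt_pos (t - x)). nra.
Qed.

(** While [Im Z ^ 2 < t - r], the bound on the real part makes the ratio
    [Im Z ^ 2 / (t - r)] decrease in [r], whereas the expansion of [Z ^ 2] makes
    it tend to [4]. *)
Lemma flow_Im_lower r : 0 <= r <= t -> sqrt (t - r) <= Im (Z r).
Proof.
  intros Hr.
  destruct (Req_dec r t) as [->|Hne].
  { rewrite (flow_end _ _ _ HZ) Rminus_diag sqrt_0; simpl; lra. }
  assert (Hy : 0 < Im (Z r)) by (apply (flow_pos _ _ _ HZ); lra).
  enough (t - r <= Im (Z r) ^ 2).
  { rewrite -(sqrt_pow2 (Im (Z r))); [now apply sqrt_le_1_alt | lra]. }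
  apply Rnot_lt_le; intros L.
  pose proof driver_bound_ge_0 as HM.
  pose (d := / (1 + 4 * M)).
  assert (Hd : 0 < d) by (apply Rinv_0_lt_compat; lra).
  assert (Ed : d * (1 + 4 * M) = 1) by (apply Rinv_l; lra).
  pose (s := Rmin (t - r) (d * d)).
  assert (Hs : 0 < s <= t - r /\ s <= d * d).
  { unfold s; split; [split|].
    - apply Rmin_pos; nra.
    - apply Rmin_l.
    - apply Rmin_r. }
  pose (p := fun x => Im (Z x) * Im (Z x) * / (t - x)).
  pose (p' := fun x => Im (Z x) ^ 2 * / (t - x) ^ 2 *
     (1 - 4 * (t - x) * / (Re (Z x) ^ 2 + Im (Z x) ^ 2))).
  assert (Hd' : forall x, 0 < x < t -> is_derive p x (p' x)).
  { intros x Hx; eapply is_derive_eq.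
    - apply: is_derive_mulR.
      + apply: is_derive_mulR; apply flow_derive_Im; lra.
      + apply: is_derive_inv; [|lra].
        apply: is_derive_minus; [apply is_derive_const | apply is_derive_id].
    - unfold p', minus, plus, opp, zero, one; simpl.
      pose proof (flow_mod_pos x ltac:(lra)). field; split; lra. }
  assert (Hp : p (t - s) <= p r).
  { apply (barrier p p' r (t - s) 1); try lra.
    - intros x Hx; destruct (flow_cont _ _ _ HZ x).
      apply: continuous_mult; [apply: continuous_mult; auto|].
      apply (continuous_Rinv_comp (fun x => t - x)); [|lra].
      apply: ex_derive_continuous; auto_derive; exact I.
    - intros x Hx; apply Hd'; lra.
    - unfold p; apply (Rmult_lt_reg_r (t - r)); [lra|].
      rewrite Rmult_assoc Rinv_l; lra.
    - intros x Hx Hlt.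
      assert (Hlt2 : Im (Z x) ^ 2 < t - x).
      { unfold p in Hlt; apply (Rmult_lt_compat_r (t - x)) in Hlt; [|lra].
        rewrite Rmult_assoc Rinv_l in Hlt; lra. }
      pose proof (flow_Re_bound x ltac:(lra)) as HR; apply Rabs_le_between in HR.
      pose proof (sqrt_pos (t - x)). pose proof (sqrt_sqrt (t - x) ltac:(lra)).
      pose proof (flow_mod_pos x ltac:(lra)) as P.
      assert (1 <= 4 * (t - x) * / (Re (Z x) ^ 2 + Im (Z x) ^ 2)).
      { apply (Rmult_le_reg_r (Re (Z x) ^ 2 + Im (Z x) ^ 2)); auto.
        rewrite Rmult_assoc Rinv_l; nra. }
      assert (0 <= Im (Z x) ^ 2 * / (t - x) ^ 2).
      { apply Rmult_le_pos; [nra|]. left; apply Rinv_0_lt_compat; nra. }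
      unfold p'; nra. }
  assert (Hp1 : p r < 1).
  { unfold p; apply (Rmult_lt_reg_r (t - r)); [lra|].
    rewrite Rmult_assoc Rinv_l; lra. }
  assert (Hlt2 : Im (Z (t - s)) ^ 2 < s).
  { assert (Hq : p (t - s) < 1) by lra.
    unfold p in Hq; replace (t - (t - s)) with s in Hq by ring.
    apply (Rmult_lt_compat_r s) in Hq; [|lra].
    rewrite Rmult_assoc Rinv_l in Hq; lra. }
  pose proof (flow_sq_expansion (t - s) ltac:(lra)) as Q.
  pose proof (re_le_Cmod (Z (t - s) * Z (t - s) + RtoC (4 * (t - (t - s))))) as Q2.
  apply (Rle_trans _ _ _ Q2) in Q; apply Rabs_le_between in Q.
  replace (t - (t - s)) with s in Q by ring.
  assert (sqrt s <= d).
  { rewrite -(sqrt_pow2 d); [apply sqrt_le_1_alt; nra | lra]. }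
  assert (4 * M * (s * sqrt s) <= s).
  { replace (4 * M * (s * sqrt s)) with (s * (4 * M * sqrt s)) by ring.
    assert (4 * M * sqrt s <= 4 * M * d) by (apply Rmult_le_compat_l; lra).
    assert (s * (4 * M * sqrt s) <= s * 1) by (apply Rmult_le_compat_l; lra). lra. }
  simpl in Q; unfold Re, Im in *; nra.
Qed.

Lemma flow_Cmod_lower r : 0 <= r <= t -> sqrt (t - r) <= Cmod (Z r).
Proof.
  intros Hr; eapply Rle_trans; [now apply flow_Im_lower | apply Im_le_Cmod].
Qed.

(** The integral of [l / Z] converges at [t] because [1 / |Z|] is at most
    [1 / sqrt (t - r)]. *)
Lemma flow_log_exists : exists Phi : R -> C,
  (forall r, 0 <= r <= t -> Ccont Phi r) /\ Phi 0 = 0 /\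
  (forall r, 0 < r < t -> Cderiv Phi r (RtoC (l r) / Z r)).
Proof.
  pose (h1 := fun r => l r * (Re (Z r) * / (Re (Z r) ^ 2 + Im (Z r) ^ 2))).
  pose (h2 := fun r => l r * (- Im (Z r) * / (Re (Z r) ^ 2 + Im (Z r) ^ 2))).
  assert (C1 : forall r, r < t -> continuous (fun x => / (Re (Z x) ^ 2 + Im (Z x) ^ 2)) r).
  { intros r Hr; destruct (flow_cont _ _ _ HZ r).
    apply (continuous_Rinv_comp (fun x => Re (Z x) ^ 2 + Im (Z x) ^ 2)).
    - apply: continuous_plus; apply: continuous_mult; auto;
        apply: continuous_mult; auto using continuous_const.
    - pose proof (flow_mod_pos r Hr); lra. }
  assert (Ch1 : forall r, r < t -> continuous h1 r).
  { intros r Hr; destruct (flow_cont _ _ _ HZ r).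
    apply: continuous_mult; [apply (driver_cont' _ _ _ _ HD)|].
    apply: continuous_mult; auto. }
  assert (Ch2 : forall r, r < t -> continuous h2 r).
  { intros r Hr; destruct (flow_cont _ _ _ HZ r).
    apply: continuous_mult; [apply (driver_cont' _ _ _ _ HD)|].
    apply: continuous_mult; auto. apply: continuous_opp; auto. }
  assert (Dh : forall h : R -> R, (forall r, r < t -> continuous h r) ->
     forall r, r < t -> is_derive (fun x => RInt h 0 x) r (h r)).
  { intros h Hh r Hr; apply (is_derive_RInt h (fun x => RInt h 0 x) 0); auto.
    apply (locally_of_dist _ r (t - r)); [lra|]; intros y Hy; apply Rabs_def2 in Hy.
    apply: RInt_correct; apply: ex_RInt_continuous; intros z Hz; apply Hh.
    assert (Rmax 0 y < t) by (apply Rmax_lub_lt; lra); lra. }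
  pose (F := fun r : R => (RInt h1 0 r, RInt h2 0 r) : C).
  assert (DF : forall r, r < t -> Cderiv F r (RtoC (l r) / Z r)).
  { intros r Hr; split; simpl; (eapply is_derive_eq; [apply Dh; eauto|]).
    - unfold h1, Cdiv, Cinv, Cmult, Rdiv, Re, Im; simpl; ring.
    - unfold h2, Cdiv, Cinv, Cmult, Rdiv, Re, Im; simpl; ring. }
  pose (m := fun x => - (2 * M) * sqrt (t - x)).
  pose proof driver_bound_ge_0 as HM.
  assert (INC : forall x y, 0 <= x <= y -> y < t -> Cmod (F y - F x) <= m y - m x).
  { intros x y Hxy Hy.
    apply (Cmod_increment_le F (fun r => (RtoC (l r) / Z r)%C) m
       (fun r => - (2 * M) * (- / (2 * sqrt (t - r))))); try lra.
    - intros r Hr; eapply Cderiv_cont, DF; lra.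
    - intros r Hr; apply: continuous_mult; [apply continuous_const | apply continuous_sqrt_sub].
    - intros r Hr; apply DF; lra.
    - intros r Hr; apply: is_derive_scal; apply is_derive_sqrt_sub; lra.
    - intros r Hr. assert (0 < sqrt (t - r)) by (apply sqrt_lt_R0; lra).
      replace (- (2 * M) * (- / (2 * sqrt (t - r)))) with (M / sqrt (t - r)) by (field; lra).
      apply Cdiv_Cmod_le; auto.
      + rewrite Cmod_R; apply (driver_bound _ _ _ _ HD).
      + apply flow_Cmod_lower; lra. }
  assert (Hm : forall x, 0 <= x < t -> m x <= m t).
  { intros x Hx; unfold m; rewrite Rminus_diag sqrt_0.
    pose proof (sqrt_pos (t - x)); nra. }
  destruct (C_limit_at_end F m 0 t) as [L HL]; try lra; auto.
  exists (extend_by t F L); split; [|split].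
  - intros r _; apply (Ccont_extend_by t F L (fun r => 4 * M * sqrt (t - r)) 0); try lra.
    + intros x Hx; eapply Cderiv_cont, DF, Hx.
    + intros x Hx; eapply Rle_trans; [apply HL, Hx|].
      unfold m; rewrite Rminus_diag sqrt_0; lra.
    + intros x; pose proof (sqrt_pos (t - x)); repeat first [lra | apply Rmult_le_pos].
    + apply: continuous_mult; [apply continuous_const | apply continuous_sqrt_sub].
    + rewrite Rminus_diag sqrt_0; ring.
  - rewrite extend_by_left; [|lra]; unfold F; rewrite !RInt_point; reflexivity.
  - intros r Hr; apply Cderiv_extend_by, DF; lra.
Qed.

End Flow.

(** * Comparison of the flows of two points of the slit *)

(** [Phi] is a primitive of [l / Z].  Its end value [Phi t] is the logarithm of
    the derivative of the slit in the time [u = sqrt t], up to the factor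
    [- 4 u / (gam t - gam 0)]. *)
Record flow_log (l : R -> R) (t : R) (Z Phi : R -> C) : Prop := {
  log_cont : forall r, 0 <= r <= t -> Ccont Phi r;
  log_0 : Phi 0 = 0;
  log_ode : forall r, 0 < r < t -> Cderiv Phi r (RtoC (l r) / Z r) }.

Lemma Cmod_sub_sym z w : Cmod (z - w) = Cmod (w - z).
Proof. rewrite -Cmod_opp; f_equal; ring. Qed.

Lemma Cmod_sum_le_Im z w a b :
  0 <= a -> 0 <= b -> a <= Im z -> b <= Im w -> a + b <= Cmod (z + w).
Proof.
  intros; eapply Rle_trans; [|apply Im_le_Cmod]; simpl; unfold Im in *; lra.
Qed.

Section Log_bound.

Context (T M : R) (lam l : R -> R) (HD : driver T M lam l).
Context (t : R) (Z Phi : R -> C) (Ht : 0 < t <= T) (HZ : hitting_flow l t Z)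
  (HP : flow_log l t Z Phi).

Lemma flow_log_bound r : 0 <= r <= t -> Cmod (Phi r) <= 2 * M * sqrt t.
Proof.
  intros Hr; pose proof (driver_bound_ge_0 _ _ _ _ HD) as HM.
  replace (Phi r) with (Phi r - Phi 0)%C by (rewrite (log_0 _ _ _ _ HP); ring).
  eapply Rle_trans.
  - apply (Cmod_increment_le Phi (fun x => (RtoC (l x) / Z x)%C)
       (fun x => - (2 * M) * sqrt (t - x)) (fun x => - (2 * M) * (- / (2 * sqrt (t - x)))));
      try lra.
    + intros x Hx; apply (log_cont _ _ _ _ HP); lra.
    + intros x Hx; apply: continuous_mult; [apply continuous_const | apply continuous_sqrt_sub].
    + intros x Hx; apply (log_ode _ _ _ _ HP); lra.
    + intros x Hx; apply: is_derive_scal; apply is_derive_sqrt_sub; lra.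
    + intros x Hx; assert (0 < sqrt (t - x)) by (apply sqrt_lt_R0; lra).
      replace (- (2 * M) * (- / (2 * sqrt (t - x)))) with (M / sqrt (t - x)) by (field; lra).
      apply Cdiv_Cmod_le; auto.
      * rewrite Cmod_R; apply (driver_bound _ _ _ _ HD).
      * apply (flow_Cmod_lower T M lam l HD t Z Ht HZ); lra.
  - rewrite Rminus_0_r; pose proof (sqrt_pos (t - r)); nra.
Qed.

End Log_bound.

Section Two_times.

Context (T M : R) (lam l : R -> R) (HD : driver T M lam l).
Context (a b : R) (Hab : 0 < a < b) (HbT : b <= T).
Context (ZA ZB PA PB : R -> C) (HZA : hitting_flow l a ZA) (HZB : hitting_flow l b ZB)
  (HPA : flow_log l a ZA PA) (HPB : flow_log l b ZB PB).

Let HM : 0 <= M := driver_bound_ge_0 _ _ _ _ HD.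

(** From [|Z_b(a)| ^ 2 <= 9 (b - a)] and the Gronwall factor. *)
Definition gap_const (T M : R) : R := 9 * exp (4 * M * sqrt T).

Let K := gap_const T M.

Lemma gap_const_pos : 0 < K.
Proof. unfold K, gap_const; pose proof (exp_pos (4 * M * sqrt T)); lra. Qed.

Lemma flow_A_lower r : 0 <= r <= a -> sqrt (a - r) <= Im (ZA r).
Proof. apply (flow_Im_lower T M lam l HD a ZA); auto; lra. Qed.

Lemma flow_B_lower r : 0 <= r <= b -> sqrt (b - r) <= Im (ZB r).
Proof. apply (flow_Im_lower T M lam l HD b ZB); auto; lra. Qed.

Lemma flow_A_Cmod r : 0 <= r <= a -> sqrt (a - r) <= Cmod (ZA r).
Proof. apply (flow_Cmod_lower T M lam l HD a ZA); auto; lra. Qed.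

Lemma flow_B_Cmod r : 0 <= r <= b -> sqrt (b - r) <= Cmod (ZB r).
Proof. apply (flow_Cmod_lower T M lam l HD b ZB); auto; lra. Qed.

Lemma flow_sum_lower r : 0 <= r <= a -> sqrt (b - r) + sqrt (a - r) <= Cmod (ZB r + ZA r).
Proof.
  intros Hr; apply Cmod_sum_le_Im; auto using sqrt_pos.
  - apply flow_B_lower; lra.
  - apply flow_A_lower; lra.
Qed.

Lemma flow_gap_ode r : 0 < r < a -> Cderiv (fun x => (ZB x - ZA x)%C) r (2 / ZB r - 2 / ZA r).
Proof.
  intros Hr; eapply Cderiv_eq.
  - apply Cderiv_minus; [apply (flow_ode _ _ _ HZB) | apply (flow_ode _ _ _ HZA)]; lra.
  - ring.
Qed.

Lemma flow_sq_gap_ode r : 0 < r < a ->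
  Cderiv (fun x => (ZB x * ZB x - ZA x * ZA x)%C) r
    (- (2 * RtoC (l r)) * (ZB r - ZA r)).
Proof.
  intros Hr; eapply Cderiv_eq.
  - apply Cderiv_minus; eapply flow_sq_ode; try eassumption; lra.
  - ring.
Qed.

Lemma flow_gap_cont r : Ccont (fun x => (ZB x - ZA x)%C) r.
Proof. apply Ccont_minus; [apply (flow_cont _ _ _ HZB) | apply (flow_cont _ _ _ HZA)]. Qed.

Lemma flow_sq_gap_cont r : Ccont (fun x => (ZB x * ZB x - ZA x * ZA x)%C) r.
Proof.
  apply Ccont_minus; apply Ccont_mult; try apply (flow_cont _ _ _ HZB);
    apply (flow_cont _ _ _ HZA).
Qed.

Lemma Csq_sub_factor z w : (z * z - w * w = (z - w) * (z + w))%C.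
Proof. ring. Qed.

(** The difference of squares [B = Z_b^2 - Z_a^2] solves the linear equation
    [B' = - 2 l / (Z_b + Z_a) B], whose coefficient is integrable, and
    [B a = Z_b(a)^2] has size [b - a]. *)
Lemma flow_sq_gap_bound r : 0 <= r <= a ->
  Cmod (ZB r * ZB r - ZA r * ZA r) <= K * (b - a).
Proof.
  intros Hr.
  destruct (Cmod_gronwall (fun x => (ZB x * ZB x - ZA x * ZA x)%C)
    (fun x => (- (2 * RtoC (l x)) * (ZB x - ZA x))%C)
    (fun x => - (4 * M) * sqrt (a - x)) (fun x => - (4 * M) * (- / (2 * sqrt (a - x)))) r a)
    as [_ H]; try lra.
  - intros; apply flow_sq_gap_cont.
  - intros x Hx; apply: continuous_mult; [apply continuous_const | apply continuous_sqrt_sub].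
  - intros x Hx; apply flow_sq_gap_ode; lra.
  - intros x Hx; apply: is_derive_scal; apply is_derive_sqrt_sub; lra.
  - intros x Hx; assert (0 < sqrt (a - x)) by (apply sqrt_lt_R0; lra).
    replace (- (4 * M) * (- / (2 * sqrt (a - x)))) with (2 * M * / sqrt (a - x))
      by (field; lra).
    rewrite Csq_sub_factor !Cmod_mult Cmod_opp Cmod_mult !Cmod_R (Rabs_right 2); [|lra].
    pose proof (flow_sum_lower x ltac:(lra)) as S. pose proof (sqrt_pos (b - x)).
    assert (1 <= / sqrt (a - x) * Cmod (ZB x + ZA x)).
    { apply (Rmult_le_reg_l (sqrt (a - x))); auto.
      rewrite -Rmult_assoc Rinv_r; lra. }
    pose proof (driver_bound _ _ _ _ HD x). pose proof (Rabs_pos (l x)).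
    pose proof (Cmod_ge_0 (ZB x - ZA x)).
    replace (2 * M * / sqrt (a - x) * (Cmod (ZB x - ZA x) * Cmod (ZB x + ZA x)))
      with (2 * (M * Cmod (ZB x - ZA x)) * (/ sqrt (a - x) * Cmod (ZB x + ZA x))) by ring.
    assert (Rabs (l x) * Cmod (ZB x - ZA x) <= M * Cmod (ZB x - ZA x))
      by (apply Rmult_le_compat_r; lra).
    assert (0 <= M * Cmod (ZB x - ZA x)) by nra. nra.
  - eapply Rle_trans; [exact H|].
    rewrite (flow_end _ _ _ HZA).
    replace (ZB a * ZB a - 0 * 0)%C with (ZB a * ZB a)%C by ring.
    rewrite Cmod_mult.
    pose proof (flow_Cmod_upper T M lam l HD b ZB ltac:(lra) HZB a ltac:(lra)) as U.
    pose proof (Cmod_ge_0 (ZB a)). pose proof (sqrt_sqrt (b - a) ltac:(lra)).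
    assert (Cmod (ZB a) * Cmod (ZB a) <= 9 * (b - a)) by nra.
    assert (exp (- (4 * M) * sqrt (a - a) - - (4 * M) * sqrt (a - r)) <= exp (4 * M * sqrt T)).
    { apply exp_nondecreasing. rewrite Rminus_diag sqrt_0.
      assert (sqrt (a - r) <= sqrt T) by (apply sqrt_le_1_alt; lra). nra. }
    unfold K, gap_const.
    pose proof (exp_pos (- (4 * M) * sqrt (a - a) - - (4 * M) * sqrt (a - r))). nra.
Qed.

Lemma flow_gap_bound r : 0 <= r <= a -> Cmod (ZB r - ZA r) <= K * (b - a) / sqrt (b - r).
Proof.
  intros Hr; assert (0 < sqrt (b - r)) by (apply sqrt_lt_R0; lra).
  pose proof (flow_sq_gap_bound r Hr) as B; rewrite Csq_sub_factor Cmod_mult in B.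
  pose proof (flow_sum_lower r Hr); pose proof (sqrt_pos (a - r)).
  apply (Rmult_le_reg_r (sqrt (b - r))); auto.
  unfold Rdiv; rewrite Rmult_assoc Rinv_l; [|lra].
  pose proof (Cmod_ge_0 (ZB r - ZA r)). nra.
Qed.

(** The bound is integrable near [a], and its integral is concentrated at
    distance of order [b - a] from [a].  The denominator is used with
    [w = Z_b + Z_a] and with [w = Z_b]. *)
Lemma flow_gap_ratio_bound r (w : C) : 0 <= r < a -> sqrt (b - r) <= Cmod w ->
  Cmod ((ZB r - ZA r) / (w * ZA r)) <= K * ((b - a) / ((b - r) * sqrt (a - r))).
Proof.
  intros Hr Hw; assert (0 < sqrt (b - r)) by (apply sqrt_lt_R0; lra).
  assert (0 < sqrt (a - r)) by (apply sqrt_lt_R0; lra).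
  pose proof (sqrt_sqrt (b - r) ltac:(lra)) as E.
  replace (K * ((b - a) / ((b - r) * sqrt (a - r)))) with
    (K * (b - a) / sqrt (b - r) / (sqrt (b - r) * sqrt (a - r))).
  2:{ rewrite -{3}E; field; lra. }
  apply Cdiv_Cmod_le.
  - nra.
  - apply flow_gap_bound; lra.
  - rewrite Cmod_mult; pose proof (flow_A_Cmod r ltac:(lra)).
    apply Rmult_le_compat; lra.
Qed.

Definition sq_increment_const (T M : R) : R :=
  4 * gap_const T M * gap_const T M * M * exp (2 * M * sqrt T)
  + 4 * M * exp (2 * M * sqrt T).

(** Multiplying [B] by [exp Phi_a] leaves the derivative
    [B exp Phi_a l D / ((Z_b + Z_a) Z_a)] with [D = Z_b - Z_a], whose integral is
    negligible with respect to [b - a]; so [B 0] is [B a exp (Phi_a a)] up to an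
    error, and [B a = Z_b(a)^2] is about [- 4 (b - a)].  The arctangent comes
    from integrating the bound of [flow_gap_ratio_bound]. *)
Lemma flow_sq_increment :
  Cmod (ZB 0 * ZB 0 - ZA 0 * ZA 0 + RtoC (4 * (b - a)) * Cexp (PA a))
    <= sq_increment_const T M * ((b - a) * sqrt (b - a)).
Proof.
  pose (c := exp (2 * M * sqrt T)).
  assert (HcA : forall r, 0 <= r <= a -> Cmod (Cexp (PA r)) <= c).
  { intros r Hr; rewrite Cmod_Cexp; apply exp_nondecreasing.
    eapply Rle_trans; [apply Rle_abs|]. eapply Rle_trans; [apply re_le_Cmod|].
    eapply Rle_trans; [apply (flow_log_bound T M lam l HD a ZA PA); auto; lra|].
    assert (sqrt a <= sqrt T) by (apply sqrt_le_1_alt; lra). nra. }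
  assert (Hc : 0 < c) by apply exp_pos.
  assert (Hh : 0 < sqrt (b - a)) by (apply sqrt_lt_R0; lra).
  pose proof (sqrt_sqrt (b - a) ltac:(lra)) as Eh.
  pose proof gap_const_pos as HK.
  pose (B := fun x => (ZB x * ZB x - ZA x * ZA x)%C).
  pose (F := fun x => (B x * Cexp (PA x))%C).
  pose (K2 := K * K * M * c).
  assert (HK2 : 0 <= K2) by (unfold K2; repeat first [lra | apply Rmult_le_pos]).
  assert (H1 : Cmod (F a - F 0) <= 4 * K2 * ((b - a) * sqrt (b - a))).
  { eapply Rle_trans.
    - apply (Cmod_increment_le F
        (fun x => (B x * Cexp (PA x) * RtoC (l x) *
           ((ZB x - ZA x) / ((ZB x + ZA x) * ZA x)))%C)
        (fun x => - (K2 * (b - a) * (2 * sqrt (b - a))) * atan (sqrt (a - x) / sqrt (b - a)))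
        (fun x => K2 * (b - a) * ((b - a) / ((b - x) * sqrt (a - x))))); try lra.
      + intros x Hx; apply Ccont_mult; [apply flow_sq_gap_cont|].
        apply Ccont_Cexp, (log_cont _ _ _ _ HPA); lra.
      + intros x Hx; apply: continuous_mult; [apply continuous_const|].
        apply (continuous_comp (fun x => sqrt (a - x) / sqrt (b - a)) atan).
        * apply: continuous_mult; [apply continuous_sqrt_sub | apply continuous_const].
        * apply: ex_derive_continuous; eexists; apply is_derive_atan.
      + intros x Hx; eapply Cderiv_eq.
        * apply Cderiv_mult; [apply flow_sq_gap_ode; lra|].
          apply Cderiv_Cexp, (log_ode _ _ _ _ HPA); lra.
        * pose proof (flow_neq_0 l a ZA HZA x ltac:(lra)).
          assert ((ZB x + ZA x)%C <> 0).
          { apply Cmod_gt_0; pose proof (flow_sum_lower x ltac:(lra)).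
            assert (0 < sqrt (a - x)) by (apply sqrt_lt_R0; lra).
            pose proof (sqrt_pos (b - x)); lra. }
          cbv beta; unfold B; field; auto.
      + intros x Hx; assert (Hs : 0 < sqrt (a - x)) by (apply sqrt_lt_R0; lra).
        pose proof (sqrt_sqrt (a - x) ltac:(lra)) as Es.
        eapply is_derive_eq.
        * apply: is_derive_scal; apply: (is_derive_comp atan); [apply is_derive_atan|].
          apply: (is_derive_ext (fun y => / sqrt (b - a) * sqrt (a - y))).
          { intros y; simpl; unfold Rdiv; apply Rmult_comm. }
          apply: is_derive_scal; apply is_derive_sqrt_sub; lra.
        * unfold scal; simpl; unfold mult; simpl.
          replace (1 + Rsqr (sqrt (a - x) / sqrt (b - a))) with ((b - x) / (b - a)).
          2:{ replace (Rsqr (sqrt (a - x) / sqrt (b - a))) with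
                ((sqrt (a - x) * sqrt (a - x)) / (sqrt (b - a) * sqrt (b - a)))
                by (unfold Rsqr; field; lra).
              rewrite Es Eh; field; lra. }
          field; lra.
      + intros x Hx.
        replace (K2 * (b - a) * ((b - a) / ((b - x) * sqrt (a - x))))
          with (K * (b - a) * c * M * (K * ((b - a) / ((b - x) * sqrt (a - x)))))
          by (unfold K2; ring).
        rewrite Cmod_mult (Cmod_mult _ (RtoC (l x))) (Cmod_mult (B x)) Cmod_R.
        pose proof (flow_sum_lower x ltac:(lra)). pose proof (sqrt_pos (a - x)).
        apply Rmult_le_compat.
        * repeat first [lra | apply Rmult_le_pos]; auto using Cmod_ge_0, Rabs_pos.
        * apply Cmod_ge_0.
        * apply Rmult_le_compat; auto using Rabs_pos.
          -- apply Rmult_le_pos; apply Cmod_ge_0.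
          -- apply Rmult_le_compat; auto using Cmod_ge_0.
             ++ apply flow_sq_gap_bound; lra.
             ++ apply HcA; lra.
          -- apply (driver_bound _ _ _ _ HD).
        * apply flow_gap_ratio_bound; lra.
    - rewrite Rminus_diag sqrt_0 Rminus_0_r.
      replace (0 / sqrt (b - a)) with 0 by (unfold Rdiv; ring); rewrite atan_0.
      assert (atan (sqrt a / sqrt (b - a)) <= 2).
      { pose proof (atan_bound (sqrt a / sqrt (b - a))). pose proof PI_4; lra. }
      assert (0 <= K2 * (b - a) * (2 * sqrt (b - a)))
        by (apply Rmult_le_pos; [apply Rmult_le_pos|]; lra). nra. }
  assert (H2 : Cmod (RtoC (4 * (b - a)) * Cexp (PA a) + F a)
     <= 4 * M * c * ((b - a) * sqrt (b - a))).
  { replace (RtoC (4 * (b - a)) * Cexp (PA a) + F a)%C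
      with ((ZB a * ZB a + RtoC (4 * (b - a))) * Cexp (PA a))%C
      by (unfold F, B; rewrite (flow_end _ _ _ HZA); ring).
    rewrite Cmod_mult.
    replace (4 * M * c * ((b - a) * sqrt (b - a)))
      with (4 * M * ((b - a) * sqrt (b - a)) * c) by ring.
    apply Rmult_le_compat; auto using Cmod_ge_0.
    - apply (flow_sq_expansion T M lam l HD b ZB); auto; lra.
    - apply HcA; lra. }
  replace (ZB 0 * ZB 0 - ZA 0 * ZA 0 + RtoC (4 * (b - a)) * Cexp (PA a))%C with
    ((RtoC (4 * (b - a)) * Cexp (PA a) + F a) + (F 0 - F a))%C
    by (unfold F, B; rewrite (log_0 _ _ _ _ HPA) Cexp_0; ring).
  eapply Rle_trans; [apply Cmod_triangle|].
  rewrite (Cmod_sub_sym (F 0)).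
  unfold sq_increment_const; fold K; unfold K2 in H1; fold c; lra.
Qed.

(** ** Regularity of the logarithm of the derivative *)

Context (d : R) (Hd : 0 < d)
  (Hhol : forall r s, 0 <= r <= T -> 0 <= s <= T -> r <> s ->
     Rabs (l r - l s) <= M * Rpower (Rabs (r - s)) d).

Lemma driver_lipschitz : Rabs (lam b - lam a) <= M * (b - a).
Proof.
  pose proof (Cmod_increment_le (fun x => RtoC (lam x)) (fun x => RtoC (l x))
    (fun x => M * x) (fun _ => M) a b) as H.
  rewrite -Cmod_R RtoC_minus; replace (M * (b - a)) with (M * b - M * a) by ring.
  apply H; try lra.
  - intros; apply Ccont_RtoC, (driver_cont _ _ _ _ HD).
  - intros; apply: ex_derive_continuous; auto_derive; exact I.
  - intros x Hx; apply Cderiv_RtoC, (driver_derive _ _ _ _ HD); lra.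
  - intros; auto_derive; [exact I | ring].
  - intros x Hx; rewrite Cmod_R; apply (driver_bound _ _ _ _ HD).
Qed.

Lemma driver_derivative_Holder r s h : 0 <= r <= T -> 0 <= s <= T -> r <> s -> Rabs (r - s) <= h ->
  Rabs (l r - l s) <= M * Rpower h d.
Proof.
  intros Hr Hs N H; eapply Rle_trans; [now apply Hhol|].
  apply Rmult_le_compat_l; auto.
  apply Rle_Rpower_l; [lra|]; split; auto; apply Rabs_pos_lt; lra.
Qed.

(** The pairs [1/Z_b - 1/Z_a] and [1/Z_b] are half the derivatives of
    [Z_b - Z_a] and [Z_b + lam].  Hence freezing [l] at the value [l a] leaves
    boundary terms of size [(b - a) / sqrt b], and only [l r - l a] has to be
    integrated.
    At distance less than [b - a] from [a], the Hoelder bound on [l r - l a] is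
    used through its largest value; the primitive [m] measures the contribution
    of the times further away. *)
Lemma flow_log_increment (m m' : R -> R) (F : R) :
  (forall x, 0 < x -> is_derive m x (m' x)) ->
  (forall x, 0 < x <= T -> Rpower x d * / (x * sqrt x) <= m' x) ->
  0 <= F -> (b - a < a -> m a - m (b - a) <= F) ->
  Cmod (PB b - PA a) <=
    2 * M * (1 + K) * (Rpower (b - a) d * sqrt (b - a)) + M * K * ((b - a) * F)
    + M * (M * (b - a) + K * (b - a) / sqrt b).
Proof.
  intros Hm Hm' HF0 HF.
  pose proof gap_const_pos as HK.
  set (h := b - a) in *. assert (Hh : 0 < h) by (unfold h; lra).
  set (q := Rpower h d). assert (Hq : 0 < q) by apply exp_pos.
  pose (ca := (RtoC (/ 2) * RtoC (l a))%C).
  pose (f := fun x => (PB x - PA x - ca * (ZB x - ZA x))%C).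
  pose (f' := fun x => (RtoC (l a - l x) * ((ZB x - ZA x) / (ZB x * ZA x)))%C).
  pose (g := fun x => (PB x - ca * (ZB x + RtoC (lam x)))%C).
  assert (E2 : (RtoC (/ 2) * 2 = 1)%C) by (rewrite -RtoC_mult; f_equal; lra).
  assert (Cf : forall x, 0 <= x <= a -> Ccont f x).
  { intros x Hx; apply Ccont_minus.
    - apply Ccont_minus; [apply (log_cont _ _ _ _ HPB) | apply (log_cont _ _ _ _ HPA)]; lra.
    - apply Ccont_mult; [apply Ccont_const | apply flow_gap_cont]. }
  assert (Df : forall x, 0 < x < a -> Cderiv f x (f' x)).
  { intros x Hx; eapply Cderiv_eq.
    - apply Cderiv_minus.
      + apply Cderiv_minus; [apply (log_ode _ _ _ _ HPB) | apply (log_ode _ _ _ _ HPA)]; lra.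
      + apply Cderiv_mult; [apply Cderiv_const | apply flow_gap_ode; lra].
    - unfold f', ca. rewrite RtoC_minus.
      pose proof (flow_neq_0 l a ZA HZA x ltac:(lra)).
      pose proof (flow_neq_0 l b ZB HZB x ltac:(lra)).
      transitivity ((RtoC (l x) / ZB x - RtoC (l x) / ZA x)
        - (RtoC (/ 2) * 2) * (RtoC (l a) * (/ ZB x - / ZA x)))%C; [field; auto|].
      rewrite E2; field; auto. }
  assert (Bf : forall x, 0 <= x < a -> Cmod (f' x) <=
     Rabs (l x - l a) * (K * (h / ((b - x) * sqrt (a - x))))).
  { intros x Hx; unfold f'; rewrite Cmod_mult Cmod_R (Rabs_minus_sym (l a)).
    apply Rmult_le_compat_l; [apply Rabs_pos|].
    apply flow_gap_ratio_bound; [lra | apply flow_B_Cmod; lra]. }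
  assert (Hg : Cmod (g b - g a) <= 2 * M * (q * sqrt h)).
  { eapply Rle_trans.
    - apply (Cmod_increment_le g (fun x => (RtoC (l x - l a) / ZB x)%C)
        (fun x => - (2 * M * q) * sqrt (b - x))
        (fun x => - (2 * M * q) * (- / (2 * sqrt (b - x))))); try lra.
      + intros x Hx; apply Ccont_minus; [apply (log_cont _ _ _ _ HPB); lra|].
        apply Ccont_mult; [apply Ccont_const|].
        apply Ccont_plus; [apply (flow_cont _ _ _ HZB)|].
        apply Ccont_RtoC, (driver_cont _ _ _ _ HD).
      + intros x Hx; apply: continuous_mult; [apply continuous_const | apply continuous_sqrt_sub].
      + intros x Hx; eapply Cderiv_eq.
        * apply Cderiv_minus; [apply (log_ode _ _ _ _ HPB); lra|].
          apply Cderiv_mult; [apply Cderiv_const|].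
          apply Cderiv_plus; [apply (flow_ode _ _ _ HZB); lra|].
          apply Cderiv_RtoC, (driver_derive _ _ _ _ HD); lra.
        * unfold ca; rewrite RtoC_minus.
          pose proof (flow_neq_0 l b ZB HZB x ltac:(lra)).
          transitivity (RtoC (l x) / ZB x - (RtoC (/ 2) * 2) * (RtoC (l a) / ZB x))%C;
            [field; auto|].
          rewrite E2; field; auto.
      + intros x Hx; apply: is_derive_scal; apply is_derive_sqrt_sub; lra.
      + intros x Hx; assert (0 < sqrt (b - x)) by (apply sqrt_lt_R0; lra).
        replace (- (2 * M * q) * (- / (2 * sqrt (b - x)))) with (M * q / sqrt (b - x))
          by (field; lra).
        apply Cdiv_Cmod_le; auto.
        * rewrite Cmod_R; apply driver_derivative_Holder; try lra. rewrite Rabs_right; unfold h; lra.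
        * apply flow_B_Cmod; lra.
    - rewrite Rminus_diag sqrt_0; fold h; lra. }
  pose (c := Rmax 0 (a - h)).
  assert (Hc : 0 <= c < a /\ a - h <= c).
  { unfold c; split; [split|]; [apply Rmax_l | apply Rmax_lub_lt; lra | apply Rmax_r]. }
  assert (Hnear : Cmod (f a - f c) <= 2 * M * K * (q * sqrt h)).
  { eapply Rle_trans.
    - apply (Cmod_increment_le f f'
        (fun x => - (2 * (M * q * K)) * sqrt (a - x))
        (fun x => - (2 * (M * q * K)) * (- / (2 * sqrt (a - x))))); try lra.
      + intros x Hx; apply Cf; lra.
      + intros x Hx; apply: continuous_mult; [apply continuous_const | apply continuous_sqrt_sub].
      + intros x Hx; apply Df; lra.
      + intros x Hx; apply: is_derive_scal; apply is_derive_sqrt_sub; lra.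
      + intros x Hx; assert (Hs : 0 < sqrt (a - x)) by (apply sqrt_lt_R0; lra).
        replace (- (2 * (M * q * K)) * (- / (2 * sqrt (a - x))))
          with (M * q * (K * / sqrt (a - x))) by (field; lra).
        eapply Rle_trans; [apply Bf; lra|].
        apply Rmult_le_compat; auto using Rabs_pos.
        * apply Rmult_le_pos; [lra|]; apply Rmult_le_pos; [lra|].
          left; apply Rinv_0_lt_compat; apply Rmult_lt_0_compat; lra.
        * apply driver_derivative_Holder; try lra. rewrite Rabs_left; lra.
        * apply Rmult_le_compat_l; [lra|].
          apply (Rmult_le_reg_r ((b - x) * sqrt (a - x))); [apply Rmult_lt_0_compat; lra|].
          replace (h / ((b - x) * sqrt (a - x)) * ((b - x) * sqrt (a - x))) with h
            by (field; lra).
          replace (/ sqrt (a - x) * ((b - x) * sqrt (a - x))) with (b - x) by (field; lra).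
          unfold h; lra.
    - rewrite Rminus_diag sqrt_0.
      assert (sqrt (a - c) <= sqrt h) by (apply sqrt_le_1_alt; lra).
      assert (0 <= M * q * K) by (repeat first [lra | apply Rmult_le_pos]). nra. }
  assert (Hfar : Cmod (f c - f 0) <= M * K * (h * F)).
  { destruct (Rle_dec a h) as [L|L].
    - replace c with 0 by (unfold c; rewrite Rmax_left; lra).
      replace (f 0 - f 0)%C with (RtoC 0) by ring.
      rewrite Cmod_0; repeat first [lra | apply Rmult_le_pos].
    - assert (Ec : c = a - h) by (unfold c; rewrite Rmax_right; lra).
      assert (Dm : forall x, x < a -> is_derive (fun y => - (M * K * h) * m (a - y)) x
        (M * K * h * m' (a - x))).
      { intros x Hx; eapply is_derive_eq.
        - apply: is_derive_scal; apply: (is_derive_comp m (fun y => a - y)).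
          + apply Hm; lra.
          + apply: is_derive_minus; [apply is_derive_const | apply is_derive_id].
        - unfold scal; simpl; unfold mult, minus, plus, opp, zero, one; simpl; ring. }
      eapply Rle_trans.
      + apply (Cmod_increment_le f f' (fun y => - (M * K * h) * m (a - y))
          (fun y => M * K * h * m' (a - y))); try lra.
        * intros x Hx; apply Cf; lra.
        * intros x Hx; apply: ex_derive_continuous; eexists; apply Dm; lra.
        * intros x Hx; apply Df; lra.
        * intros x Hx; apply Dm; lra.
        * intros x Hx; assert (Hs : 0 < sqrt (a - x)) by (apply sqrt_lt_R0; lra).
          eapply Rle_trans; [apply Bf; lra|].
          pose proof (Hhol x a ltac:(lra) ltac:(lra) ltac:(lra)) as Hx2.
          rewrite (Rabs_left (x - a)) in Hx2; [|lra].
          replace (- (x - a)) with (a - x) in Hx2 by ring.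
          pose proof (Hm' (a - x) ltac:(lra)) as Hx3.
          apply (Rle_trans _ (M * K * h * (Rpower (a - x) d * / ((a - x) * sqrt (a - x))))).
          2:{ apply Rmult_le_compat_l; auto; repeat first [lra | apply Rmult_le_pos]. }
          replace (M * K * h * (Rpower (a - x) d * / ((a - x) * sqrt (a - x))))
            with (M * Rpower (a - x) d * (K * (h * / ((a - x) * sqrt (a - x))))) by ring.
          apply Rmult_le_compat; auto using Rabs_pos.
          -- apply Rmult_le_pos; [lra|]; apply Rmult_le_pos; [lra|].
             left; apply Rinv_0_lt_compat; apply Rmult_lt_0_compat; lra.
          -- apply Rmult_le_compat_l; [lra|]. apply Rmult_le_compat_l; [lra|].
             apply Rinv_le_contravar; [apply Rmult_lt_0_compat; lra|].
             apply Rmult_le_compat_r; lra.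
      + rewrite Rminus_0_r Ec; replace (a - (a - h)) with h by ring.
        pose proof (HF ltac:(lra)) as HF'.
        assert (0 <= M * K * h) by (repeat first [lra | apply Rmult_le_pos]). nra. }
  assert (Hb : Cmod (ca * (RtoC (lam b - lam a) - (ZB 0 - ZA 0)))
     <= M * (M * h + K * h / sqrt b)).
  { unfold ca; rewrite !Cmod_mult !Cmod_R (Rabs_right (/ 2)); [|lra].
    assert (Cmod (RtoC (lam b - lam a) - (ZB 0 - ZA 0)) <= M * h + K * h / sqrt b).
    { eapply Rle_trans; [apply Cmod_triangle|].
      rewrite Cmod_opp Cmod_R; apply Rplus_le_compat; [apply driver_lipschitz|].
      pose proof (flow_gap_bound 0 ltac:(lra)) as G; rewrite Rminus_0_r in G; exact G. }
    pose proof (driver_bound _ _ _ _ HD a). pose proof (Rabs_pos (l a)).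
    pose proof (Cmod_ge_0 (RtoC (lam b - lam a) - (ZB 0 - ZA 0))). nra. }
  replace (PB b - PA a)%C with
    ((g b - g a) + (f a - f c) + (f c - f 0) + ca * (RtoC (lam b - lam a) - (ZB 0 - ZA 0)))%C.
  2:{ unfold f, g; rewrite (flow_end _ _ _ HZA) (flow_end _ _ _ HZB)
        (log_0 _ _ _ _ HPA) (log_0 _ _ _ _ HPB) !RtoC_minus; ring. }
  eapply Rle_trans; [apply Cmod_triangle|].
  assert (Cmod (g b - g a + (f a - f c) + (f c - f 0)) <=
    2 * M * (q * sqrt h) + 2 * M * K * (q * sqrt h) + M * K * (h * F)).
  { eapply Rle_trans; [apply Cmod_triangle|].
    apply Rplus_le_compat; auto.
    eapply Rle_trans; [apply Cmod_triangle|]; lra. }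
  lra.
Qed.

End Two_times.

(** * From increments of the square to the derivative of the root *)

Lemma is_derive_of_bound (f : R -> R) x l K e : 0 < e ->
  (forall y, Rabs (y - x) < e ->
     Rabs (f y - f x - l * (y - x)) <= K * (Rabs (y - x) * sqrt (Rabs (y - x)))) ->
  is_derive f x l.
Proof.
  intros He H; apply is_derive_Reals; intros eps Heps.
  pose (k := Rabs K + 1). assert (Hk : 0 < k) by (pose proof (Rabs_pos K); unfold k; lra).
  pose (s := eps / k). assert (Hs : 0 < s) by (apply Rdiv_lt_0_compat; lra).
  assert (Es : k * s = eps) by (unfold s; field; lra).
  assert (P : 0 < Rmin e (s * s)) by (apply Rmin_pos; nra).
  exists (mkposreal _ P); intros h Hh Hlt; simpl in Hlt.
  pose proof (Rmin_l e (s * s)); pose proof (Rmin_r e (s * s)).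
  specialize (H (x + h)); replace (x + h - x) with h in H by ring.
  specialize (H ltac:(lra)).
  assert (Hah : 0 < Rabs h) by now apply Rabs_pos_lt.
  assert (Hsq : sqrt (Rabs h) < s).
  { rewrite -(sqrt_pow2 s); [apply sqrt_lt_1_alt; nra | lra]. }
  replace ((f (x + h) - f x) / h - l) with ((f (x + h) - f x - l * h) / h) by (field; auto).
  unfold Rdiv; rewrite Rabs_mult Rabs_inv.
  apply (Rmult_lt_reg_r (Rabs h)); auto.
  rewrite Rmult_assoc Rinv_l; [|lra]. rewrite Rmult_1_r.
  eapply Rle_lt_trans; [exact H|].
  pose proof (sqrt_pos (Rabs h)). pose proof (Rle_abs K).
  assert (K * sqrt (Rabs h) <= k * sqrt (Rabs h)) by (unfold k in *; nra).
  assert (k * sqrt (Rabs h) < eps) by (rewrite -Es; apply Rmult_lt_compat_l; lra).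
  nra.
Qed.

Lemma Cderiv_of_bound (f : R -> C) x l K e : 0 < e ->
  (forall y, Rabs (y - x) < e ->
     Cmod (f y - f x - l * RtoC (y - x)) <= K * (Rabs (y - x) * sqrt (Rabs (y - x)))) ->
  Cderiv f x l.
Proof.
  intros He H; split; apply (is_derive_of_bound _ x _ K e He); intros y Hy;
    (eapply Rle_trans; [|apply (H y Hy)]).
  - eapply Rle_trans; [|apply re_le_Cmod]. right; f_equal; simpl; unfold Re, Im; ring.
  - eapply Rle_trans; [|apply Im_abs_le_Cmod]. right; f_equal; simpl; unfold Re, Im; ring.
Qed.

Lemma Ccont_of_lipschitz (f : R -> C) L x :
  (forall y, Cmod (f y - f x) <= L * Rabs (y - x)) -> Ccont f x.
Proof.
  intros H; apply (Ccont_of_bound f (fun y => L * Rabs (y - x)) x 1); auto; [lra | |].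
  - apply: continuous_mult; [apply continuous_const|].
    apply (continuous_comp (fun y => y - x) Rabs); [|apply continuous_Rabs].
    apply: continuous_minus; [apply continuous_id | apply continuous_const].
  - rewrite Rminus_diag Rabs_R0; ring.
Qed.

Definition clamp (b x : R) : R := Rmax 0 (Rmin b x).

Lemma clamp_in b x : 0 <= b -> 0 <= clamp b x <= b.
Proof.
  intros; unfold clamp; split; [apply Rmax_l | apply Rmax_lub; [lra | apply Rmin_l]].
Qed.

Lemma clamp_id b x : 0 <= x <= b -> clamp b x = x.
Proof. intros; unfold clamp; rewrite Rmin_right ?Rmax_right; lra. Qed.

Lemma clamp_lipschitz b x y : Rabs (clamp b x - clamp b y) <= Rabs (x - y).
Proof.
  unfold clamp, Rmax, Rmin.
  destruct (Rle_dec b x), (Rle_dec b y); repeat destruct Rle_dec; 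
    unfold Rabs; repeat destruct Rcase_abs; lra.
Qed.

Section Root.

(** [z] stands for the slit in the square-root time [u], seen from its base
    point, and [J] for the logarithm of its normalized derivative: the increments
    of [z ^ 2] are those of a primitive of [- 8 u exp (J u)] up to order
    [3/2]. *)
Context (b C2 c KJ c1 c2 : R) (w : R -> R) (z J : R -> C).
Context (Hb : 0 < b) (HC2 : 0 <= C2) (HKJ : 0 <= KJ) (Hc1 : 0 <= c1) (Hc2 : 0 <= c2).
Context (Hz0 : z 0 = 0) (HJ0 : J 0 = 0).
Context (Hzl : forall u, 0 < u <= b -> u <= Im (z u)).
Context (Hzu : forall u, 0 < u <= b -> Cmod (z u) <= 3 * u).
Context (Hsq : forall v u, 0 <= v < u -> u <= b ->
  Cmod (z u * z u - z v * z v + RtoC (4 * (u ^ 2 - v ^ 2)) * Cexp (J v)) <=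
  C2 * ((u ^ 2 - v ^ 2) * sqrt (u ^ 2 - v ^ 2))).
Context (HJc : forall u, 0 <= u <= b -> Cmod (J u) <= c).
Context (HJw : forall v u, 0 <= v < u -> u <= b -> Cmod (J u - J v) <= KJ * w (u - v)).
Context (Hw_mono : forall x y, 0 < x <= y -> y <= b -> w x <= w y).
Context (Hw_low : forall x, 0 < x <= b -> x <= c1 * w x).
Context (Hw_up : forall x, 0 < x <= b -> w x <= c2 * sqrt x).

Let E (u : R) : C := Cexp (J u).
Let e := exp c.
Let P (u : R) : C := (z u * z u)%C.

Lemma exp_bound_ge_1 : 1 <= e.
Proof.
  pose proof (HJc 0 ltac:(lra)) as H; rewrite HJ0 Cmod_0 in H.
  unfold e; rewrite -exp_0; now apply exp_nondecreasing.
Qed.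

Lemma Re_log_bound u : 0 <= u <= b -> - c <= Re (J u) <= c.
Proof.
  intros Hu; pose proof (re_le_Cmod (J u)); pose proof (HJc u Hu).
  apply Rabs_le_between; lra.
Qed.

Lemma exp_log_upper u : 0 <= u <= b -> Cmod (E u) <= e.
Proof. intros Hu; unfold E; rewrite Cmod_Cexp; apply exp_nondecreasing, Re_log_bound, Hu. Qed.

Lemma exp_log_lower u : 0 <= u <= b -> / e <= Cmod (E u).
Proof.
  intros Hu; unfold E, e; rewrite Cmod_Cexp -exp_Ropp; apply exp_nondecreasing, Re_log_bound, Hu.
Qed.

Lemma exp_log_increment v u : 0 <= v < u -> u <= b -> Cmod (E u - E v) <= e * KJ * w (u - v).
Proof.
  intros Hv Hu; eapply Rle_trans.
  - apply (Cexp_lipschitz _ _ c); apply Re_log_bound; lra.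
  - rewrite Rmult_assoc; apply Rmult_le_compat_l; [left; apply exp_pos | now apply HJw].
Qed.

Lemma sqrt_sq_gap v u : 0 <= v < u -> u <= b ->
  (u ^ 2 - v ^ 2) * sqrt (u ^ 2 - v ^ 2) <= 2 * b * sqrt (2 * b) * ((u - v) * sqrt (u - v)).
Proof.
  intros Hv Hu.
  assert (0 <= u ^ 2 - v ^ 2 <= 2 * b * (u - v)) by nra.
  replace (2 * b * sqrt (2 * b) * ((u - v) * sqrt (u - v)))
    with (2 * b * (u - v) * (sqrt (2 * b) * sqrt (u - v))) by ring.
  rewrite -sqrt_mult_alt; [|lra].
  apply Rmult_le_compat; try lra; [apply sqrt_pos | apply sqrt_le_1_alt; lra].
Qed.

Lemma sq_le_pow32 x : 0 <= x <= b -> x ^ 2 <= sqrt b * (x * sqrt x).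
Proof.
  intros Hx. assert (H : sqrt x <= sqrt b) by (apply sqrt_le_1_alt; lra).
  pose proof (sqrt_sqrt x ltac:(lra)) as Ex. pose proof (sqrt_pos x).
  assert (sqrt x * sqrt x <= sqrt b * sqrt x) by nra. nra.
Qed.

Definition sq_lip_const (b C2 e : R) : R := 8 * b * e + C2 * 2 * b * sqrt (2 * b) * sqrt b.

Lemma sq_lipschitz x y : 0 <= x <= b -> 0 <= y <= b ->
  Cmod (P y - P x) <= sq_lip_const b C2 e * Rabs (y - x).
Proof.
  assert (K : forall v u, 0 <= v < u -> u <= b ->
    Cmod (P u - P v) <= sq_lip_const b C2 e * (u - v)).
  { intros v u Hv Hu.
    replace (P u - P v)%C with ((P u - P v + RtoC (4 * (u ^ 2 - v ^ 2)) * Cexp (J v))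
      + - (RtoC (4 * (u ^ 2 - v ^ 2)) * E v))%C by (unfold E; ring).
    eapply Rle_trans; [apply Cmod_triangle|].
    rewrite Cmod_opp Cmod_mult Cmod_R (Rabs_right (4 * (u ^ 2 - v ^ 2))); [|nra].
    pose proof (Hsq v u Hv Hu) as H1. pose proof (sqrt_sq_gap v u Hv Hu) as H2.
    pose proof (exp_log_upper v ltac:(lra)) as H3. pose proof exp_bound_ge_1.
    assert (H4 : 4 * (u ^ 2 - v ^ 2) * Cmod (E v) <= 8 * b * (u - v) * e)
      by (apply Rmult_le_compat; try apply Cmod_ge_0; nra).
    assert (H5 : sqrt (u - v) <= sqrt b) by (apply sqrt_le_1_alt; lra).
    assert (H6 : C2 * ((u ^ 2 - v ^ 2) * sqrt (u ^ 2 - v ^ 2)) <=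
       C2 * (2 * b * sqrt (2 * b) * ((u - v) * sqrt b))).
    { apply Rmult_le_compat_l; auto. eapply Rle_trans; [exact H2|].
      apply Rmult_le_compat_l; [|nra].
      pose proof (sqrt_pos (2 * b)); nra. }
    unfold sq_lip_const; fold (P u) (P v) in H1. lra. }
  intros Hx Hy; destruct (total_order_T x y) as [[L|Q]|L].
  - rewrite Rabs_right; [apply K; lra | lra].
  - rewrite Q; replace (P y - P y)%C with (RtoC 0) by ring.
    rewrite Cmod_0 Rminus_diag Rabs_R0; lra.
  - rewrite Cmod_sub_sym Rabs_left; [|lra].
    replace (- (y - x)) with (x - y) by ring; apply K; lra.
Qed.

(** For [y < x] the hypothesis on increments is anchored at [y], and the modulus
    of continuity of [J] moves the exponential to [x]. *)
Lemma sq_derivative_bound x y : 0 <= x <= b -> 0 <= y <= b ->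
  Cmod (P y - P x - (- RtoC (8 * x)) * E x * RtoC (y - x)) <=
  (C2 * (2 * b * sqrt (2 * b)) + 4 * e * sqrt b + 8 * b * e * KJ * c2)
   * (Rabs (y - x) * sqrt (Rabs (y - x))).
Proof.
  intros Hx Hy. pose proof exp_bound_ge_1 as He.
  pose proof (exp_log_upper x Hx) as HE. pose proof (Cmod_ge_0 (E x)).
  destruct (total_order_T x y) as [[L|Q]|L].
  - rewrite Rabs_right; [|lra].
    pose proof (Hsq x y ltac:(lra) ltac:(lra)) as H1.
    pose proof (sqrt_sq_gap x y ltac:(lra) ltac:(lra)) as H2.
    pose proof (sq_le_pow32 (y - x) ltac:(lra)) as H3.
    apply (Rmult_le_compat_l C2) in H2; auto.
    replace (P y - P x - (- RtoC (8 * x)) * E x * RtoC (y - x))%C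
      with ((P y - P x + RtoC (4 * (y ^ 2 - x ^ 2)) * Cexp (J x))
        + - (RtoC (4 * (y - x) ^ 2) * E x))%C.
    2:{ unfold E. replace (4 * (y ^ 2 - x ^ 2)) with (4 * (y - x) ^ 2 + 8 * x * (y - x)) by ring.
        rewrite RtoC_plus (RtoC_mult (8 * x)). ring. }
    eapply Rle_trans; [apply Cmod_triangle|].
    rewrite Cmod_opp Cmod_mult Cmod_R (Rabs_right (4 * (y - x) ^ 2)); [|nra].
    assert (H4 : 4 * (y - x) ^ 2 * Cmod (E x) <= 4 * (sqrt b * ((y - x) * sqrt (y - x))) * e)
      by (apply Rmult_le_compat; nra).
    fold (P y) (P x) in H1.
    assert (0 <= 8 * b * e * KJ * c2 * ((y - x) * sqrt (y - x))).
    { pose proof (sqrt_pos (y - x)); repeat first [lra | apply Rmult_le_pos]. }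
    lra.
  - rewrite Q; replace (P y - P y - (- RtoC (8 * y)) * E y * RtoC (y - y))%C with (RtoC 0)
      by (rewrite Rminus_diag; ring).
    rewrite Cmod_0 Rminus_diag Rabs_R0; lra.
  - rewrite Rabs_left; [|lra]; replace (- (y - x)) with (x - y) by ring.
    pose proof (Hsq y x ltac:(lra) ltac:(lra)) as H1.
    pose proof (sqrt_sq_gap y x ltac:(lra) ltac:(lra)) as H2.
    pose proof (sq_le_pow32 (x - y) ltac:(lra)) as H3.
    apply (Rmult_le_compat_l C2) in H2; auto.
    pose proof (exp_log_increment y x ltac:(lra) ltac:(lra)) as H5.
    pose proof (Hw_up (x - y) ltac:(lra)) as H6.
    replace (P y - P x - (- RtoC (8 * x)) * E x * RtoC (y - x))%C
      with (- (P x - P y + RtoC (4 * (x ^ 2 - y ^ 2)) * Cexp (J y))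
        + - (RtoC (4 * (x - y) ^ 2) * E x) + - (RtoC (4 * (x ^ 2 - y ^ 2)) * (E x - E y)))%C.
    2:{ unfold E. replace (4 * (x ^ 2 - y ^ 2)) with (8 * x * (x - y) - 4 * (x - y) ^ 2) by ring.
        replace (y - x) with (- (x - y)) by ring.
        rewrite RtoC_minus (RtoC_mult (8 * x)) RtoC_opp. ring. }
    eapply Rle_trans; [apply Cmod_triangle|].
    eapply Rle_trans; [apply Rplus_le_compat_r, Cmod_triangle|].
    rewrite !Cmod_opp !(Cmod_mult (RtoC _)) !Cmod_R (Rabs_right (4 * (x - y) ^ 2));
      [|nra]. rewrite (Rabs_right (4 * (x ^ 2 - y ^ 2))); [|nra].
    assert (H4 : 4 * (x - y) ^ 2 * Cmod (E x) <= 4 * (sqrt b * ((x - y) * sqrt (x - y))) * e)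
      by (apply Rmult_le_compat; nra).
    assert (H7 : 4 * (x ^ 2 - y ^ 2) * Cmod (E x - E y) <=
        8 * b * (x - y) * (e * KJ * (c2 * sqrt (x - y)))).
    { apply Rmult_le_compat; try apply Cmod_ge_0; try nra.
      eapply Rle_trans; [exact H5|]. apply Rmult_le_compat_l; auto.
      apply Rmult_le_pos; lra. }
    fold (P y) (P x) in H1. lra.
Qed.

Lemma clamp_sq_cont x : Ccont (fun y => P (clamp b y)) x.
Proof.
  apply (Ccont_of_lipschitz _ (sq_lip_const b C2 e)); intros y.
  eapply Rle_trans; [apply sq_lipschitz; apply clamp_in; lra|].
  apply Rmult_le_compat_l; [|apply clamp_lipschitz].
  pose proof exp_bound_ge_1; pose proof (sqrt_pos (2 * b)); pose proof (sqrt_pos b).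
  unfold sq_lip_const; apply Rplus_le_le_0_compat; repeat first [lra | apply Rmult_le_pos].
Qed.

Lemma clamp_sq_derive x : 0 < x < b ->
  Cderiv (fun y => P (clamp b y)) x (- RtoC (8 * x) * E x).
Proof.
  intros Hx. assert (Hr : 0 < Rmin x (b - x)) by (apply Rmin_pos; lra).
  eapply (Cderiv_of_bound _ _ _ _ _ Hr); intros y Hy.
  pose proof (Rmin_l x (b - x)); pose proof (Rmin_r x (b - x)).
  apply Rabs_def2 in Hy; rewrite !clamp_id; try lra.
  apply sq_derivative_bound; lra.
Qed.

(* The value at [0] is the limit of [z u / u]: [Q ^ 2] tends to [- 4] there. *)
Let Q (u : R) : C := match Rle_dec u 0 with left _ => (2 * Ci)%C | right _ => (z u / RtoC u)%C end.

Lemma quotient_at_0 : Q 0 = (2 * Ci)%C.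
Proof. unfold Q; destruct (Rle_dec 0 0); [auto|lra]. Qed.

Lemma quotient_at_pos u : 0 < u -> Q u = (z u / RtoC u)%C.
Proof. intros; unfold Q; destruct (Rle_dec u 0); [lra|auto]. Qed.

Lemma Im_div_R (a : C) u : 0 < u -> Im (a / RtoC u) = Im a / u.
Proof.
  intros Hu; unfold Cdiv, Cinv, Cmult, Re, Im, RtoC; simpl; field; lra.
Qed.

Lemma quotient_Im_lower u : 0 <= u <= b -> 1 <= Im (Q u).
Proof.
  intros Hu; destruct (Req_dec u 0) as [->|N].
  - rewrite quotient_at_0; simpl; unfold Re, Im; simpl; lra.
  - rewrite quotient_at_pos ?Im_div_R; try lra.
    apply (Rmult_le_reg_r u); [lra|].
    unfold Rdiv; rewrite Rmult_assoc Rinv_l; [|lra].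
    pose proof (Hzl u ltac:(lra)); lra.
Qed.

Lemma quotient_Cmod_lower u : 0 <= u <= b -> 1 <= Cmod (Q u).
Proof. intros; eapply Rle_trans; [now apply quotient_Im_lower | apply Im_le_Cmod]. Qed.

Lemma quotient_neq_0 u : 0 <= u <= b -> Q u <> 0.
Proof. intros H; apply Cmod_gt_0; pose proof (quotient_Cmod_lower u H); lra. Qed.

Lemma RtoC_pos_neq_0 u : 0 < u -> RtoC u <> 0.
Proof. intros H E0; apply RtoC_inj in E0; lra. Qed.

Lemma quotient_Cmod_upper u : 0 <= u <= b -> Cmod (Q u) <= 3.
Proof.
  intros Hu; destruct (Req_dec u 0) as [->|N].
  - rewrite quotient_at_0 Cmod_mult Cmod_Ci Cmod_R Rabs_right; lra.
  - rewrite quotient_at_pos ?Cmod_div; [|apply RtoC_pos_neq_0; lra|lra].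
    rewrite Cmod_R Rabs_right; [|lra]. pose proof (Hzu u ltac:(lra)).
    apply (Rmult_le_reg_r u); [lra|].
    unfold Rdiv; rewrite Rmult_assoc Rinv_l; lra.
Qed.

(** Both [Q u ^ 2] and [Q v ^ 2] are averages over [x] in [0, 1] of
    [- 8 x exp (J (u x))] and [- 8 x exp (J (v x))], so [Q ^ 2] inherits the
    modulus of continuity of [J]. *)
Lemma quotient_sq_increment v u : 0 <= v < u -> u <= b ->
  Cmod (Q u * Q u - Q v * Q v) <= (8 * e * KJ + C2 * c1) * w (u - v).
Proof.
  intros Hv Hu.
  pose proof (Hw_low (u - v) ltac:(lra)) as Hwl. pose proof exp_bound_ge_1 as He.
  destruct (Req_dec v 0) as [->|N].
  - rewrite quotient_at_0 quotient_at_pos; [|lra]. rewrite Rminus_0_r in Hwl |- *.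
    pose proof (Hsq 0 u ltac:(lra) Hu) as H1.
    rewrite HJ0 Cexp_0 Hz0 in H1.
    replace (u ^ 2 - 0 ^ 2) with (u ^ 2) in H1 by ring.
    rewrite sqrt_pow2 in H1; [|lra].
    assert (Nu : RtoC u <> 0) by (apply RtoC_pos_neq_0; lra).
    replace (z u / RtoC u * (z u / RtoC u) - 2 * Ci * (2 * Ci))%C
      with ((z u * z u - 0 * 0 + RtoC (4 * u ^ 2) * 1) / RtoC (u ^ 2))%C.
    2:{ replace (2 * Ci * (2 * Ci))%C with (- (4))%C.
        - replace (u ^ 2) with (u * u) by ring. rewrite !RtoC_mult; field; auto.
        - unfold Ci, Cmult, Copp, RtoC; simpl; f_equal; ring. }
    assert (0 <= u * KJ * 8 * e) by (repeat first [lra | apply Rmult_le_pos]).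
    eapply Rle_trans.
    + apply (Cdiv_Cmod_le _ _ (C2 * (u ^ 2 * u)) (u ^ 2)); [nra | exact H1 |].
      rewrite Cmod_R; apply Rle_abs.
    + replace (C2 * (u ^ 2 * u) / u ^ 2) with (C2 * u) by (field; lra).
      assert (C2 * u <= C2 * (c1 * w u)) by (apply Rmult_le_compat_l; auto).
      assert (0 <= 8 * e * KJ * w u); [|lra].
      destruct (Rle_lt_or_eq_dec 0 c1 Hc1) as [Q1|Q1]; [|rewrite -Q1 in Hwl; lra].
      assert (0 <= w u) by (apply (Rmult_le_reg_l c1); lra).
      repeat first [lra | apply Rmult_le_pos].
  - assert (Hvp : 0 < v) by lra.
    assert (Nu : RtoC u <> 0) by (apply RtoC_pos_neq_0; lra).
    assert (Nv : RtoC v <> 0) by (apply RtoC_pos_neq_0; lra).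
    pose (Pc := fun y => P (clamp b y)).
    pose (f := fun x : R => (Pc (u * x)%R * / RtoC (u * u) - Pc (v * x)%R * / RtoC (v * v))%C).
    replace (Q u * Q u - Q v * Q v)%C with (f 1 - f 0)%C.
    2:{ unfold f, Pc; rewrite !Rmult_1_r !Rmult_0_r !clamp_id; try lra.
        unfold P; rewrite Hz0 !quotient_at_pos; try lra. rewrite !RtoC_mult; field; auto. }
    pose proof (Hw_up (u - v) ltac:(lra)).
    assert (Hw0 : 0 <= w (u - v)).
    { destruct (Rle_lt_or_eq_dec 0 c1 Hc1) as [Q1|Q1]; [|rewrite -Q1 in Hwl; lra].
      apply (Rmult_le_reg_l c1); lra. }
    apply (Rle_trans _ (8 * (e * KJ * w (u - v)) * 1 - 8 * (e * KJ * w (u - v)) * 0)).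
    2:{ assert (0 <= C2 * c1 * w (u - v)) by (repeat first [lra | apply Rmult_le_pos]). lra. }
    assert (Cin : forall k x, Ccont (fun x => Pc (k * x)%R) x).
    { intros k x; destruct (clamp_sq_cont (k * x)) as [K1 K2].
      assert (Kk : continuous (fun x => k * x) x)
        by (apply: ex_derive_continuous; auto_derive; exact I).
      split.
      - apply (continuous_comp (fun x => k * x) (fun y => Re (Pc y))); auto.
      - apply (continuous_comp (fun x => k * x) (fun y => Im (Pc y))); auto. }
    apply (Cmod_increment_le f (fun x => (- RtoC (8 * x) * (E (u * x) - E (v * x)))%C)
      (fun x => 8 * (e * KJ * w (u - v)) * x) (fun x => 8 * (e * KJ * w (u - v)))); try lra.
    + intros x Hx; apply Ccont_minus; apply Ccont_mult; auto using Ccont_const.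
    + intros x Hx; apply: ex_derive_continuous; auto_derive; exact I.
    + intros x Hx; eapply Cderiv_eq.
      * apply Cderiv_minus; (apply Cderiv_mult; [|apply Cderiv_const]);
          apply Cderiv_scale, clamp_sq_derive; nra.
      * rewrite !RtoC_mult; field; auto.
    + intros x Hx; auto_derive; [exact I | ring].
    + intros x Hx. rewrite Cmod_mult Cmod_opp Cmod_R Rabs_right; [|lra].
      pose proof (exp_log_increment (v * x) (u * x) ltac:(nra) ltac:(nra)) as HE.
      assert (w (u * x - v * x) <= w (u - v)) by (apply Hw_mono; nra).
      assert (Cmod (E (u * x) - E (v * x)) <= e * KJ * w (u - v)).
      { eapply Rle_trans; [exact HE|]. apply Rmult_le_compat_l; auto.
        apply Rmult_le_pos; lra. }
      pose proof (Cmod_ge_0 (E (u * x) - E (v * x))). nra.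
Qed.

Lemma quotient_increment v u : 0 <= v < u -> u <= b ->
  Cmod (Q u - Q v) <= (8 * e * KJ + C2 * c1) * w (u - v).
Proof.
  intros Hv Hu; eapply Rle_trans; [|now apply quotient_sq_increment].
  rewrite Csq_sub_factor Cmod_mult.
  pose proof (Cmod_sum_le_Im (Q u) (Q v) 1 1 ltac:(lra) ltac:(lra)
    (quotient_Im_lower u ltac:(lra)) (quotient_Im_lower v ltac:(lra))).
  pose proof (Cmod_ge_0 (Q u - Q v)). nra.
Qed.

(** This is [(z ^ 2)' / (2 z)] with [(z ^ 2)' = - 8 u exp (J u)], in a form that
    makes sense at [u = 0]. *)
Definition root_derivative (u : R) : C := (- (4) * E u / Q u)%C.

Definition root_const (c KJ C2 c1 : R) : R :=
  12 * exp c * KJ + 4 * exp c * (8 * exp c * KJ + C2 * c1).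

Lemma root_derivative_increment v u : 0 <= v < u -> u <= b ->
  Cmod (root_derivative u - root_derivative v) <= root_const c KJ C2 c1 * w (u - v).
Proof.
  intros Hv Hu. pose proof exp_bound_ge_1 as He.
  pose proof (exp_log_increment v u Hv Hu) as H1. pose proof (quotient_increment v u Hv Hu) as H2.
  pose proof (exp_log_upper v ltac:(lra)) as H3.
  pose proof (quotient_neq_0 u ltac:(lra)); pose proof (quotient_neq_0 v ltac:(lra)).
  replace (root_derivative u - root_derivative v)%C with
    (- (4) * (((E u - E v) * Q v) - E v * (Q u - Q v)) / (Q u * Q v))%C
    by (unfold root_derivative; field; auto).
  eapply Rle_trans.
  - apply (Cdiv_Cmod_le _ _ (4 * ((e * KJ * w (u - v)) * 3
       + e * ((8 * e * KJ + C2 * c1) * w (u - v)))) 1); [lra | |].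
    + rewrite Cmod_mult Cmod_opp Cmod_R Rabs_right; [|lra].
      apply Rmult_le_compat_l; [lra|].
      eapply Rle_trans; [apply Cmod_triangle|].
      rewrite Cmod_opp !Cmod_mult; apply Rplus_le_compat.
      * apply Rmult_le_compat; auto using Cmod_ge_0; apply quotient_Cmod_upper; lra.
      * apply Rmult_le_compat; auto using Cmod_ge_0.
    + rewrite Cmod_mult; pose proof (quotient_Cmod_lower u ltac:(lra)); pose proof (quotient_Cmod_lower v ltac:(lra)).
      nra.
  - unfold root_const; fold e; lra.
Qed.

Lemma root_derivative_upper u : 0 <= u <= b -> Cmod (root_derivative u) <= 4 * exp c.
Proof.
  intros Hu; replace (4 * exp c) with (4 * exp c / 1) by field.
  apply Cdiv_Cmod_le; [lra | | now apply quotient_Cmod_lower].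
  rewrite Cmod_mult Cmod_opp Cmod_R Rabs_right; [|lra].
  pose proof (exp_log_upper u Hu); unfold e in *; lra.
Qed.

Lemma root_derivative_lower u : 0 <= u <= b -> / exp c <= Cmod (root_derivative u).
Proof.
  intros Hu; unfold root_derivative; rewrite Cmod_div; [|now apply quotient_neq_0].
  rewrite Cmod_mult Cmod_opp Cmod_R Rabs_right; [|lra].
  pose proof (exp_log_lower u Hu); pose proof (quotient_Cmod_upper u Hu); pose proof (quotient_Cmod_lower u Hu).
  pose proof exp_bound_ge_1. assert (0 < / e) by (apply Rinv_0_lt_compat; lra).
  apply (Rmult_le_reg_r (Cmod (Q u))); [lra|].
  unfold Rdiv; rewrite Rmult_assoc Rinv_l; [|lra].
  fold e; nra.
Qed.

(** For [x > 0] the increment of [z] is that of [z ^ 2] divided by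
    [z y + z x], which is bounded below by [x]; at [0] it is compared with
    [2 i y]. *)
Lemma root_differentiable x : 0 <= x <= b -> exists K, forall y, 0 <= y <= b ->
  Cmod (z y - z x - root_derivative x * RtoC (y - x)) <=
  K * (Rabs (y - x) * sqrt (Rabs (y - x))).
Proof.
  intros Hx. pose proof exp_bound_ge_1 as He.
  assert (Hz_Im : forall y, 0 <= y <= b -> 0 <= Im (z y)).
  { intros y Hy; destruct (Req_dec y 0) as [->|N].
    - rewrite Hz0; simpl; lra.
    - pose proof (Hzl y ltac:(lra)); lra. }
  destruct (Req_dec x 0) as [->|N].
  - exists (C2 * sqrt b); intros y Hy.
    unfold root_derivative; rewrite quotient_at_0 Hz0 Rminus_0_r; unfold E; rewrite HJ0 Cexp_0.
    destruct (Req_dec y 0) as [->|Ny].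
    { rewrite Hz0; replace (0 - 0 - - (4) * 1 / (2 * Ci) * 0)%C with (RtoC 0) by ring.
      rewrite Cmod_0 Rabs_R0; lra. }
    assert (Hy0 : 0 < y) by lra.
    pose proof (Hsq 0 y ltac:(lra) ltac:(lra)) as H1.
    rewrite HJ0 Cexp_0 Hz0 in H1.
    replace (y ^ 2 - 0 ^ 2) with (y ^ 2) in H1 by ring.
    rewrite sqrt_pow2 in H1; [|lra].
    pose proof (Hzl y ltac:(lra)) as H2.
    assert (Hi : (Ci * Ci = - (1))%C)
      by (unfold Ci, Cmult, Copp, RtoC; simpl; f_equal; ring).
    assert (Ni : Ci <> 0) by (intros Q0; apply (f_equal Im) in Q0; simpl in Q0; lra).
    assert (N2i : (2 * Ci)%C <> 0)
      by (apply Cmult_neq_0; auto; apply RtoC_pos_neq_0; lra).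
    replace (- (4) * 1 / (2 * Ci))%C with (2 * Ci)%C.
    2:{ transitivity ((4 * (Ci * Ci)) / (2 * Ci))%C; [field; auto | rewrite Hi; field; auto]. }
    assert (H3 : Cmod (z y - 2 * Ci * RtoC y) * y <= C2 * (y ^ 2 * y)).
    { eapply Rle_trans; [|exact H1].
      replace (z y * z y - 0 * 0 + RtoC (4 * y ^ 2) * 1)%C with
        ((z y - 2 * Ci * RtoC y) * (z y + 2 * Ci * RtoC y))%C.
      2:{ transitivity (z y * z y - 4 * (Ci * Ci) * (RtoC y * RtoC y))%C; [ring|].
          rewrite Hi; replace (4 * y ^ 2) with (4 * (y * y)) by ring.
          rewrite !RtoC_mult; ring. }
      rewrite Cmod_mult; apply Rmult_le_compat_l; [apply Cmod_ge_0|].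
      eapply Rle_trans; [|apply Im_le_Cmod]. simpl; unfold Re, Im in *; simpl; lra. }
    rewrite Rabs_right; [|lra].
    replace (z y - 0 - 2 * Ci * RtoC y)%C with (z y - 2 * Ci * RtoC y)%C by ring.
    pose proof (sq_le_pow32 y ltac:(lra)) as H4.
    apply (Rmult_le_compat_l C2) in H4; auto.
    apply (Rmult_le_reg_r y); auto. nra.
  - assert (Hx0 : 0 < x) by lra.
    set (K3 := C2 * (2 * b * sqrt (2 * b)) + 4 * e * sqrt b + 8 * b * e * KJ * c2).
    set (L := sq_lip_const b C2 e).
    exists (K3 / x + 4 * e * (L * sqrt b) / x / x); intros y Hy.
    pose proof (sq_derivative_bound x y Hx Hy) as H1; fold K3 in H1.
    pose proof (sq_lipschitz x y Hx Hy) as H2; fold L in H2.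
    pose proof (Hzl x ltac:(lra)) as Hzx.
    assert (HS : x <= Cmod (z y + z x)).
    { replace x with (0 + x) at 1 by ring; apply Cmod_sum_le_Im; auto; lra. }
    assert (NS : (z y + z x)%C <> 0) by (apply Cmod_gt_0; lra).
    assert (Nz : z x <> 0) by (apply Im_pos_neq_0; lra).
    assert (Nx : RtoC x <> 0) by now apply RtoC_pos_neq_0.
    assert (Hd : Cmod (z y - z x) <= L * Rabs (y - x) / x).
    { apply (Rmult_le_reg_r x); auto.
      unfold Rdiv; rewrite Rmult_assoc Rinv_l; [|lra]; rewrite Rmult_1_r.
      unfold P in H2; rewrite Csq_sub_factor Cmod_mult in H2.
      pose proof (Cmod_ge_0 (z y - z x)); nra. }
    unfold root_derivative; rewrite quotient_at_pos; auto.
    replace (z y - z x - - (4) * E x / (z x / RtoC x) * RtoC (y - x))%C with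
      ((P y - P x - (- RtoC (8 * x)) * E x * RtoC (y - x)) / (z y + z x)
       + RtoC (4 * x) * E x * RtoC (y - x) * (z y - z x) / (z x * (z y + z x)))%C
      by (unfold P; rewrite (RtoC_mult 8) (RtoC_mult 4); field; auto).
    set (s := Rabs (y - x)) in *.
    assert (Hs : 0 <= s <= b).
    { split; [apply Rabs_pos | unfold s; apply Rabs_le_between; lra]. }
    assert (Hss : s <= sqrt b * sqrt s).
    { pose proof (sqrt_sqrt s ltac:(lra)) as Es. pose proof (sqrt_pos s).
      assert (sqrt s <= sqrt b) by (apply sqrt_le_1_alt; lra). nra. }
    eapply Rle_trans; [apply Cmod_triangle|].
    rewrite Rmult_plus_distr_r; apply Rplus_le_compat.
    + replace (K3 / x * (s * sqrt s)) with (K3 * (s * sqrt s) / x) by (field; lra).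
      now apply Cdiv_Cmod_le.
    + apply (Rle_trans _ (4 * x * e * s * (L * s / x) / (x * x))).
      * apply Cdiv_Cmod_le; [nra | |].
        -- rewrite !Cmod_mult !Cmod_R (Rabs_right (4 * x)); [|lra].
           fold s; pose proof (exp_log_upper x Hx); pose proof (Cmod_ge_0 (E x)).
           apply Rmult_le_compat; auto using Cmod_ge_0.
           { repeat first [lra | apply Rmult_le_pos]. }
           apply Rmult_le_compat_r; [lra|]. apply Rmult_le_compat_l; lra.
        -- rewrite Cmod_mult; pose proof (Im_le_Cmod (z x)).
           apply Rmult_le_compat; lra.
      * replace (4 * x * e * s * (L * s / x) / (x * x)) with (4 * e * L / x / x * s * s)
          by (field; lra).
        replace (4 * e * (L * sqrt b) / x / x * (s * sqrt s)) with
          (4 * e * L / x / x * s * (sqrt b * sqrt s)) by (field; lra).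
        apply Rmult_le_compat_l; auto.
        apply Rmult_le_pos; [|lra].
        assert (0 <= L).
        { pose proof (sqrt_pos (2 * b)); pose proof (sqrt_pos b).
          unfold L, sq_lip_const; apply Rplus_le_le_0_compat;
            repeat first [lra | apply Rmult_le_pos]. }
        assert (0 < / x) by now apply Rinv_0_lt_compat.
        unfold Rdiv; repeat first [lra | apply Rmult_le_pos].
Qed.

End Root.

(** * The slit in terms of hitting flows *)

(** ** Derivatives within an interval *)

Lemma is_derive_within_iff {V : NormedModule R_AbsRing} a b (f : R -> V) t l :
  Icc a b t ->
  is_derive_within a b f t l <->
  (forall eps, 0 < eps -> exists d, 0 < d /\ forall y, Icc a b y -> Rabs (y - t) < d ->
     norm (minus (minus (f y) (f t)) (scal (y - t) l)) <= eps * Rabs (y - t)).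
Proof.
  intros Ht; split.
  - intros [_ H] eps He.
    destruct (H t) with (eps := mkposreal eps He) as [d Hd].
    + intros Q [d Hd]; exists d; intros y Hy _; now apply Hd.
    + exists d; split; [apply cond_pos|]; intros y Hy Hlt.
      apply (Hd y Hlt Hy).
  - intros H; split; [apply (is_linear_scal_l (K := R_AbsRing) l)|].
    intros x Hx eps.
    assert (E : t = x).
    { apply NNPP; intros N.
      assert (Hr : 0 < Rabs (t - x)) by (apply Rabs_pos_lt; lra).
      destruct (Hx (fun y => Rabs (y - x) < Rabs (t - x))) as [d Hd].
      - now apply (locally_of_dist _ x (Rabs (t - x))).
      - specialize (Hd t (ball_center t d) Ht); lra. }
    rewrite -E; destruct (H eps (cond_pos eps)) as [d [Hd Hb]].
    apply (locally_of_dist _ t d Hd); intros y Hy Hyi; now apply Hb.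
Qed.

Lemma is_derive_within_C_iff a b (f : R -> C) t (l : C) :
  Icc a b t ->
  is_derive_within (V := C_R_NormedModule) a b f t l <->
  (forall eps, 0 < eps -> exists d, 0 < d /\ forall y, Icc a b y -> Rabs (y - t) < d ->
     Cmod (f y - f t - l * RtoC (y - t)) <= eps * Rabs (y - t)).
Proof.
  intros Ht.
  assert (E : forall y, @norm R_AbsRing C_R_NormedModule
     (minus (minus (f y) (f t)) (scal (y - t) l)) = Cmod (f y - f t - l * RtoC (y - t))).
  { intros y; rewrite norm_C_R_Cmod; f_equal.
    apply injective_projections;
      unfold Cminus, Cplus, Copp, Cmult, RtoC; simpl;
      unfold minus, plus, opp, scal; simpl; unfold mult; simpl; ring. }
  rewrite (is_derive_within_iff (V := C_R_NormedModule) a b f t l Ht).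
  split; intros H eps He; destruct (H eps He) as [d [Hd Hb]]; exists d; split; auto;
    intros y Hy Hlt; specialize (Hb y Hy Hlt); rewrite ?E in Hb |- *; exact Hb.
Qed.

Lemma is_derive_within_C_elim a b (f : R -> C) t (l : C) :
  Icc a b t -> is_derive_within (V := C_R_NormedModule) a b f t l ->
  forall eps, 0 < eps -> exists d, 0 < d /\ forall y, Icc a b y -> Rabs (y - t) < d ->
     Cmod (f y - f t - l * RtoC (y - t)) <= eps * Rabs (y - t).
Proof. intros Ht; apply (is_derive_within_C_iff a b f t l Ht). Qed.

Lemma is_derive_within_unique a b (f : R -> C) t (l1 l2 : C) : a < b -> Icc a b t ->
  is_derive_within (V := C_R_NormedModule) a b f t l1 ->
  is_derive_within (V := C_R_NormedModule) a b f t l2 -> l1 = l2.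
Proof.
  intros Hab Ht D1 D2.
  pose proof (is_derive_within_C_elim _ _ _ _ _ Ht D1) as H1.
  pose proof (is_derive_within_C_elim _ _ _ _ _ Ht D2) as H2.
  assert (K : Cmod (l1 - l2) <= 0).
  { apply Rnot_lt_le; intros L.
    destruct (H1 (Cmod (l1 - l2) / 4)) as [d1 [Hd1 B1]]; [lra|].
    destruct (H2 (Cmod (l1 - l2) / 4)) as [d2 [Hd2 B2]]; [lra|].
    assert (X : exists y, Icc a b y /\ 0 < Rabs (y - t) /\ Rabs (y - t) < d1 /\ Rabs (y - t) < d2).
    { pose (r := Rmin (Rmin d1 d2) (b - a) / 2).
      assert (Hr : 0 < r /\ r < d1 /\ r < d2 /\ r <= (b - a) / 2).
      { assert (0 < Rmin (Rmin d1 d2) (b - a)) by (repeat apply Rmin_pos; lra).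
        pose proof (Rmin_l (Rmin d1 d2) (b - a)); pose proof (Rmin_r (Rmin d1 d2) (b - a)).
        pose proof (Rmin_l d1 d2); pose proof (Rmin_r d1 d2). unfold r; lra. }
      unfold Icc in *; destruct (Rle_dec (t + r) b).
      - exists (t + r); replace (t + r - t) with r by ring; rewrite Rabs_right; lra.
      - exists (t - r); replace (t - r - t) with (- r) by ring; rewrite Rabs_left; lra. }
    destruct X as [y [Hy [H0 [L1 L2]]]].
    specialize (B1 y Hy L1); specialize (B2 y Hy L2).
    assert (B : Cmod (l1 - l2) * Rabs (y - t) <= Cmod (l1 - l2) / 2 * Rabs (y - t)).
    { rewrite -(Cmod_R (y - t)) -Cmod_mult.
      replace ((l1 - l2) * RtoC (y - t))%C with
        ((f y - f t - l2 * RtoC (y - t)) - (f y - f t - l1 * RtoC (y - t)))%C by ring.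
      eapply Rle_trans; [apply Cmod_triangle|]. rewrite Cmod_opp Cmod_R. lra. }
    nra. }
  assert (K2 : (l1 - l2)%C = 0) by (apply Cmod_eq_0; pose proof (Cmod_ge_0 (l1 - l2)); lra).
  transitivity (l1 - l2 + l2)%C; [ring | rewrite K2; ring].
Qed.

Lemma Cderiv_of_within a b (f : R -> C) t (l : C) : a < t < b ->
  is_derive_within (V := C_R_NormedModule) a b f t l -> Cderiv f t l.
Proof.
  intros Ht Hw; assert (Hi : Icc a b t) by (unfold Icc; lra).
  pose proof (is_derive_within_C_elim _ _ _ _ _ Hi Hw) as H.
  assert (K : forall eps, 0 < eps -> exists d : posreal, forall h, h <> 0 -> Rabs h < d ->
     Cmod ((f (t + h)%R - f t - l * RtoC h) / RtoC h) < eps).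
  { intros eps He; destruct (H (eps / 2)) as [d [Hd B]]; [lra|].
    assert (P : 0 < Rmin d (Rmin (t - a) (b - t))) by (repeat apply Rmin_pos; lra).
    exists (mkposreal _ P); simpl; intros h Hh Hlt.
    pose proof (Rmin_l d (Rmin (t - a) (b - t))); pose proof (Rmin_r d (Rmin (t - a) (b - t))).
    pose proof (Rmin_l (t - a) (b - t)); pose proof (Rmin_r (t - a) (b - t)).
    assert (Rabs h < t - a /\ Rabs h < b - t) as [K1 K2] by lra.
    apply Rabs_def2 in K1; apply Rabs_def2 in K2.
    specialize (B (t + h)); replace (t + h - t) with h in B by ring.
    specialize (B ltac:(unfold Icc; lra) ltac:(lra)).
    assert (0 < Rabs h) by now apply Rabs_pos_lt.
    rewrite Cmod_div; [|intros E; apply RtoC_inj in E; auto].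
    rewrite Cmod_R; apply (Rmult_lt_reg_r (Rabs h)); auto.
    unfold Rdiv; rewrite Rmult_assoc Rinv_l; [|lra]. nra. }
  split; apply is_derive_Reals; intros eps He; destruct (K eps He) as [d Hd]; exists d;
    intros h Hh Hlt; specialize (Hd h Hh Hlt);
    (eapply Rle_lt_trans; [|exact Hd]).
  - eapply Rle_trans; [|apply re_le_Cmod]. right; f_equal.
    unfold Cdiv, Cinv, Cminus, Cplus, Copp, Cmult, RtoC, Re, Im; simpl; field; auto.
  - eapply Rle_trans; [|apply Im_abs_le_Cmod]. right; f_equal.
    unfold Cdiv, Cinv, Cminus, Cplus, Copp, Cmult, RtoC, Re, Im; simpl; field; auto.
Qed.

Lemma Ccont_clamp_of_within b (f f' : R -> C) : 0 <= b ->
  (forall t, Icc 0 b t -> is_derive_within (V := C_R_NormedModule) 0 b f t (f' t)) ->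
  forall x, Ccont (fun y => f (clamp b y)) x.
Proof.
  intros Hb H x. pose proof (clamp_in b x Hb) as Hx.
  pose proof (is_derive_within_C_elim _ _ _ _ _ Hx (H (clamp b x) Hx)) as H1.
  destruct (H1 1) as [d [Hd B]]; [lra|].
  pose (k := 1 + Cmod (f' (clamp b x))).
  assert (Hk : 0 <= k) by (pose proof (Cmod_ge_0 (f' (clamp b x))); unfold k; lra).
  apply (Ccont_of_bound _ (fun y => k * Rabs (y - x)) x d Hd).
  - apply: continuous_mult; [apply continuous_const|].
    apply (continuous_comp (fun y => y - x) Rabs); [|apply continuous_Rabs].
    apply: continuous_minus; [apply continuous_id | apply continuous_const].
  - rewrite Rminus_diag Rabs_R0; ring.
  - intros y Hy; pose proof (clamp_lipschitz b y x) as Hc.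
    specialize (B (clamp b y) (clamp_in b y Hb) ltac:(lra)).
    replace (f (clamp b y) - f (clamp b x))%C with
      ((f (clamp b y) - f (clamp b x) - f' (clamp b x) * RtoC (clamp b y - clamp b x))
       + f' (clamp b x) * RtoC (clamp b y - clamp b x))%C by ring.
    eapply Rle_trans; [apply Cmod_triangle|].
    rewrite Cmod_mult Cmod_R.
    apply (Rle_trans _ (k * Rabs (clamp b y - clamp b x))); [unfold k; lra|].
    now apply Rmult_le_compat_l.
Qed.

(** The mean value inequality for [f u - v t * u] holds up to the endpoints. *)
Lemma is_derive_within_of_interior a b (f v : R -> C) t : Icc a b t ->
  (forall x, a <= x <= b -> Ccont f x) ->
  (forall x, a < x < b -> Cderiv f x (v x)) ->
  Ccont v t -> is_derive_within (V := C_R_NormedModule) a b f t (v t).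
Proof.
  intros Ht Hf Hd [Hv1 Hv2]; apply is_derive_within_C_iff; auto; unfold Icc in *.
  intros eps He.
  apply continuity_pt_filterlim in Hv1; apply continuity_pt_filterlim in Hv2.
  destruct (Hv1 (eps / 2)) as [d1 [Hd1 B1]]; [lra|].
  destruct (Hv2 (eps / 2)) as [d2 [Hd2 B2]]; [lra|].
  exists (Rmin d1 d2); split; [apply Rmin_pos; lra|].
  pose proof (Rmin_l d1 d2); pose proof (Rmin_r d1 d2).
  assert (Hnear : forall x, Rabs (x - t) < Rmin d1 d2 -> Cmod (v x - v t) <= eps).
  { intros x Hx; eapply Rle_trans; [apply Cmod_le_sum|].
    destruct (Req_dec t x) as [E|N].
    - rewrite E; replace (v x - v x)%C with (RtoC 0) by ring; simpl; rewrite Rabs_R0; lra.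
    - specialize (B1 x); specialize (B2 x); unfold dist in *; simpl in *; unfold R_dist in *.
      specialize (B1 ltac:(split; [split; [exact I | auto] | lra])).
      specialize (B2 ltac:(split; [split; [exact I | auto] | lra])).
      unfold Re, Im, Rminus in *; lra. }
  assert (K : forall x y, a <= x <= y -> y <= b -> (forall u, x < u < y -> Rabs (u - t) < Rmin d1 d2) ->
     Cmod (f y - f x - v t * RtoC (y - x)) <= eps * (y - x)).
  { intros x y Hx Hy Hu.
    replace (f y - f x - v t * RtoC (y - x))%C with
      ((f y - v t * RtoC y) - (f x - v t * RtoC x))%C by (rewrite RtoC_minus; ring).
    rewrite Rmult_minus_distr_l.
    apply (Cmod_increment_le (fun u => (f u - v t * RtoC u)%C) (fun u => (v u - v t)%C)
      (fun u => eps * u) (fun _ => eps)); try lra.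
    - intros u Hu'; apply Ccont_minus; [apply Hf; lra|].
      apply Ccont_mult; [apply Ccont_const | apply Ccont_RtoC, continuous_id].
    - intros u _; apply: ex_derive_continuous; auto_derive; exact I.
    - intros u Hu'; eapply Cderiv_eq.
      + apply Cderiv_minus; [apply Hd; lra|].
        apply Cderiv_mult; [apply Cderiv_const | apply (Cderiv_RtoC (fun u => u)), is_derive_id].
      + cbv beta; change (RtoC one) with (RtoC 1); ring.
    - intros u _; auto_derive; [exact I | ring].
    - intros u Hu'; apply Hnear, Hu; lra. }
  intros y Hy Hlt; destruct (Rle_dec t y) as [L|L].
  - rewrite (Rabs_right (y - t)) in Hlt |- *; try lra.
    apply K; try lra. intros u Hu; rewrite Rabs_right; lra.
  - rewrite (Rabs_left (y - t)) in Hlt |- *; try lra.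
    replace (f y - f t - v t * RtoC (y - t))%C with (- (f t - f y - v t * RtoC (t - y)))%C
      by (rewrite !RtoC_minus; ring).
    rewrite Cmod_opp; replace (- (y - t)) with (t - y) by ring.
    apply K; try lra. intros u Hu; rewrite Rabs_left; lra.
Qed.

(** ** Solutions of the Loewner equation *)

Lemma Ccont_div_2 (f : R -> C) x : f x <> 0 -> Ccont f x -> Ccont (fun r => (2 / f r)%C) x.
Proof.
  intros N [H1 H2].
  assert (P : Re (f x) ^ 2 + Im (f x) ^ 2 <> 0).
  { rewrite -Cmod_sq; apply pow_nonzero. pose proof (proj1 (Cmod_gt_0 (f x)) N); lra. }
  assert (K : continuous (fun r => / (Re (f r) ^ 2 + Im (f r) ^ 2)) x).
  { apply (continuous_Rinv_comp (fun r => Re (f r) ^ 2 + Im (f r) ^ 2)); auto.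
    apply: continuous_plus; apply: continuous_mult; auto;
      apply: continuous_mult; auto using continuous_const. }
  split.
  - apply (continuous_ext (fun r => 2 * Re (f r) * / (Re (f r) ^ 2 + Im (f r) ^ 2))).
    + intros r; rewrite Re_2div; reflexivity.
    + apply: continuous_mult; auto. apply: continuous_mult; auto using continuous_const.
  - apply (continuous_ext (fun r => - 2 * Im (f r) * / (Re (f r) ^ 2 + Im (f r) ^ 2))).
    + intros r; rewrite Im_2div; reflexivity.
    + apply: continuous_mult; auto. apply: continuous_mult; auto using continuous_const.
Qed.

Lemma Cmod_bounded_below (f : R -> C) a b : a <= b ->
  (forall x, a <= x <= b -> Ccont f x) -> (forall x, a <= x <= b -> f x <> 0) ->
  exists m, 0 < m /\ forall x, a <= x <= b -> m <= Cmod (f x).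
Proof.
  intros Hab Hc Hn.
  destruct (continuity_ab_min (fun x => Re (f x) ^ 2 + Im (f x) ^ 2) a b Hab) as [x0 [Hx0 Hi]].
  - intros x Hx; apply continuity_pt_filterlim; destruct (Hc x Hx).
    apply: continuous_plus; apply: continuous_mult; auto;
      apply: continuous_mult; auto using continuous_const.
  - exists (Cmod (f x0)); split; [apply Cmod_gt_0, Hn, Hi|].
    intros x Hx; specialize (Hx0 x Hx); simpl in Hx0.
    pose proof (Cmod_sq (f x)); pose proof (Cmod_sq (f x0)).
    pose proof (Cmod_ge_0 (f x)); pose proof (Cmod_ge_0 (f x0)). simpl in *; nra.
Qed.

Lemma Loewner_solution_restrict lam s s' z g : 0 <= s' <= s ->
  Loewner_solution lam s z g -> Loewner_solution lam s' z g.
Proof.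
  intros Hs [H0 H]; split; auto; intros r Hr; unfold Icc in *.
  destruct (H r ltac:(lra)) as [H1 H2]; split; auto.
  assert (Hi : Icc 0 s r) by (unfold Icc; lra).
  pose proof (is_derive_within_C_elim _ _ _ _ _ Hi H2) as H3.
  apply is_derive_within_C_iff; [unfold Icc; lra|].
  intros eps He; destruct (H3 eps He) as [d [Hd B]]; exists d; split; auto.
  intros y Hy; apply B; unfold Icc in *; lra.
Qed.

Section Slit_point.

(** The slit depends on [lam] only between [0] and [T]; [lc] continues it to the
    whole line. *)
Context (T M : R) (lam lc l : R -> R) (HT : 0 < T) (HD : driver T M lc l)
  (Hlc : forall r, 0 <= r <= T -> lc r = lam r).

(** Both solutions stay away from the driving function on the compact interval,
    so the vector field is Lipschitz along them. *)
Lemma Loewner_solution_unique s z g1 g2 : 0 <= s <= T ->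
  Loewner_solution lam s z g1 -> Loewner_solution lam s z g2 ->
  forall r, 0 <= r <= s -> g1 r = g2 r.
Proof.
  intros Hs [E1 H1] [E2 H2] r Hr.
  destruct (Req_dec r 0) as [->|N]; [congruence|].
  assert (HC : forall g, g 0 = z -> (forall r, Icc 0 s r -> g r <> RtoC (lam r) /\
     is_derive_within (V := C_R_NormedModule) 0 s g r (RtoC 2 / (g r - RtoC (lam r)))%C) ->
     (forall x, Ccont (fun y => g (clamp s y)) x) /\
     (forall x, 0 < x < s -> Cderiv (fun y => g (clamp s y)) x (2 / (g x - RtoC (lam x)))) /\
     exists m, 0 < m /\ forall x, 0 <= x <= s -> m <= Cmod (g x - RtoC (lam x))).
  { intros g E H.
    assert (Cg : forall x, Ccont (fun y => g (clamp s y)) x).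
    { apply (Ccont_clamp_of_within s g (fun r => RtoC 2 / (g r - RtoC (lam r)))%C); [lra|].
      intros x Hx; now apply H. }
    split; auto; split.
    - intros x Hx; apply (Cderiv_ext_loc g).
      + assert (P : 0 < Rmin x (s - x)) by (apply Rmin_pos; lra).
        apply (locally_of_dist _ x _ P); intros y Hy; apply Rabs_def2 in Hy.
        pose proof (Rmin_l x (s - x)); pose proof (Rmin_r x (s - x)).
        rewrite clamp_id; auto; lra.
      + apply (Cderiv_of_within 0 s); auto. apply H; unfold Icc; lra.
    - destruct (Cmod_bounded_below (fun x => (g (clamp s x) - RtoC (lc x))%C) 0 s)
        as [m [Hm B]]; [lra | | |].
      + intros x Hx; apply Ccont_minus; auto. apply Ccont_RtoC, (driver_cont _ _ _ _ HD).
      + intros x Hx; rewrite clamp_id // Hlc; [|lra].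
        intros E0; apply (proj1 (H x Hx)).
        transitivity (g x - RtoC (lam x) + RtoC (lam x))%C; [ring | rewrite E0; ring].
      + exists m; split; auto; intros x Hx; specialize (B x Hx).
        rewrite clamp_id // Hlc in B; lra. }
  destruct (HC g1 E1 H1) as [C1 [D1 [m1 [Hm1 B1]]]].
  destruct (HC g2 E2 H2) as [C2 [D2 [m2 [Hm2 B2]]]].
  pose (f := fun x => (g1 (clamp s x) - g2 (clamp s x))%C).
  destruct (Cmod_gronwall f (fun x => (2 / (g1 x - RtoC (lam x)) - 2 / (g2 x - RtoC (lam x)))%C)
    (fun x => 2 / (m1 * m2) * x) (fun _ => 2 / (m1 * m2)) 0 r) as [G _]; try lra.
  - intros x Hx; apply Ccont_minus; auto.
  - intros x Hx; apply: ex_derive_continuous; auto_derive; exact I.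
  - intros x Hx; apply Cderiv_minus; [apply D1 | apply D2]; lra.
  - intros x Hx; auto_derive; [exact I | ring].
  - intros x Hx; unfold f; rewrite !clamp_id; try lra.
    pose proof (B1 x ltac:(lra)) as b1; pose proof (B2 x ltac:(lra)) as b2.
    set (z1 := (g1 x - RtoC (lam x))%C) in *; set (z2 := (g2 x - RtoC (lam x))%C) in *.
    assert (N1 : z1 <> 0) by (apply Cmod_gt_0; lra).
    assert (N2 : z2 <> 0) by (apply Cmod_gt_0; lra).
    replace (2 / z1 - 2 / z2)%C with (- (2 * (g1 x - g2 x)) / (z1 * z2))%C
      by (replace (g1 x - g2 x)%C with (z1 - z2)%C by (unfold z1, z2; ring); field; auto).
    replace (2 / (m1 * m2) * Cmod (g1 x - g2 x)) with (2 * Cmod (g1 x - g2 x) / (m1 * m2))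
      by (field; lra).
    apply Cdiv_Cmod_le; [nra | |].
    + rewrite Cmod_opp Cmod_mult Cmod_R Rabs_right; lra.
    + rewrite Cmod_mult; apply Rmult_le_compat; lra.
  - assert (E0 : f 0 = 0) by (unfold f; rewrite clamp_id ?E1 ?E2; [ring | lra]).
    rewrite E0 Cmod_0 Rmult_0_l in G.
    assert (Er : f r = 0) by (apply Cmod_eq_0; pose proof (Cmod_ge_0 (f r)); lra).
    unfold f in Er; rewrite clamp_id in Er; [|lra].
    transitivity (g1 r - g2 r + g2 r)%C; [ring | rewrite Er; ring].
Qed.

(** By uniqueness, the value at [r] of a solution on [0, s] does not depend on
    [s]; the choice [s = (r + t) / 2] defines [G r] up to time [t]. *)
Lemma Loewner_solutions_glue t z : 0 < t <= T ->
  (forall s, 0 <= s < t -> exists g, Loewner_solution lam s z g) ->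
  exists G : R -> C, (forall r, r <= 0 -> G r = z) /\
    (forall r, 0 <= r < t -> G r <> RtoC (lc r)) /\
    (forall r, r < t -> Ccont G r) /\
    (forall r, 0 < r < t -> Cderiv G r (2 / (G r - RtoC (lc r)))).
Proof.
  intros Ht Hs.
  pose (gs := fun s => epsilon (inhabits (fun _ : R => RtoC 0))
    (fun g => Loewner_solution lam s z g)).
  assert (Hgs : forall s, 0 <= s < t -> Loewner_solution lam s z (gs s))
    by (intros s H; apply (epsilon_spec (inhabits (fun _ : R => RtoC 0))), Hs, H).
  pose (G := fun r => gs ((Rmax 0 r + t) / 2) (Rmax 0 r)).
  assert (HG : forall s r, 0 <= r <= s -> s < t -> G r = gs s r).
  { intros s r Hr Hst; unfold G; rewrite Rmax_right; [|lra].
    destruct (Rle_dec s ((r + t) / 2)) as [L|L].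
    - apply (Loewner_solution_unique s z); try lra.
      + apply (Loewner_solution_restrict lam ((r + t) / 2)); [lra|]; apply Hgs; lra.
      + apply Hgs; lra.
    - apply (Loewner_solution_unique ((r + t) / 2) z); try lra.
      + apply Hgs; lra.
      + apply (Loewner_solution_restrict lam s); [lra|]; apply Hgs; lra. }
  assert (HG0 : forall r, r <= 0 -> G r = z).
  { intros r Hr; unfold G; rewrite Rmax_left; [|lra]; apply Hgs; lra. }
  assert (HC : forall s x, 0 < s < t -> x < s -> locally x (fun y => gs s (clamp s y) = G y)).
  { intros s x Hst Hx; apply (locally_of_dist _ x (s - x)); [lra|]; intros y Hy.
    apply Rabs_def2 in Hy; destruct (Rle_dec 0 y).
    - rewrite clamp_id; [|lra]; symmetry; apply HG; lra.
    - rewrite HG0; [|lra]. replace (clamp s y) with 0; [apply Hgs; lra|].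
      unfold clamp; rewrite Rmin_right ?Rmax_left; lra. }
  exists G; split; [|split; [|split]]; auto.
  - intros r Hr; rewrite Hlc; [|lra].
    rewrite (HG ((r + t) / 2)); try lra. apply Hgs; unfold Icc; lra.
  - intros r Hr; pose (s := (Rmax 0 r + t) / 2).
    assert (Rmax 0 r < t) by (apply Rmax_lub_lt; lra).
    pose proof (Rmax_l 0 r); pose proof (Rmax_r 0 r).
    assert (Hst : 0 < s < t /\ r < s) by (unfold s; lra).
    destruct (Hgs s ltac:(lra)) as [_ Hsol].
    destruct (Ccont_clamp_of_within s (gs s) (fun r => RtoC 2 / (gs s r - RtoC (lam r)))%C
      ltac:(lra) (fun x Hx => proj2 (Hsol x Hx)) r) as [K1 K2].
    pose proof (HC s r ltac:(lra) ltac:(lra)) as E.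
    split; [eapply continuous_ext_loc, K1 | eapply continuous_ext_loc, K2];
      revert E; apply filter_imp; intros y <-; auto.
  - intros r Hr; pose (s := (r + t) / 2).
    assert (Hst : 0 < s < t /\ r < s) by (unfold s; lra).
    destruct (Hgs s ltac:(lra)) as [_ Hsol].
    rewrite (HG s r) ?Hlc; try lra.
    apply (Cderiv_ext_loc (gs s)).
    + assert (P : 0 < Rmin r (s - r)) by (apply Rmin_pos; lra).
      apply (locally_of_dist _ r _ P); intros y Hy; apply Rabs_def2 in Hy.
      pose proof (Rmin_l r (s - r)); pose proof (Rmin_r r (s - r)).
      symmetry; apply HG; lra.
    + apply (Cderiv_of_within 0 s); [lra|]. apply Hsol; unfold Icc; lra.
Qed.

(** [Z ^ 2] has the bounded derivative [4 - 2 l Z], so it has a limit at [t]; a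
    nonzero limit would keep the vector field bounded, and the solution would
    continue up to time [t]. *)
Lemma hitting_flow_of_escape t z : 0 < t <= T -> 0 < Im z ->
  (forall s, 0 <= s < t -> exists g, Loewner_solution lam s z g) ->
  (~ exists g, Loewner_solution lam t z g) ->
  exists Z : R -> C, hitting_flow l t Z /\ Z 0 = (z - RtoC (lam 0))%C.
Proof.
  intros Ht Hz Hs Hno.
  pose proof (driver_bound_ge_0 _ _ _ _ HD) as HM.
  destruct (Loewner_solutions_glue t z Ht Hs) as [G [G0 [GN [GC GD]]]].
  pose (Y := fun r => (G r - RtoC (lc r))%C).
  assert (YC : forall r, r < t -> Ccont Y r).
  { intros r Hr; apply Ccont_minus; auto; apply Ccont_RtoC, (driver_cont _ _ _ _ HD). }
  assert (YN : forall r, 0 <= r < t -> Y r <> 0).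
  { intros r Hr E; apply (GN r Hr).
    transitivity (Y r + RtoC (lc r))%C; [unfold Y; ring | rewrite E; ring]. }
  assert (YD : forall r, 0 < r < t -> Cderiv Y r (2 / Y r - RtoC (l r))).
  { intros r Hr; apply Cderiv_minus; [now apply GD|].
    apply Cderiv_RtoC, (driver_derive _ _ _ _ HD); lra. }
  assert (YP : forall r, 0 <= r < t -> 0 < Re (Y r) ^ 2 + Im (Y r) ^ 2).
  { intros r Hr; rewrite -Cmod_sq; pose proof (proj1 (Cmod_gt_0 (Y r)) (YN r Hr)); nra. }
  (* [(Im Y)' = - 2 Im Y / |Y| ^ 2] with [|Y|] bounded below on [0, r], so
     [Im Y * exp (k x)] is nondecreasing for [k] large, while it is positive. *)
  assert (Ypos : forall r, r < t -> 0 < Im (Y r)).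
  { intros r Hr.
    destruct (Rle_dec r 0) as [L|L].
    { unfold Y; rewrite G0; auto; simpl; unfold Im in *; lra. }
    destruct (Cmod_bounded_below Y 0 r) as [m [Hm B]]; [lra | | |].
    { intros x Hx; apply YC; lra. }
    { intros x Hx; apply YN; lra. }
    pose (k := 2 / m ^ 2).
    enough (- (Im (Y r) * exp (k * r)) < 0) by (pose proof (exp_pos (k * r)); nra).
    apply (Rle_lt_trans _ (- (Im (Y 0) * exp (k * 0)))).
    2:{ unfold Y; rewrite G0; [|lra]; rewrite Rmult_0_r exp_0; simpl; unfold Im in *; lra. }
    apply (barrier (fun x => - (Im (Y x) * exp (k * x)))
      (fun x => - ((Im (Y x) * exp (k * x)) * (k - 2 * / (Re (Y x) ^ 2 + Im (Y x) ^ 2)))) 0 r 0);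
      try lra.
    - intros x Hx; destruct (YC x ltac:(lra)).
      apply: continuous_opp; apply: continuous_mult; auto.
      apply: ex_derive_continuous; auto_derive; exact I.
    - intros x Hx; apply: is_derive_opp; eapply is_derive_eq.
      + apply: is_derive_mulR; [apply (proj2 (YD x ltac:(lra)))|].
        apply (is_derive_eq _ _ (k * exp (k * x))); [auto_derive; [exact I | ring] | reflexivity].
      + pose proof (Im_2div (Y x)) as E.
        replace (Im (2 / Y x - RtoC (l x))) with (Im (2 / Y x))
          by (simpl; unfold Im; simpl; ring).
        rewrite E; unfold Rdiv; ring.
    - unfold Y; rewrite G0; [|lra]; rewrite Rmult_0_r exp_0; simpl; unfold Im in *; lra.
    - intros x Hx Hlt. pose proof (exp_pos (k * x)).
      pose proof (B x ltac:(lra)) as Bx. pose proof (Cmod_sq (Y x)) as E.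
      pose proof (YP x ltac:(lra)).
      assert (2 * / (Re (Y x) ^ 2 + Im (Y x) ^ 2) <= k).
      { unfold k, Rdiv; apply Rmult_le_compat_l; [lra|].
        apply Rinv_le_contravar; nra. }
      assert (0 < Im (Y x)) by nra.
      assert (0 < Im (Y x) * exp (k * x)) by nra. nra. }
  (* [(|Y| ^ 2)'] is at most [4 + 2 M |Y|], so [|Y| ^ 2 + A] grows at most like
     [exp]. *)
  pose (A := 4 + M ^ 2). assert (HA : 4 <= A) by (unfold A; nra).
  pose (R2 := (Cmod (Y 0) ^ 2 + A) * exp t).
  assert (Ybd : forall r, 0 <= r < t -> Cmod (Y r) ^ 2 <= R2).
  { intros r Hr.
    assert (K : (Re (Y r) * Re (Y r) + Im (Y r) * Im (Y r) + A) * exp (- r) <=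
                (Re (Y 0) * Re (Y 0) + Im (Y 0) * Im (Y 0) + A) * exp (- 0)).
    { apply (nonincreasing_of_derive
        (fun x => (Re (Y x) * Re (Y x) + Im (Y x) * Im (Y x) + A) * exp (- x))
        (fun x => (4 * (Re (Y x) ^ 2 - Im (Y x) ^ 2) * / (Re (Y x) ^ 2 + Im (Y x) ^ 2)
           - 2 * l x * Re (Y x)
           - (Re (Y x) * Re (Y x) + Im (Y x) * Im (Y x) + A)) * exp (- x)) 0 r); try lra.
      - intros x Hx; destruct (YC x ltac:(lra)).
        apply: continuous_mult.
        + apply: continuous_plus; [|apply continuous_const].
          apply: continuous_plus; apply: continuous_mult; auto.
        + apply: ex_derive_continuous; auto_derive; exact I.
      - intros x Hx; destruct (YD x ltac:(lra)) as [D1 D2]; eapply is_derive_eq.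
        + apply: is_derive_mulR.
          * apply: is_derive_plus; [|apply is_derive_const].
            apply: is_derive_plus; apply: is_derive_mulR; eassumption.
          * apply (is_derive_eq _ _ (- exp (- x))); [auto_derive; [exact I | ring] | reflexivity].
        + replace (Im (2 / Y x - RtoC (l x))) with (Im (2 / Y x))
            by (simpl; unfold Im; simpl; ring).
          replace (Re (2 / Y x - RtoC (l x))) with (Re (2 / Y x) - l x)
            by (simpl; unfold Re; simpl; ring).
          rewrite Im_2div Re_2div; unfold plus, zero; simpl; unfold Rdiv; ring.
      - intros x Hx. pose proof (exp_pos (- x)). pose proof (YP x ltac:(lra)) as P.
        assert ((Re (Y x) ^ 2 - Im (Y x) ^ 2) * / (Re (Y x) ^ 2 + Im (Y x) ^ 2) <= 1).
        { apply (Rmult_le_reg_r (Re (Y x) ^ 2 + Im (Y x) ^ 2)); auto.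
          rewrite Rmult_assoc Rinv_l; nra. }
        pose proof (driver_bound _ _ _ _ HD x) as Bl; apply Rabs_le_between in Bl.
        assert (- 2 * l x * Re (Y x) <= M ^ 2 + Re (Y x) ^ 2).
        { assert (l x ^ 2 <= M ^ 2) by nra. pose proof (pow2_ge_0 (l x + Re (Y x))). lra. }
        assert (0 <= Im (Y x) ^ 2) by nra. unfold A.
        assert (4 * (Re (Y x) ^ 2 - Im (Y x) ^ 2) * / (Re (Y x) ^ 2 + Im (Y x) ^ 2)
           - 2 * l x * Re (Y x)
           - (Re (Y x) * Re (Y x) + Im (Y x) * Im (Y x) + (4 + M ^ 2)) <= 0) by lra.
        nra. }
    rewrite Ropp_0 exp_0 Rmult_1_r in K.
    rewrite Cmod_sq; unfold R2; rewrite Cmod_sq.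
    assert (E1 : exp (- r) * exp r = 1) by (rewrite -exp_plus Rplus_opp_l exp_0; auto).
    assert (E2 : exp r <= exp t) by (apply exp_nondecreasing; lra).
    apply (Rmult_le_compat_r (exp r)) in K; [|left; apply exp_pos].
    rewrite Rmult_assoc E1 in K.
    pose proof (exp_pos r). nra. }
  assert (HR2 : 0 <= R2) by (pose proof (Ybd 0 ltac:(lra)); pose proof (pow2_ge_0 (Cmod (Y 0))); lra).
  pose (L := 4 + 2 * M * sqrt R2).
  assert (HL : 4 <= L) by (pose proof (sqrt_pos R2); unfold L; nra).
  assert (Qinc : forall x y, 0 <= x <= y -> y < t -> Cmod (Y y * Y y - Y x * Y x) <= L * y - L * x).
  { intros x y Hx Hy.
    apply (Cmod_increment_le (fun u => (Y u * Y u)%C) (fun u => (4 - 2 * RtoC (l u) * Y u)%C)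
      (fun u => L * u) (fun _ => L)); try lra.
    - intros u Hu; apply Ccont_mult; apply YC; lra.
    - intros u Hu; apply: ex_derive_continuous; auto_derive; exact I.
    - intros u Hu; pose proof (YD u ltac:(lra)) as D; eapply Cderiv_eq.
      + apply Cderiv_mult; exact D.
      + field; apply YN; lra.
    - intros u Hu; auto_derive; [exact I | ring].
    - intros u Hu; eapply Rle_trans; [apply Cmod_triangle|].
      rewrite Cmod_opp !Cmod_mult !Cmod_R (Rabs_right 4) ?(Rabs_right 2); try lra.
      pose proof (driver_bound _ _ _ _ HD u). pose proof (Rabs_pos (l u)).
      assert (Cmod (Y u) <= sqrt R2).
      { rewrite -(sqrt_pow2 (Cmod (Y u))); [|apply Cmod_ge_0].
        apply sqrt_le_1_alt, Ybd; lra. }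
      pose proof (Cmod_ge_0 (Y u)).
      assert (Rabs (l u) * Cmod (Y u) <= M * sqrt R2) by (apply Rmult_le_compat; lra).
      unfold L; lra. }
  destruct (C_limit_at_end (fun u => (Y u * Y u)%C) (fun u => L * u) 0 t) as [q Hq];
    [lra | auto | intros x Hx; nra |].
  cbv beta in Hq.
  (* If the limit [q] of [Y ^ 2] vanishes, [Y] extended by [0] is the flow sought;
     otherwise the solution extends to the closed interval. *)
  destruct (Req_dec (Cmod q) 0) as [Eq|Nq].
  - apply Cmod_eq_0 in Eq; exists (extend_by t Y 0); split.
    + constructor.
      * apply (Ccont_extend_by t Y 0 (fun r => sqrt (2 * L) * sqrt (t - r)) 0); auto; try lra.
        -- intros r Hr; specialize (Hq r Hr).
           replace (Y r - 0)%C with (Y r) by ring.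
           rewrite Eq in Hq; replace (Y r * Y r - 0)%C with (Y r * Y r)%C in Hq by ring.
           rewrite Cmod_mult in Hq.
           rewrite -sqrt_mult_alt; [|lra].
           rewrite -(sqrt_pow2 (Cmod (Y r))); [|apply Cmod_ge_0].
           apply sqrt_le_1_alt; nra.
        -- intros r; apply Rmult_le_pos; apply sqrt_pos.
        -- apply: continuous_mult; [apply continuous_const | apply continuous_sqrt_sub].
        -- rewrite Rminus_diag sqrt_0; ring.
      * now rewrite extend_by_right; [|lra].
      * intros r Hr; rewrite extend_by_left; auto.
      * intros r Hr; rewrite extend_by_left; [|lra]; apply Cderiv_extend_by; auto; lra.
    + rewrite extend_by_left; [|lra]; unfold Y; rewrite G0 ?Hlc; auto; lra.
  - exfalso; apply Hno.
    assert (Hq0 : 0 < Cmod q) by (pose proof (Cmod_ge_0 q); lra).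
    pose (r0 := Rmax 0 (t - Cmod q / (4 * L))).
    assert (Hr0 : 0 <= r0 < t /\ t - r0 <= Cmod q / (4 * L)).
    { pose proof (Rmax_r 0 (t - Cmod q / (4 * L))).
      assert (0 < Cmod q / (4 * L)) by (apply Rdiv_lt_0_compat; lra).
      unfold r0; split; [split; [apply Rmax_l | apply Rmax_lub_lt; lra] | lra]. }
    pose (m := sqrt (Cmod q / 2)). assert (Hm : 0 < m) by (apply sqrt_lt_R0; lra).
    assert (Ym : forall r, r0 <= r < t -> m <= Cmod (Y r)).
    { intros r Hr; specialize (Hq r ltac:(lra)).
      assert (K : Cmod q / 2 <= Cmod (Y r) ^ 2).
      { replace (Cmod (Y r) ^ 2) with (Cmod (Y r * Y r)) by (rewrite Cmod_mult; ring).
        assert (K2 : Cmod q <= Cmod (Y r * Y r) + Cmod (Y r * Y r - q)).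
        { replace q with (Y r * Y r + - (Y r * Y r - q))%C at 1 by ring.
          eapply Rle_trans; [apply Cmod_triangle|]. rewrite Cmod_opp; lra. }
        assert (2 * (L * t - L * r) <= Cmod q / 2).
        { replace (Cmod q / 2) with (2 * L * (Cmod q / (4 * L))) by (field; lra).
          replace (2 * (L * t - L * r)) with (2 * L * (t - r)) by ring.
          apply Rmult_le_compat_l; lra. }
        lra. }
      unfold m; rewrite -(sqrt_pow2 (Cmod (Y r))); [|apply Cmod_ge_0].
      now apply sqrt_le_1_alt. }
    destruct (C_limit_at_end G (fun u => 2 / m * u) r0 t) as [Gt HGt]; [lra | | |].
    { intros x y Hx Hy.
      apply (Cmod_increment_le G (fun u => (2 / Y u)%C) (fun u => 2 / m * u) (fun _ => 2 / m));
        try lra.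
      - intros u Hu; apply GC; lra.
      - intros u Hu; apply: ex_derive_continuous; auto_derive; exact I.
      - intros u Hu; apply GD; lra.
      - intros u Hu; auto_derive; [exact I | ring].
      - intros u Hu; apply Cdiv_Cmod_le; auto.
        + rewrite Cmod_R Rabs_right; lra.
        + apply Ym; lra. }
    { intros x Hx; apply Rmult_le_compat_l; [|lra].
      left; apply Rdiv_lt_0_compat; lra. }
    pose (F := extend_by t G Gt).
    assert (FC : forall r, Ccont F r).
    { apply (Ccont_extend_by t G Gt (fun r => 4 / m * Rabs (t - r)) r0); auto; try lra.
      - intros r Hr; eapply Rle_trans; [apply HGt, Hr|].
        rewrite Rabs_right; [|lra]. right; field; lra.
      - intros r; apply Rmult_le_pos; [|apply Rabs_pos].
        left; apply Rdiv_lt_0_compat; lra.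
      - apply: continuous_mult; [apply continuous_const|].
        apply (continuous_comp (fun y => t - y) Rabs); [|apply continuous_Rabs].
        apply: continuous_minus; [apply continuous_const | apply continuous_id].
      - rewrite Rminus_diag Rabs_R0; ring. }
    assert (Ft : F t <> RtoC (lc t)).
    { intros E.
      destruct (Ccont_minus F (fun r => RtoC (lc r)) t (FC t)) as [K1 K2].
      { apply Ccont_RtoC, (driver_cont _ _ _ _ HD). }
      apply continuity_pt_filterlim in K1; apply continuity_pt_filterlim in K2.
      destruct (K1 (m / 2)) as [d1 [Hd1 B1]]; [lra|].
      destruct (K2 (m / 2)) as [d2 [Hd2 B2]]; [lra|].
      pose (h := Rmin (Rmin d1 d2) (t - r0) / 2).
      assert (Hh : 0 < h /\ h < d1 /\ h < d2 /\ h < t - r0).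
      { assert (0 < Rmin (Rmin d1 d2) (t - r0)) by (repeat apply Rmin_pos; lra).
        pose proof (Rmin_l (Rmin d1 d2) (t - r0)); pose proof (Rmin_r (Rmin d1 d2) (t - r0)).
        pose proof (Rmin_l d1 d2); pose proof (Rmin_r d1 d2). unfold h; lra. }
      specialize (B1 (t - h)); specialize (B2 (t - h)).
      unfold dist in *; simpl in *; unfold R_dist in *.
      specialize (B1 ltac:(split; [split; [exact I | lra] | rewrite Rabs_left; lra])).
      specialize (B2 ltac:(split; [split; [exact I | lra] | rewrite Rabs_left; lra])).
      rewrite E in B1 B2. pose proof (Ym (t - h) ltac:(lra)) as Y1.
      pose proof (Cmod_le_sum (Y (t - h))) as Y2.
      unfold F in B1, B2; rewrite extend_by_left in B1; [|lra].
      rewrite extend_by_left in B2; [|lra].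
      unfold Y in *; simpl in *; unfold Re, Im, Rminus in *; simpl in *.
      rewrite Rplus_opp_r Ropp_0 Rplus_0_r in B1.
      rewrite Ropp_0 Rplus_0_r Rplus_0_r Ropp_0 Rplus_0_r in B2.
      rewrite Ropp_0 Rplus_0_r in Y2. lra. }
    assert (FN : forall r, 0 <= r <= t -> (F r - RtoC (lc r))%C <> 0).
    { intros r Hr E.
      assert (E2 : F r = RtoC (lc r)).
      { transitivity (F r - RtoC (lc r) + RtoC (lc r))%C; [ring | rewrite E; ring]. }
      destruct (Req_dec r t) as [->|N]; [auto|].
      unfold F in E2; rewrite extend_by_left in E2; [|lra]. apply (GN r); [lra | auto]. }
    exists F; split.
    + unfold F; rewrite extend_by_left; [|lra]; apply G0; lra.
    + intros r Hr; unfold Icc in Hr; split.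
      * intros E; apply (FN r Hr); rewrite E Hlc; [ring | lra].
      * rewrite -Hlc; [|lra].
        apply (is_derive_within_of_interior 0 t F (fun r => (RtoC 2 / (F r - RtoC (lc r)))%C));
          auto.
        -- intros x Hx; unfold F at 2; rewrite extend_by_left; [|lra].
           apply Cderiv_extend_by; [lra|]; now apply GD.
        -- apply (Ccont_div_2 (fun r => (F r - RtoC (lc r))%C)); [now apply FN|].
           apply Ccont_minus; auto. apply Ccont_RtoC, (driver_cont _ _ _ _ HD).
Qed.

(** The point [gam t] lies in the domain of [g_s] for every [s < t], since [gam]
    is injective, and not in the domain of [g_t]. *)
Lemma slit_hitting_flow gam t : generates_slit lam T gam -> 0 < t <= T ->
  exists Z : R -> C, hitting_flow l t Z /\ Z 0 = (gam t - gam 0)%C.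
Proof.
  intros [_ [Hinj [H0 [Hup Hdom]]]] Ht; rewrite H0.
  assert (Hu : upper_half_plane (gam t)) by now apply Hup.
  apply hitting_flow_of_escape; auto.
  - intros s Hs.
    destruct (proj2 (Hdom s ltac:(unfold Icc; lra) (gam t))) as [_ Hg]; auto.
    split; auto; intros [r [Hr E]]; unfold Icc in *.
    assert (r = t) by (apply Hinj; auto; unfold Icc; lra). lra.
  - intros [g Hg].
    destruct (proj1 (Hdom t ltac:(unfold Icc; lra) (gam t))) as [_ Hn].
    + split; auto; now exists g.
    + apply Hn; exists t; split; auto; unfold Icc; lra.
Qed.

End Slit_point.

(** * Hoelder norms *)

Lemma Derive_within_correct {V : NormedModule R_AbsRing} a b (f : R -> V) t :
  ex_derive_within a b f t -> is_derive_within a b f t (Derive_within a b f t).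
Proof. intros H; exact (epsilon_spec (inhabits zero) _ H). Qed.

Lemma sup_norm_le_iff {V : NormedModule R_AbsRing} a b (f : R -> V) (B : R) :
  Rbar_le (sup_norm a b f) B <-> forall t, Icc a b t -> norm (f t) <= B.
Proof.
  unfold sup_norm; match goal with |- Rbar_le (Lub_Rbar ?E) _ <-> _ =>
    destruct (Lub_Rbar_correct E) as [H1 H2] end; split.
  - intros H t Ht; apply (Rbar_le_trans (norm (f t)) _ B (H1 _ (ex_intro _ t (conj Ht eq_refl))) H).
  - intros H; apply H2; intros r [t [Ht ->]]; now apply H.
Qed.

Lemma Holder_seminorm_le_iff {V : NormedModule R_AbsRing} al a b (f : R -> V) (B : R) :
  Rbar_le (Holder_seminorm al a b f) B <->
  forall t1 t2, Icc a b t1 -> Icc a b t2 -> t1 <> t2 ->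
    norm (minus (f t1) (f t2)) <= B * Rpower (Rabs (t1 - t2)) al.
Proof.
  assert (P : forall t1 t2, 0 < Rpower (Rabs (t1 - t2)) al) by (intros; apply exp_pos).
  unfold Holder_seminorm; match goal with |- Rbar_le (Lub_Rbar ?E) _ <-> _ =>
    destruct (Lub_Rbar_correct E) as [H1 H2] end; split.
  - intros H t1 t2 Ht1 Ht2 N.
    assert (K : norm (minus (f t1) (f t2)) / Rpower (Rabs (t1 - t2)) al <= B).
    { refine (Rbar_le_trans (Finite _) _ B (H1 _ _) H); exists t1, t2; auto. }
    apply (Rmult_le_compat_r (Rpower (Rabs (t1 - t2)) al)) in K; [|left; apply P].
    unfold Rdiv in K; rewrite Rmult_assoc Rinv_l in K; [lra|].
    pose proof (P t1 t2); lra.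
  - intros H; apply H2; intros r [t1 [t2 [Ht1 [Ht2 [N ->]]]]]; simpl.
    apply (Rmult_le_reg_r (Rpower (Rabs (t1 - t2)) al)); auto.
    unfold Rdiv; rewrite Rmult_assoc Rinv_l; [rewrite Rmult_1_r; auto|].
    pose proof (P t1 t2); lra.
Qed.

Lemma sup_norm_ge_0 {V : NormedModule R_AbsRing} a b (f : R -> V) : a <= b ->
  Rbar_le 0 (sup_norm a b f).
Proof.
  intros Hab; apply (Rbar_le_trans 0 (norm (f a))); [apply norm_ge_0|].
  apply Lub_Rbar_correct; exists a; split; [unfold Icc; lra | auto].
Qed.

Lemma Holder_seminorm_ge_0 {V : NormedModule R_AbsRing} al a b (f : R -> V) : a < b ->
  Rbar_le 0 (Holder_seminorm al a b f).
Proof.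
  intros Hab.
  apply (Rbar_le_trans 0 (norm (minus (f a) (f b)) / Rpower (Rabs (a - b)) al)).
  - apply Rmult_le_pos; [apply norm_ge_0|]. left; apply Rinv_0_lt_compat, exp_pos.
  - apply Lub_Rbar_correct; exists a, b; unfold Icc; repeat split; lra.
Qed.

Lemma Rbar_le_plus_l x y : Rbar_le 0 x -> Rbar_le 0 y -> Rbar_le x (Rbar_plus x y).
Proof. destruct x, y; simpl; auto; lra. Qed.

Lemma Rbar_le_plus_r x y : Rbar_le 0 x -> Rbar_le 0 y -> Rbar_le y (Rbar_plus x y).
Proof. destruct x, y; simpl; auto; lra. Qed.

Lemma Rbar_plus_ge_0 x y : Rbar_le 0 x -> Rbar_le 0 y -> Rbar_le 0 (Rbar_plus x y).
Proof. intros Hx Hy; eapply Rbar_le_trans; [exact Hx | now apply Rbar_le_plus_l]. Qed.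

Lemma is_finite_of_bounds x (B : R) : Rbar_le 0 x -> Rbar_le x B -> is_finite x.
Proof. destruct x; simpl; intros; [reflexivity | contradiction | contradiction]. Qed.

Lemma Holder_norm_1_ge_0 {V : NormedModule R_AbsRing} al a b (f : R -> V) : a < b ->
  Rbar_le 0 (Holder_norm 1 al a b f).
Proof.
  intros Hab; apply Rbar_plus_ge_0; [apply Rbar_plus_ge_0|].
  - apply sup_norm_ge_0; lra.
  - apply sup_norm_ge_0; lra.
  - now apply Holder_seminorm_ge_0.
Qed.

Lemma Holder_norm_1_le {V : NormedModule R_AbsRing} al a b (f : R -> V) (M : R) : a < b ->
  Rbar_le (Holder_norm 1 al a b f) M ->
  (forall t, Icc a b t -> norm (f t) <= M) /\
  (forall t, Icc a b t -> norm (Derive_within a b f t) <= M) /\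
  (forall t1 t2, Icc a b t1 -> Icc a b t2 -> t1 <> t2 ->
    norm (minus (Derive_within a b f t1) (Derive_within a b f t2))
      <= M * Rpower (Rabs (t1 - t2)) al).
Proof.
  intros Hab H.
  assert (S0 : Rbar_le 0 (sup_norm a b f)) by (apply sup_norm_ge_0; lra).
  assert (S1 : Rbar_le 0 (sup_norm a b (Derive_within a b f))) by (apply sup_norm_ge_0; lra).
  assert (S2 : Rbar_le 0 (Holder_seminorm al a b (Derive_within a b f)))
    by now apply Holder_seminorm_ge_0.
  change (Rbar_le (Rbar_plus (Rbar_plus (sup_norm a b f) (sup_norm a b (Derive_within a b f)))
    (Holder_seminorm al a b (Derive_within a b f))) M) in H.
  split; [|split].
  - apply sup_norm_le_iff; eapply Rbar_le_trans; [|exact H].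
    eapply Rbar_le_trans; [exact (Rbar_le_plus_l _ _ S0 S1)|].
    apply Rbar_le_plus_l; auto using Rbar_plus_ge_0.
  - apply sup_norm_le_iff; eapply Rbar_le_trans; [|exact H].
    eapply Rbar_le_trans; [exact (Rbar_le_plus_r _ _ S0 S1)|].
    apply Rbar_le_plus_l; auto using Rbar_plus_ge_0.
  - apply Holder_seminorm_le_iff; eapply Rbar_le_trans; [|exact H].
    apply Rbar_le_plus_r; auto using Rbar_plus_ge_0.
Qed.

(** * The driving function *)

Lemma Rpower_small d eps : 0 < d -> 0 < eps ->
  exists e, 0 < e /\ forall h, 0 < h < e -> Rpower h d < eps.
Proof.
  intros Hd He; exists (Rpower eps (/ d)); split; [apply exp_pos|].
  intros h Hh; apply (Rlt_le_trans _ (Rpower (Rpower eps (/ d)) d)).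
  - now apply Rlt_Rpower_l.
  - rewrite Rpower_mult Rinv_l; [rewrite Rpower_1; lra | lra].
Qed.

Lemma driver_of_Holder (T M d : R) (lam : R -> R) : 0 < T -> 0 < d ->
  Rbar_le (Holder_seminorm (V := R_NormedModule) (1 / 2) 0 T lam) 1 ->
  in_Holder (V := R_NormedModule) 1 d 0 T lam ->
  Rbar_le (Holder_norm (V := R_NormedModule) 1 d 0 T lam) M ->
  let l := fun r => Derive_within (V := R_NormedModule) 0 T lam (clamp T r) in
  driver T M (fun r => lam (clamp T r)) l /\
  (forall r s, 0 <= r <= T -> 0 <= s <= T -> r <> s ->
     Rabs (l r - l s) <= M * Rpower (Rabs (r - s)) d).
Proof.
  intros HT Hd H1 [H2 _] H3 l.
  destruct (Holder_norm_1_le d 0 T lam M HT H3) as [_ [B1 B2]].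
  assert (Hhalf : forall r s, 0 <= r <= T -> 0 <= s <= T ->
     Rabs (lam r - lam s) <= sqrt (Rabs (r - s))).
  { intros r s Hr Hs; destruct (Req_dec r s) as [->|N].
    { rewrite !Rminus_diag Rabs_R0 sqrt_0; lra. }
    pose proof (proj1 (Holder_seminorm_le_iff (V := R_NormedModule) (1 / 2) 0 T lam 1) H1 r s Hr Hs N) as K.
    replace (1 / 2) with (/ 2) in K by lra.
    rewrite Rpower_sqrt in K; [|apply Rabs_pos_lt; lra].
    rewrite Rmult_1_l in K; exact K. }
  assert (Hl : forall r s, 0 <= r <= T -> 0 <= s <= T -> r <> s ->
     Rabs (l r - l s) <= M * Rpower (Rabs (r - s)) d).
  { intros r s Hr Hs N; unfold l; rewrite !clamp_id //; exact (B2 r s Hr Hs N). }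
  assert (HM : forall r, Rabs (l r) <= M).
  { intros r; apply (B1 (clamp T r)); apply clamp_in; lra. }
  assert (HM0 : 0 <= M) by (pose proof (HM 0); pose proof (Rabs_pos (l 0)); lra).
  split; auto; constructor; auto.
  - intros r; apply (continuous_of_bound _ (fun y => sqrt (Rabs (y - r))) r 1); [lra | | |].
    + apply continuous_sqrt_comp.
      apply (continuous_comp (fun y => y - r) Rabs); [|apply continuous_Rabs].
      apply: continuous_minus; [apply continuous_id | apply continuous_const].
    + rewrite Rminus_diag Rabs_R0 sqrt_0; auto.
    + intros y _; eapply Rle_trans; [apply Hhalf; apply clamp_in; lra|].
      apply sqrt_le_1_alt, clamp_lipschitz.
  - intros r; apply continuity_pt_filterlim; intros eps He.
    destruct (Rpower_small d (eps / (M + 1)) Hd) as [e [He1 He2]];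
      [apply Rdiv_lt_0_compat; lra|].
    exists e; split; auto; intros y [_ Hy]; simpl in *; unfold R_dist in *.
    destruct (Req_dec (clamp T y) (clamp T r)) as [E|N].
    { unfold l; rewrite E Rminus_diag Rabs_R0; auto. }
    assert (El : forall x, l x = l (clamp T x)).
    { intros x; unfold l; f_equal; symmetry; apply clamp_id, clamp_in; lra. }
    rewrite (El y) (El r).
    eapply Rle_lt_trans; [apply Hl; auto; apply clamp_in; lra|].
    pose proof (clamp_lipschitz T y r).
    assert (Hp : Rpower (Rabs (clamp T y - clamp T r)) d < eps / (M + 1)).
    { apply He2; split; [apply Rabs_pos_lt; lra | lra]. }
    apply (Rle_lt_trans _ (M * (eps / (M + 1)))).
    + apply Rmult_le_compat_l; lra.
    + replace (M * (eps / (M + 1))) with (eps - eps / (M + 1)) by (field; lra).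
      assert (0 < eps / (M + 1)) by (apply Rdiv_lt_0_compat; lra). lra.
  - intros r Hr.
    assert (Hi : Icc 0 T r) by (unfold Icc; lra).
    assert (D : is_derive_within (V := R_NormedModule) 0 T lam r (l r)).
    { unfold l; rewrite clamp_id; [|lra]. apply (Derive_within_correct (V := R_NormedModule)).
      apply (H2 0%nat r); auto. }
    pose proof (proj1 (is_derive_within_iff (V := R_NormedModule) 0 T lam r (l r) Hi) D) as K.
    apply is_derive_Reals; intros eps He; destruct (K (eps / 2)) as [e [He1 He2]]; [lra|].
    assert (P : 0 < Rmin e (Rmin r (T - r))) by (repeat apply Rmin_pos; lra).
    exists (mkposreal _ P); simpl; intros h Hh Hlt.
    pose proof (Rmin_l e (Rmin r (T - r))); pose proof (Rmin_r e (Rmin r (T - r))).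
    pose proof (Rmin_l r (T - r)); pose proof (Rmin_r r (T - r)).
    assert (Rabs h < r /\ Rabs h < T - r) as [K1 K2] by lra.
    apply Rabs_def2 in K1; apply Rabs_def2 in K2.
    assert (Hb : Rabs (lam (r + h) - lam r - h * l r) <= eps / 2 * Rabs h).
    { pose proof (He2 (r + h)) as B; replace (r + h - r) with h in B by ring.
      apply B; [unfold Icc; lra | lra]. }
    rewrite !clamp_id; try lra.
    assert (0 < Rabs h) by now apply Rabs_pos_lt.
    replace ((lam (r + h) - lam r) / h - l r) with ((lam (r + h) - lam r - h * l r) / h)
      by (field; auto).
    unfold Rdiv; rewrite Rabs_mult Rabs_inv.
    apply (Rmult_lt_reg_r (Rabs h)); auto.
    rewrite Rmult_assoc Rinv_l; [nra | lra].
  - intros r s Hr Hs; rewrite !clamp_id; auto.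
Qed.

(** * Regularity of the slit for a general modulus of continuity *)

Lemma sqrt_le_of_sq x y : 0 <= x -> x <= y ^ 2 -> 0 <= y -> sqrt x <= y.
Proof.
  intros Hx H Hy; rewrite -(sqrt_pow2 y); auto; now apply sqrt_le_1_alt.
Qed.

Lemma is_derive_within_of_pow32 b (f : R -> C) t l K : Icc 0 b t ->
  (forall y, 0 <= y <= b ->
     Cmod (f y - f t - l * RtoC (y - t)) <= K * (Rabs (y - t) * sqrt (Rabs (y - t)))) ->
  is_derive_within (V := C_R_NormedModule) 0 b f t l.
Proof.
  intros Ht H; apply is_derive_within_C_iff; auto; intros eps He.
  pose (k := Rabs K + 1). assert (Hk : 0 < k) by (pose proof (Rabs_pos K); unfold k; lra).
  assert (Hs : 0 < eps / k) by (apply Rdiv_lt_0_compat; lra).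
  assert (Es : k * (eps / k) = eps) by (field; lra).
  exists ((eps / k) ^ 2); split; [nra|]; intros y Hy Hlt.
  eapply Rle_trans; [now apply H|].
  pose proof (sqrt_le_of_sq (Rabs (y - t)) (eps / k) (Rabs_pos _) ltac:(lra) ltac:(lra)) as Hq.
  pose proof (Rle_abs K). pose proof (sqrt_pos (Rabs (y - t))). pose proof (Rabs_pos (y - t)).
  assert (K * sqrt (Rabs (y - t)) <= k * (eps / k)).
  { apply (Rle_trans _ (k * sqrt (Rabs (y - t)))).
    - apply Rmult_le_compat_r; unfold k; lra.
    - apply Rmult_le_compat_l; lra. }
  nra.
Qed.

(** The estimates on the slit in square-root time, with a constant that depends
    on the driving function only through [T], [M] and [d]. *)
Definition uniform_slit_estimates (T M d : R) (w : R -> R) : Prop :=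
  exists N, 0 < N /\ forall lam gam,
    Rbar_le (Holder_seminorm (V := R_NormedModule) (1 / 2) 0 T lam) 1 ->
    in_Holder (V := R_NormedModule) 1 d 0 T lam ->
    Rbar_le (Holder_norm (V := R_NormedModule) 1 d 0 T lam) M ->
    generates_slit lam T gam ->
    let b := sqrt T in
    let D := Derive_within (V := C_R_NormedModule) 0 b (slit_sq gam) in
    forall t, Icc 0 b t ->
      is_derive_within (V := C_R_NormedModule) 0 b (slit_sq gam) t (D t) /\
      Cmod (slit_sq gam t) <= N /\ Cmod (D t) <= N /\ 1 / N <= Cmod (D t) /\
      (forall s, 0 <= s < t -> Cmod (D t - D s) <= N * w (t - s)).

(** [J u] is the end value at time [u ^ 2] of the primitive of [l / Z], for the
    flow [Z] of the slit point [gam (u ^ 2)].  The functions [m] and [F] bound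
    the integral left over from freezing [l] in the comparison of two such end
    values; the last two hypotheses say that the resulting bound is a modulus
    [w] of [J] in the square-root time. *)
Lemma slit_regularity (T M d : R) (m m' F w : R -> R) (c1 c2 KJ : R) :
  0 < T -> 0 < M -> 0 < d -> 0 <= c1 -> 0 <= c2 -> 0 <= KJ ->
  (forall x, 0 < x -> is_derive m x (m' x)) ->
  (forall x, 0 < x <= T -> Rpower x d * / (x * sqrt x) <= m' x) ->
  (forall h, 0 < h <= T -> 0 <= F h) ->
  (forall a h, 0 < h < a -> a <= T -> m a - m h <= F h) ->
  (forall x y, 0 < x <= y -> y <= sqrt T -> w x <= w y) ->
  (forall x, 0 < x <= sqrt T -> x <= c1 * w x) ->
  (forall x, 0 < x <= sqrt T -> w x <= c2 * sqrt x) ->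
  (forall v u, 0 < v < u -> u <= sqrt T ->
     2 * M * (1 + gap_const T M) * (Rpower (u ^ 2 - v ^ 2) d * sqrt (u ^ 2 - v ^ 2))
     + M * gap_const T M * ((u ^ 2 - v ^ 2) * F (u ^ 2 - v ^ 2))
     + M * (M * (u ^ 2 - v ^ 2) + gap_const T M * (u ^ 2 - v ^ 2) / u) <= KJ * w (u - v)) ->
  (forall u, 0 < u <= sqrt T -> 2 * M * u <= KJ * w u) ->
  uniform_slit_estimates T M d w.
Proof.
  intros HT HM Hd Hc1 Hc2 HKJ Hm Hm' HF0 HF Hw1 Hw2 Hw3 HJb HJ0.
  pose (b := sqrt T). assert (Hb : 0 < b) by now apply sqrt_lt_R0.
  assert (Ebb : b ^ 2 = T) by (unfold b; simpl; rewrite Rmult_1_r; apply sqrt_sqrt; lra).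
  pose (C2 := sq_increment_const T M + 4 * M).
  pose (c := 2 * M * b).
  pose (RC := root_const c KJ C2 c1).
  assert (HG : 0 < gap_const T M) by (unfold gap_const; pose proof (exp_pos (4 * M * sqrt T)); lra).
  assert (Hsc : 0 <= sq_increment_const T M).
  { unfold sq_increment_const; pose proof (exp_pos (2 * M * sqrt T)).
    apply Rplus_le_le_0_compat; repeat first [lra | apply Rmult_le_pos]. }
  assert (HC2 : 0 <= C2) by (unfold C2; lra).
  assert (HRC : 0 <= RC).
  { unfold RC, root_const; pose proof (exp_pos c).
    assert (0 <= 8 * exp c * KJ + C2 * c1)
      by (apply Rplus_le_le_0_compat; repeat first [lra | apply Rmult_le_pos]).
    apply Rplus_le_le_0_compat; repeat first [lra | apply Rmult_le_pos]. }
  exists (RC + 4 * exp c + (M + 3 * b)).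
  pose proof (exp_pos c) as Hec. split; [lra|].
  intros lam gam L1 L2 L3 Hslit b' D.
  destruct (driver_of_Holder T M d lam HT Hd L1 L2 L3) as [HD Hhol].
  set (lc := fun r => lam (clamp T r)) in HD.
  set (l := fun r => Derive_within (V := R_NormedModule) 0 T lam (clamp T r)) in HD, Hhol.
  assert (Hlc : forall r, 0 <= r <= T -> lc r = lam r) by (intros r Hr; unfold lc; now rewrite clamp_id).
  assert (Hex : forall t, 0 < t <= T -> exists p : (R -> C) * (R -> C),
    hitting_flow l t (fst p) /\ fst p 0 = (gam t - gam 0)%C /\ flow_log l t (fst p) (snd p)).
  { intros t Ht.
    destruct (slit_hitting_flow T M lam lc l HT HD Hlc gam t Hslit Ht) as [Z [HZ E]].
    destruct (flow_log_exists T M lc l HD t Z Ht HZ) as [Phi [P1 [P2 P3]]].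
    exists (Z, Phi); split; [|split]; auto; now constructor. }
  pose (zero2 := ((fun _ : R => RtoC 0), (fun _ : R => RtoC 0))).
  pose (p := fun t => epsilon (inhabits zero2) (fun p : (R -> C) * (R -> C) =>
    hitting_flow l t (fst p) /\ fst p 0 = (gam t - gam 0)%C /\ flow_log l t (fst p) (snd p))).
  assert (Hp : forall t, 0 < t <= T -> hitting_flow l t (fst (p t)) /\
    fst (p t) 0 = (gam t - gam 0)%C /\ flow_log l t (fst (p t)) (snd (p t))).
  { intros t Ht; apply (epsilon_spec (inhabits zero2)), Hex, Ht. }
  pose (z := fun u => (gam (u ^ 2)%R - gam 0)%C).
  pose (J := fun u => match Rle_dec u 0 with left _ => RtoC 0 | right _ => snd (p (u ^ 2)) (u ^ 2) end).
  assert (Jpos : forall u, 0 < u -> J u = snd (p (u ^ 2)) (u ^ 2))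
    by (intros u Hu; unfold J; destruct (Rle_dec u 0); [lra | auto]).
  assert (J0 : J 0 = 0) by (unfold J; destruct (Rle_dec 0 0); [auto | lra]).
  assert (Hsq : forall u, 0 < u <= b -> 0 < u ^ 2 <= T) by (intros u Hu; rewrite -Ebb; nra).
  assert (Es : forall u, 0 < u -> sqrt (u ^ 2 - 0) = u)
    by (intros u Hu; rewrite Rminus_0_r; apply sqrt_pow2; lra).
  assert (z0 : z 0 = 0).
  { unfold z; replace (0 ^ 2) with 0 by ring; ring. }
  assert (zl : forall u, 0 < u <= b -> u <= Im (z u)).
  { intros u Hu; destruct (Hp (u ^ 2) (Hsq u Hu)) as [P1 [P2 P3]].
    pose proof (flow_Im_lower T M lc l HD (u ^ 2) _ (Hsq u Hu) P1 0 ltac:(nra)) as K.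
    rewrite P2 Es in K; [exact K | lra]. }
  assert (zu : forall u, 0 < u <= b -> Cmod (z u) <= 3 * u).
  { intros u Hu; destruct (Hp (u ^ 2) (Hsq u Hu)) as [P1 [P2 P3]].
    pose proof (flow_Cmod_upper T M lc l HD (u ^ 2) _ (Hsq u Hu) P1 0 ltac:(nra)) as K.
    rewrite P2 Es in K; [exact K | lra]. }
  assert (zsq : forall v u, 0 <= v < u -> u <= b ->
    Cmod (z u * z u - z v * z v + RtoC (4 * (u ^ 2 - v ^ 2)) * Cexp (J v)) <=
    C2 * ((u ^ 2 - v ^ 2) * sqrt (u ^ 2 - v ^ 2))).
  { intros v u Hv Hu; destruct (Hp (u ^ 2) (Hsq u ltac:(lra))) as [P1 [P2 P3]].
    assert (Hpos : 0 <= (u ^ 2 - v ^ 2) * sqrt (u ^ 2 - v ^ 2))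
      by (apply Rmult_le_pos; [nra | apply sqrt_pos]).
    destruct (Req_dec v 0) as [->|N].
    - pose proof (flow_sq_expansion T M lc l HD (u ^ 2) _ (Hsq u ltac:(lra)) P1 0 ltac:(nra)) as K.
      rewrite P2 in K. rewrite J0 Cexp_0 z0.
      replace (u ^ 2 - 0 ^ 2) with (u ^ 2 - 0) in Hpos |- * by ring.
      replace (z u * z u - 0 * 0 + RtoC (4 * (u ^ 2 - 0)) * 1)%C
        with (z u * z u + RtoC (4 * (u ^ 2 - 0)))%C by ring.
      eapply Rle_trans; [exact K|]. unfold C2; nra.
    - destruct (Hp (v ^ 2) (Hsq v ltac:(lra))) as [Q1 [Q2 Q3]].
      pose proof (flow_sq_increment T M lc l HD (v ^ 2) (u ^ 2) ltac:(nra)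
        ltac:(pose proof (Hsq u ltac:(lra)); lra) _ _ _ Q1 P1 Q3) as K.
      rewrite P2 Q2 -Jpos in K; [|lra].
      eapply Rle_trans; [exact K|]. unfold C2; nra. }
  assert (Jc : forall u, 0 <= u <= b -> Cmod (J u) <= 2 * M * u).
  { intros u Hu; destruct (Req_dec u 0) as [->|N].
    - rewrite J0 Cmod_0; lra.
    - destruct (Hp (u ^ 2) (Hsq u ltac:(lra))) as [P1 [P2 P3]].
      rewrite Jpos; [|lra].
      pose proof (flow_log_bound T M lc l HD (u ^ 2) _ _ (Hsq u ltac:(lra)) P1 P3 (u ^ 2) ltac:(nra)) as K.
      rewrite sqrt_pow2 in K; lra. }
  assert (Jcc : forall u, 0 <= u <= b -> Cmod (J u) <= c).
  { intros u Hu; eapply Rle_trans; [now apply Jc|]. unfold c; nra. }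
  assert (Jw : forall v u, 0 <= v < u -> u <= b -> Cmod (J u - J v) <= KJ * w (u - v)).
  { intros v u Hv Hu; destruct (Req_dec v 0) as [->|N].
    - rewrite J0 Rminus_0_r; replace (J u - 0)%C with (J u) by ring.
      eapply Rle_trans; [apply Jc; lra | apply HJ0; fold b; lra].
    - destruct (Hp (u ^ 2) (Hsq u ltac:(lra))) as [P1 [P2 P3]].
      destruct (Hp (v ^ 2) (Hsq v ltac:(lra))) as [Q1 [Q2 Q3]].
      pose proof (Hsq u ltac:(lra)) as Hu2; pose proof (Hsq v ltac:(lra)) as Hv2.
      assert (Huv : 0 < u ^ 2 - v ^ 2) by nra.
      rewrite !Jpos; try lra.
      eapply Rle_trans; [|apply (HJb v u); fold b; lra].
      pose proof (flow_log_increment T M lc l HD (v ^ 2) (u ^ 2) ltac:(lra) ltac:(lra) _ _ _ _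
        Q1 P1 Q3 P3 d Hd Hhol m m' (F (u ^ 2 - v ^ 2)) Hm Hm') as K.
      rewrite sqrt_pow2 in K; [|lra].
      apply K.
      + apply HF0; lra.
      + intros Hlt; apply HF; lra. }
  pose (A := root_derivative z J).
  assert (DA : forall t, Icc 0 b t ->
     is_derive_within (V := C_R_NormedModule) 0 b (slit_sq gam) t (A t)).
  { intros t Ht.
    destruct (root_differentiable b C2 c KJ c2 w z J Hb HC2 HKJ Hc2 z0 J0 zl zsq Jcc Jw Hw3 t Ht)
      as [K HK].
    apply (is_derive_within_of_pow32 b (slit_sq gam) t (A t) K Ht).
    intros y Hy; replace (slit_sq gam y - slit_sq gam t)%C with (z y - z t)%C
      by (unfold z, slit_sq; ring).
    now apply HK. }
  assert (ED : forall t, Icc 0 b t -> D t = A t).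
  { intros t Ht; apply (is_derive_within_unique 0 b (slit_sq gam) t); auto.
    apply (Derive_within_correct (V := C_R_NormedModule)); exists (A t); now apply DA. }
  intros t Ht; unfold b' in Ht; fold b in Ht.
  rewrite (ED t Ht). unfold Icc in Ht.
  assert (Habs : 0 <= M + 3 * b) by lra.
  split; [now apply DA | split; [|split; [|split]]].
  - destruct (Holder_norm_1_le d 0 T lam M HT L3) as [B0 _].
    assert (G0 : Cmod (gam 0) <= M).
    { destruct Hslit as [_ [_ [E _]]]; rewrite E Cmod_R.
      apply (B0 0); unfold Icc; lra. }
    apply (Rle_trans _ (M + 3 * b)); [|lra].
    replace (slit_sq gam t) with (z t + gam 0)%C by (unfold z, slit_sq; ring).
    eapply Rle_trans; [apply Cmod_triangle|].
    destruct (Req_dec t 0) as [->|N].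
    + rewrite z0 Cmod_0; lra.
    + pose proof (zu t ltac:(lra)); lra.
  - pose proof (root_derivative_upper b c z J zl Jcc t Ht) as K; fold A in K. lra.
  - pose proof (root_derivative_lower b c z J Hb J0 zl zu Jcc t Ht) as K; fold A in K.
    eapply Rle_trans; [|exact K].
    unfold Rdiv; rewrite Rmult_1_l; apply Rinv_le_contravar; lra.
  - intros s Hs; rewrite ED; [|unfold Icc; lra].
    eapply Rle_trans.
    + apply (root_derivative_increment b C2 c KJ c1 c2 w z J Hb HC2 HKJ Hc1 Hc2 z0 J0 zl zu zsq
        Jcc Jw Hw1 Hw2 Hw3); lra.
    + apply Rmult_le_compat_r; [|fold RC; lra].
      pose proof (Hw2 (t - s) ltac:(fold b; lra)) as K.
      destruct (Rle_lt_or_eq_dec 0 c1 Hc1) as [Q|Q]; [|rewrite -Q in K; lra].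
      apply (Rmult_le_reg_l c1); lra.
Qed.

(** * The two moduli of continuity *)

Lemma is_derive_Rpower a x : 0 < x ->
  is_derive (fun y => Rpower y a) x (a * Rpower x (a - 1)).
Proof. intros Hx; apply is_derive_Reals, derivable_pt_lim_power, Hx. Qed.

Lemma Rpower_div_pow32 x d : 0 < x ->
  Rpower x d * / (x * sqrt x) = Rpower x (d - 3 / 2).
Proof.
  intros Hx. rewrite -(Rpower_sqrt x) // -{2}(Rpower_1 x) // -Rpower_plus -Rpower_Ropp -Rpower_plus.
  f_equal; lra.
Qed.

Lemma Rpower_mult_sqrt x d : 0 < x -> Rpower x d * sqrt x = Rpower x (1 / 2 + d).
Proof. intros Hx; rewrite -(Rpower_sqrt x) // -Rpower_plus; f_equal; lra. Qed.

Lemma sq_gap_bounds b v u : 0 < v < u -> u <= b ->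
  0 < u ^ 2 - v ^ 2 <= 2 * b * (u - v) /\ (u ^ 2 - v ^ 2) / u <= 2 * (u - v).
Proof.
  intros Hv Hu; split; [nra|].
  apply (Rmult_le_reg_r u); [lra|].
  unfold Rdiv; rewrite Rmult_assoc Rinv_l; nra.
Qed.

(** The integral of [x ^ (d - 3/2)] over [x >= h] is [e * h ^ (d - 1/2)] with
    [e = 1 / (1/2 - d)]; multiplied by [h] it is of the order [h ^ (1/2 + d)] of
    the other terms. *)
Lemma slit_regularity_Holder (T M d : R) : 0 < T -> 0 < M -> 0 < d < 1 / 2 ->
  uniform_slit_estimates T M d (fun x => Rpower x (1 / 2 + d)).
Proof.
  intros HT HM Hd.
  pose (b := sqrt T). assert (Hb : 0 < b) by now apply sqrt_lt_R0.
  pose (K := gap_const T M).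
  assert (HK : 0 < K) by (unfold K, gap_const; pose proof (exp_pos (4 * M * sqrt T)); lra).
  pose (P := fun x => Rpower x (1 / 2 + d)).
  pose (c1 := Rpower b (1 / 2 - d)). assert (Hc1 : 0 < c1) by apply exp_pos.
  pose (c2 := Rpower b d). assert (Hc2 : 0 < c2) by apply exp_pos.
  pose (q := P (2 * b)). assert (Hq : 0 < q) by apply exp_pos.
  pose (e := / (1 / 2 - d)). assert (He : 0 < e) by (apply Rinv_0_lt_compat; lra).
  assert (Ppos : forall x, 0 < P x) by (intros; apply exp_pos).
  assert (Plow : forall x, 0 < x <= b -> x <= c1 * P x).
  { intros x Hx; rewrite -{1}(Rpower_1 x); [|lra].
    replace 1 with ((1 / 2 - d) + (1 / 2 + d)) at 1 by lra.
    rewrite Rpower_plus; apply Rmult_le_compat_r; [left; apply Ppos|].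
    apply Rle_Rpower_l; lra. }
  pose (KJ := 2 * M * (1 + K) * q + M * K * (e * q)
     + M * (M * (2 * b * c1) + K * (2 * c1)) + 2 * M * c1).
  assert (HKJ : 0 <= 2 * M * (1 + K) * q + M * K * (e * q)
     + M * (M * (2 * b * c1) + K * (2 * c1))).
  { repeat apply Rplus_le_le_0_compat; repeat first [lra | apply Rmult_le_pos].
    apply Rplus_le_le_0_compat; repeat first [lra | apply Rmult_le_pos]. }
  assert (HMc : 0 <= 2 * M * c1) by (repeat first [lra | apply Rmult_le_pos]).
  apply (slit_regularity T M d (fun x => - e * Rpower x (d - 1 / 2)) (fun x => Rpower x (d - 3 / 2))
    (fun h => e * Rpower h (d - 1 / 2)) P c1 c2 KJ); try lra.
  - unfold KJ; lra.
  - intros x Hx; eapply is_derive_eq.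
    + apply: is_derive_scal; now apply is_derive_Rpower.
    + replace (d - 1 / 2 - 1) with (d - 3 / 2) by lra.
      unfold e; field; lra.
  - intros x Hx; rewrite Rpower_div_pow32; lra.
  - intros h Hh; apply Rmult_le_pos; [lra | left; apply exp_pos].
  - intros a h Hh Ha; pose proof (exp_pos ((d - 1 / 2) * ln a)) as Pa.
    unfold Rpower; nra.
  - intros x y Hx Hy; apply Rle_Rpower_l; lra.
  - exact Plow.
  - intros x Hx; unfold P; rewrite -Rpower_mult_sqrt; [|lra].
    apply Rmult_le_compat_r; [apply sqrt_pos|]. apply Rle_Rpower_l; [lra|]. exact Hx.
  - fold K b; intros v u Hv Hu; destruct (sq_gap_bounds b v u Hv Hu) as [[G0 G1] G2].
    set (h := u ^ 2 - v ^ 2) in *. set (x := u - v) in *.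
    assert (Hx : 0 < x <= b) by (unfold x; lra).
    pose proof (Plow x Hx) as Hl.
    assert (Hh : P h <= q * P x).
    { unfold q, P; rewrite Rpower_mult_distr; [|lra|lra]. apply Rle_Rpower_l; lra. }
    rewrite Rpower_mult_sqrt; auto; fold (P h).
    replace (h * (e * Rpower h (d - 1 / 2))) with (e * P h).
    2:{ unfold P; rewrite -{2}(Rpower_1 h) //.
        replace (1 / 2 + d) with (1 + (d - 1 / 2)) by lra. rewrite Rpower_plus; ring. }
    assert (T1 : 2 * M * (1 + K) * P h <= 2 * M * (1 + K) * (q * P x))
      by (apply Rmult_le_compat_l; auto; repeat first [lra | apply Rmult_le_pos]).
    assert (T2 : M * K * (e * P h) <= M * K * (e * (q * P x))).
    { apply Rmult_le_compat_l; [repeat first [lra | apply Rmult_le_pos]|].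
      apply Rmult_le_compat_l; lra. }
    assert (T3 : h <= 2 * b * (c1 * P x)).
    { eapply Rle_trans; [exact G1|]. apply Rmult_le_compat_l; lra. }
    assert (T4 : h / u <= 2 * (c1 * P x)) by lra.
    assert (T5 : M * (M * h + K * h / u) <= M * (M * (2 * b * (c1 * P x)) + K * (2 * (c1 * P x)))).
    { apply Rmult_le_compat_l; [lra|]. apply Rplus_le_compat.
      - apply Rmult_le_compat_l; lra.
      - unfold Rdiv in *; rewrite Rmult_assoc; apply Rmult_le_compat_l; lra. }
    assert (T6 : 0 <= 2 * M * c1 * P x) by (apply Rmult_le_pos; auto; left; apply Ppos).
    unfold KJ; lra.
  - intros u Hu; pose proof (Plow u Hu) as Hl.
    assert (2 * M * u <= 2 * M * (c1 * P u)) by (apply Rmult_le_compat_l; lra).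
    pose proof (Rmult_le_compat_r (P u) 0 _ ltac:(left; apply Ppos) HKJ).
    unfold KJ; lra.
Qed.

Definition log_modulus (x : R) : R := x * Rmax 1 (ln (1 / x)).

Lemma ln_le_id x : 0 < x -> ln x <= x.
Proof.
  intros Hx; apply Rnot_lt_le; intros H.
  apply exp_increasing in H; rewrite exp_ln in H; auto.
  pose proof (exp_ineq1 x ltac:(lra)); lra.
Qed.

Lemma log_modulus_low x : 0 < x -> x <= log_modulus x.
Proof. intros Hx; unfold log_modulus; pose proof (Rmax_l 1 (ln (1 / x))); nra. Qed.

(** Because [x * ln (y / x) <= y - x]. *)
Lemma log_modulus_mono x y : 0 < x <= y -> log_modulus x <= log_modulus y.
Proof.
  intros Hx; unfold log_modulus.
  pose proof (Rmax_l 1 (ln (1 / y))) as L1; pose proof (Rmax_r 1 (ln (1 / y))) as L2.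
  set (L := Rmax 1 (ln (1 / y))) in *.
  assert (E : ln (1 / x) = ln (1 / y) + ln (y / x)).
  { rewrite -ln_mult; try (apply Rdiv_lt_0_compat; lra). f_equal; field; lra. }
  assert (B : x * ln (y / x) <= y - x).
  { replace (y - x) with (x * (y / x - 1)) by (field; lra).
    apply Rmult_le_compat_l; [lra|].
    assert (0 < y / x) by (apply Rdiv_lt_0_compat; lra).
    pose proof (exp_ineq1_le (ln (y / x))) as K; rewrite exp_ln in K; lra. }
  destruct (Rle_dec 1 (ln (1 / x))) as [H|H].
  - rewrite Rmax_right; auto. rewrite E. nra.
  - rewrite Rmax_left; [nra|lra].
Qed.

Lemma log_modulus_up x b : 0 < x <= b -> log_modulus x <= (sqrt b + 2) * sqrt x.
Proof.
  intros Hx; unfold log_modulus.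
  assert (Hs : 0 < sqrt x) by (apply sqrt_lt_R0; lra).
  pose proof (sqrt_sqrt x ltac:(lra)) as E.
  assert (sqrt x <= sqrt b) by (apply sqrt_le_1_alt; lra).
  assert (B : x * ln (1 / x) <= 2 * sqrt x).
  { assert (E2 : ln (1 / x) = 2 * ln (/ sqrt x)).
    { rewrite -{1}E. replace (1 / (sqrt x * sqrt x)) with (/ sqrt x * / sqrt x) by (field; lra).
      rewrite ln_mult; [ring | |]; now apply Rinv_0_lt_compat. }
    rewrite E2 -{1}E.
    pose proof (ln_le_id (/ sqrt x) ltac:(now apply Rinv_0_lt_compat)) as L.
    apply (Rmult_le_compat_l (sqrt x)) in L; [|lra]. rewrite Rinv_r in L; [|lra]. nra. }
  unfold Rmax; destruct (Rle_dec 1 (ln (1 / x))); nra.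
Qed.

(** For [d = 1/2] the integral of [x ^ (d - 3/2)] over [h <= x <= T] is
    [ln T - ln h], and [h] is at least the square of the increment of the
    square-root time. *)
Lemma slit_regularity_log (T M : R) : 0 < T -> 0 < M ->
  uniform_slit_estimates T M (1 / 2) log_modulus.
Proof.
  intros HT HM.
  pose (b := sqrt T). assert (Hb : 0 < b) by now apply sqrt_lt_R0.
  pose (K := gap_const T M).
  assert (HK : 0 < K) by (unfold K, gap_const; pose proof (exp_pos (4 * M * sqrt T)); lra).
  pose (q := Rabs (ln T) + 2).
  assert (Hq : 2 <= q) by (unfold q; pose proof (Rabs_pos (ln T)); lra).
  pose (KJ := 2 * M * (1 + K) * (2 * b) + M * K * (2 * b * q)
     + M * (M * (2 * b) + K * 2) + 2 * M).
  assert (HKJ : 0 <= 2 * M * (1 + K) * (2 * b) + M * K * (2 * b * q)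
     + M * (M * (2 * b) + K * 2)).
  { repeat apply Rplus_le_le_0_compat; repeat first [lra | apply Rmult_le_pos].
    apply Rplus_le_le_0_compat; repeat first [lra | apply Rmult_le_pos]. }
  pose proof (sqrt_pos b) as Hsb.
  apply (slit_regularity T M (1 / 2) ln (fun x => / x)
    (fun h => Rmax 0 (ln T - ln h)) log_modulus 1 (sqrt b + 2) KJ); try lra.
  - unfold KJ; lra.
  - intros x Hx; now apply is_derive_ln.
  - intros x Hx; rewrite Rpower_div_pow32; [|lra].
    replace (1 / 2 - 3 / 2) with (- (1)) by lra. rewrite Rpower_Ropp Rpower_1; lra.
  - intros h Hh; apply Rmax_l.
  - intros a h Hh Ha; eapply Rle_trans; [|apply Rmax_r].
    assert (ln a <= ln T); [|lra].
    destruct (Req_dec a T) as [->|N]; [lra | left; apply ln_increasing; lra].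
  - intros x y Hx Hy; now apply log_modulus_mono.
  - intros x Hx; rewrite Rmult_1_l; apply log_modulus_low; lra.
  - intros x Hx; now apply log_modulus_up.
  - fold K b; intros v u Hv Hu; destruct (sq_gap_bounds b v u Hv Hu) as [[G0 G1] G2].
    assert (G3 : (u - v) ^ 2 <= u ^ 2 - v ^ 2) by nra.
    set (h := u ^ 2 - v ^ 2) in *. set (x := u - v) in *.
    assert (Hx : 0 < x <= b) by (unfold x; lra).
    pose proof (log_modulus_low x ltac:(lra)) as Hl.
    replace (Rpower h (1 / 2) * sqrt h) with h.
    2:{ rewrite Rpower_mult_sqrt // -{1}(Rpower_1 h) //; f_equal; lra. }
    assert (HF : Rmax 0 (ln T - ln h) <= q * Rmax 1 (ln (1 / x))).
    { pose proof (Rmax_l 1 (ln (1 / x))) as M1; pose proof (Rmax_r 1 (ln (1 / x))) as M2.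
      apply Rmax_lub; [nra|].
      assert (E : - ln h <= 2 * ln (1 / x)).
      { replace (1 / x) with (/ x) by (field; lra). rewrite ln_Rinv; [|lra].
        assert (L : ln (x ^ 2) <= ln h).
        { destruct (Req_dec (x ^ 2) h) as [->|N]; [lra | left; apply ln_increasing; nra]. }
        replace (x ^ 2) with (x * x) in L by ring. rewrite ln_mult in L; lra. }
      pose proof (Rle_abs (ln T)). pose proof (Rabs_pos (ln T)). unfold q; nra. }
    assert (T1 : h <= 2 * b * log_modulus x).
    { eapply Rle_trans; [exact G1|]. apply Rmult_le_compat_l; lra. }
    assert (T2 : h * Rmax 0 (ln T - ln h) <= 2 * b * q * log_modulus x).
    { apply (Rle_trans _ (2 * b * x * (q * Rmax 1 (ln (1 / x))))).
      - apply Rmult_le_compat; auto; [lra | apply Rmax_l].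
      - unfold log_modulus; lra. }
    assert (T4 : h / u <= 2 * log_modulus x) by lra.
    assert (T5 : M * (M * h + K * h / u) <= M * (M * (2 * b * log_modulus x) + K * (2 * log_modulus x))).
    { apply Rmult_le_compat_l; [lra|]. apply Rplus_le_compat.
      - apply Rmult_le_compat_l; lra.
      - unfold Rdiv in *; rewrite Rmult_assoc; apply Rmult_le_compat_l; lra. }
    assert (T6 : 2 * M * (1 + K) * h <= 2 * M * (1 + K) * (2 * b * log_modulus x))
      by (apply Rmult_le_compat_l; auto; repeat first [lra | apply Rmult_le_pos]).
    assert (T7 : M * K * (h * Rmax 0 (ln T - ln h)) <= M * K * (2 * b * q * log_modulus x))
      by (apply Rmult_le_compat_l; auto; repeat first [lra | apply Rmult_le_pos]).
    assert (T8 : 0 <= 2 * M * log_modulus x) by (apply Rmult_le_pos; lra).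
    unfold KJ; lra.
  - intros u Hu; pose proof (log_modulus_low u ltac:(lra)) as Hl.
    assert (2 * M * u <= 2 * M * log_modulus u) by (apply Rmult_le_compat_l; lra).
    pose proof (Rmult_le_compat_r (log_modulus u) 0 _ ltac:(lra) HKJ).
    unfold KJ; lra.
Qed.

Theorem theorem5p2 :
  forall T M delta : R, 0 < T -> 0 < M -> 0 < delta <= 1 / 2 ->
  (delta < 1 / 2 ->
   exists N : R, 0 < N /\
   forall (lam : R -> R) (gam : R -> C),
     Rbar_le (Holder_seminorm (V := R_NormedModule) (1 / 2) 0 T lam) 1 ->
     in_Holder (V := R_NormedModule) 1 delta 0 T lam ->
     Rbar_le (Holder_norm (V := R_NormedModule) 1 delta 0 T lam) M ->
     generates_slit lam T gam ->
     Holder_regular 1 (1 / 2 + delta) 0 (sqrt T) (slit_sq gam) /\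
     Rbar_le (Holder_norm (V := C_R_NormedModule) 1 (1 / 2 + delta) 0 (sqrt T)
                (slit_sq gam)) N /\
     Rbar_le (1 / N)
       (Glb_Rbar (fun r => exists t, Icc 0 (sqrt T) t /\
          r = Cmod (Derive_within (V := C_R_NormedModule) 0 (sqrt T)
                      (slit_sq gam) t))))
  /\
  (delta = 1 / 2 ->
   exists N : R, 0 < N /\
   forall (lam : R -> R) (gam : R -> C),
     Rbar_le (Holder_seminorm (V := R_NormedModule) (1 / 2) 0 T lam) 1 ->
     in_Holder (V := R_NormedModule) 1 delta 0 T lam ->
     Rbar_le (Holder_norm (V := R_NormedModule) 1 delta 0 T lam) M ->
     generates_slit lam T gam ->
     (forall t, Icc 0 (sqrt T) t ->
        ex_derive_within (V := C_R_NormedModule) 0 (sqrt T) (slit_sq gam) t) /\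
     (forall t1 t2, 0 <= t1 -> t1 < t2 -> t2 <= sqrt T ->
        Cmod (Derive_within (V := C_R_NormedModule) 0 (sqrt T) (slit_sq gam) t1
              - Derive_within (V := C_R_NormedModule) 0 (sqrt T) (slit_sq gam) t2)
        <= N * Rabs (t1 - t2) * Rmax 1 (ln (1 / Rabs (t1 - t2))))).
Proof.
  intros T M delta HT HM Hd.
  assert (Hb : 0 < sqrt T) by now apply sqrt_lt_R0.
  split; intros Hlt.
  - destruct (slit_regularity_Holder T M delta HT HM ltac:(lra)) as [N [HN H]].
    exists (N + N + N); split; [lra|]; intros lam gam L1 L2 L3 L4.
    specialize (H lam gam L1 L2 L3 L4); cbv zeta in H.
    set (D := Derive_within (V := C_R_NormedModule) 0 (sqrt T) (slit_sq gam)) in *.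
    assert (HD : forall t1 t2, Icc 0 (sqrt T) t1 -> Icc 0 (sqrt T) t2 -> t1 <> t2 ->
      Cmod (D t1 - D t2) <= N * Rpower (Rabs (t1 - t2)) (1 / 2 + delta)).
    { intros t1 t2 H1 H2 Hne; destruct (Rlt_dec t1 t2) as [L|L].
      - rewrite Cmod_sub_sym Rabs_left; [|lra]. replace (- (t1 - t2)) with (t2 - t1) by ring.
        apply (H t2 H2); unfold Icc in *; lra.
      - rewrite Rabs_right; [|lra]. apply (H t1 H1); unfold Icc in *; lra. }
    assert (Hnorm : Rbar_le (Holder_norm (V := C_R_NormedModule) 1 (1 / 2 + delta) 0 (sqrt T)
      (slit_sq gam)) (N + N + N)).
    { apply (Rbar_plus_le_compat _ (N + N) _ N);
        [apply (Rbar_plus_le_compat _ N _ N)|].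
      - apply (sup_norm_le_iff (V := C_R_NormedModule)); intros t Ht.
        rewrite norm_C_R_Cmod; now apply H.
      - apply (sup_norm_le_iff (V := C_R_NormedModule)); intros t Ht.
        rewrite norm_C_R_Cmod; now apply H.
      - apply (Holder_seminorm_le_iff (V := C_R_NormedModule)); intros t1 t2 H1 H2 Hne.
        rewrite norm_C_R_Cmod; now apply HD. }
    assert (Hinv : 1 / (N + N + N) <= 1 / N)
      by (unfold Rdiv; rewrite !Rmult_1_l; apply Rinv_le_contravar; lra).
    assert (HN1 : 0 < 1 / N) by (apply Rdiv_lt_0_compat; lra).
    split; [split|split]; auto.
    + split.
      * intros k t Hk Ht; assert (k = 0%nat) as -> by lia; exists (D t); now apply H.
      * apply (is_finite_of_bounds _ (N + N + N)); auto.
        now apply (Holder_norm_1_ge_0 (V := C_R_NormedModule)).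
    + intros t Ht; split; [exists (D t); now apply H|].
      intros E; fold D in E. destruct (H t Ht) as [_ [_ [_ [Hl _]]]].
      rewrite E Cmod_0 in Hl; lra.
    + apply Glb_Rbar_correct; intros r [t [Ht ->]].
      apply (Rle_trans _ (1 / N)); auto. now apply H.
  - subst delta; destruct (slit_regularity_log T M HT HM) as [N [HN H]].
    exists N; split; auto; intros lam gam L1 L2 L3 L4.
    specialize (H lam gam L1 L2 L3 L4); cbv zeta in H; split.
    + intros t Ht; eexists; now apply H.
    + intros t1 t2 H1 H2 H3.
      rewrite Cmod_sub_sym Rabs_left; [|lra]. replace (- (t1 - t2)) with (t2 - t1) by ring.
      rewrite Rmult_assoc; apply (H t2 ltac:(unfold Icc; lra)); lra.
Qed.
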